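(* Let $(\Omega,\mathcal{B},\mu,\sigma,X,\|\cdot\|,L)$ be either a strongly measurable random dynamical system or a $\mu$-continuous random dynamical system, such that the function $\log^+\|L(1,\cdot)\|$ is $\mu$-integrable. Let $\mathcal{C}\subset X$ be a nice cone such that $L(1,\omega)\mathcal{C}\subset\mathcal{C}$ for all $\omega$. Suppose that there exist a positive measure subset $G_P$ of $\Omega$, a positive integer $k_P$, and a positive real number $D_P$ such that for all $\omega\in G_P$, $\operatorname{diam}_\theta(L(k_P,\omega)\mathcal{C})\le D_P$. Then there exists a $\sigma$-invariant set of full measure $\tilde\Omega\subset\Omega$ on which the following statements are true: (1) There exist measurable functions $v(\omega)\in X$ and $\eta(\omega,\cdot)\in X^*$ such that $$X=\operatorname{span}_{\mathbb{R}}\{v(\omega)\}\oplus\ker(\eta(\omega,\cdot))$$ is a measurable equivariant decomposition, the Lyapunov exponent for $v(\omega)$ is $\lambda_1$, and all vectors in $\ker(\eta(\omega,\cdot))$ have Lyapunov exponent strictly less than $\lambda_1$, unless $\lambda_1=-\infty$. (2) When $\lambda_1>-\infty$, we have $$\lambda_2\le\lambda_1-\frac{\mu(G_P)}{k_P}\log\left(\tanh\left(\tfrac14 D_P\right)^{-1}\right).$$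
   Context: Nice cones. Let $(X,\|\cdot\|)$ be a real Banach space. A cone is a set $\mathcal{C}\subset X$ with $\lambda\mathcal{C}\subset\mathcal{C}$ for all $\lambda>0$. It is a nice cone if: it is convex; $0\notin\mathcal{C}$; $\mathcal{C}\cap(-\mathcal{C})=\emptyset$; $\mathcal{C}\cup\{0\}$ is closed; $\mathcal{C}-\mathcal{C}=X$ (generating); and it is $D$-adapted for some real $D\ge1$, i.e. for $x\in X$, $y\in\mathcal{C}$, if $y+x$ and $y-x$ both lie in $\mathcal{C}\cup\{0\}$ then $\|x\|\le D\|y\|$. Write $x\preceq y$ iff $y-x\in\mathcal{C}\cup\{0\}$. Projective metric. For $v,w\in\mathcal{C}$: $\alpha(v,w)=\sup\{\lambda\ge0:\lambda v\preceq w\}$, $\beta(v,w)=\inf\{\mu\ge0:w\preceq\mu v\}$ ($+\infty$ if there is no such $\mu$), $\theta(v,w)=\log(\beta(v,w)/\alpha(v,w))\in[0,\infty]$ ($=\infty$ if $\alpha=0$ or $\beta=\infty$). For $S\subset\mathcal{C}$, $\operatorname{diam}_\theta(S)=\sup_{v,w\in S}\theta(v,w)$. Random dynamical systems. $(\Omega,\mathcal{B},\mu,\sigma)$ is an ergodic, invertible, probability-preserving transformation, $\mathcal{B}(X)$ is the space of bounded linear operators on $X$, $L:\Omega\to\mathcal{B}(X)$ is a map with $L(1,\omega)=L(\omega)$, and $L(n,\omega)=L(1,\sigma^{n-1}(\omega))\cdots L(1,\omega)$. - The tuple is a strongly measurable random dynamical system if $X$ is separable and $L$ is measurable for the Borel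 $\sigma$-algebra of the strong operator topology on $\mathcal{B}(X)$ (equivalently, $\omega\mapsto L(\omega)x$ is Borel measurable for each $x\in X$). - The tuple is a $\mu$-continuous random dynamical system if $\Omega$ is (homeomorphic to) a Borel subset of a Polish space, $\mu$ is a Borel measure, $\sigma$ is a homeomorphism, and $L$ is $\mu$-continuous for the operator norm topology ($X$ need not be separable). A map $f$ from $\Omega$ to a topological space is $\mu$-continuous if there is an increasing sequence of compact sets $K_n\subset\Omega$ with $\mu(\bigcup_nK_n)=1$ such that $f$ is continuous on each $K_n$. Measurability in the conclusion. In the strongly measurable case, ''measurable'' means: $v$ is measurable for the norm Borel $\sigma$-algebra of $X$, $\omega\mapsto\eta(\omega,x)$ is measurable for each $x\in X$, and the projections onto the two summands are strongly measurable. In the $\mu$-continuous case it means: $v$, $\eta$ and the projections are $\mu$-continuous for the norms of $X$, $X^*$, and $\mathcal{B}(X)$ respectively. Equivariant means $L(1,\omega)$ maps $\operatorname{span}\{v(\omega)\}$ into $\operatorname{span}\{v(\sigma(\omega))\}$ and $\ker\eta(\omega,\cdot)$ into $\ker\eta(\sigma(\omega),\cdot)$. Lyapunov exponents. The Lyapunov exponent of $x\in X$ at $\omega$ is $\limsup_{n\to\infty}\frac1n\log\|L(n,\omega)x\|$. $\lambda_1=\lim_{n\to\infty}\frac1n\log\|L(n,\omega)\|\in[-\infty,\infty)$ is the ($\mu$-a.e. constant) maximal Lyapunov exponent, and $\lambda_2$ is the second-largest Lyapunov exponent, i.e. the growth rate $\limsup_{n\to\infty}\frac1n\log\|L(n,\omega)|_{\ker\eta(\omega,\cdot)}\|$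 on the complementary equivariant family. *)

(* Defs.v *)
From HB Require Import structures.
From mathcomp Require Import all_boot all_order all_algebra.
From mathcomp Require Import all_classical all_reals all_analysis.

Set Implicit Arguments.
Unset Strict Implicit.
Unset Printing Implicit Defensive.

Import Order.TTheory GRing.Theory Num.Theory.
Import numFieldNormedType.Exports.

Local Open Scope classical_set_scope.
Local Open Scope ring_scope.

Section opnorm.
Context {R : realType} {X Y : normedModType R}.

(* The operator norm of [f] restricted to the subspace [V]; it is only meant
   for [f] bounded, as [sup] is [0] on unbounded sets. *)
Definition opnorm_on (V : set X) (f : X -> Y) : R :=
  sup [set `|f x| | x in V `&` [set x | `|x| <= 1]].

Definition bounded_linear : {pred X -> Y} :=
  fun f => `[< linear f /\ continuous f >].

Fact bounded_linear_submod_closed : submod_closed bounded_linear.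
Proof.
split=> [|a f g].
  apply/asboolP; split=> [a x y|]; last exact: cst_continuous.
  by change (0 = a *: 0 + 0 :> Y); rewrite scaler0 addr0.
move=> /asboolP[lf cf] /asboolP[lg cg]; apply/asboolP; split=> [b x y|].
  change (a *: f (b *: x + y) + g (b *: x + y) =
          b *: (a *: f x + g x) + (a *: f y + g y)).
  by rewrite lf lg !scalerDr !scalerA [a * b]mulrC addrACA.
move=> x; change ((fun z => a *: f z + g z) @ x --> a *: f x + g x).
by apply: cvgD; [apply: cvgZl_tmp; exact: cf|exact: cg].
Qed.

HB.instance Definition _ := GRing.isSubmodClosed.Build R (X -> Y)
  bounded_linear bounded_linear_submod_closed.

End opnorm.

Section blin_def.
Context {R : realType} (X Y : normedModType R).

Record blin : Type := Blin {
  blin_fun :> X -> Y ;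
  blin_prop : blin_fun \in @bounded_linear R X Y }.

HB.instance Definition _ := [isSub for blin_fun].
HB.instance Definition _ := gen_eqMixin blin.
HB.instance Definition _ := gen_choiceMixin blin.
HB.instance Definition _ := [SubChoice_isSubLmodule of blin by <:].

End blin_def.

Section blin_theory.
Context {R : realType} {X Y : normedModType R}.
Implicit Types f g : blin X Y.

Lemma blin_linear f : linear f.
Proof. by have /asboolP[] := blin_prop f. Qed.

Lemma blin_continuous f : continuous f.
Proof. by have /asboolP[] := blin_prop f. Qed.

HB.instance Definition _ f := GRing.isLinear.Build R X Y *:%R f (blin_linear f).

Lemma opnorm_has_sup f :
  has_sup [set `|f x| | x in setT `&` [set x | `|x| <= 1]].
Proof.
split.
  by exists `|f 0|, 0 => //; split => //=; rewrite normr0.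
pose lf : {linear X -> Y} := f.
have : bounded_near lf (nbhs 0).
  by apply/linear_bounded_continuous; exact: blin_continuous.
move=> /linear_boundedP/pinfty_ex_gt0[M M0 fM].
exists M => _ [x [_ /= x1] <-].
by rewrite (le_trans (fM x))// ler_piMr// ltW.
Qed.

Lemma opnorm_ge0 f : 0 <= opnorm_on setT f.
Proof.
apply: sup_upper_bound; first exact: opnorm_has_sup.
by exists 0; [split => //=; rewrite normr0|rewrite linear0 normr0].
Qed.

Lemma ler_opnorm f x : `|f x| <= opnorm_on setT f * `|x|.
Proof.
have [->|x0] := eqVneq x 0; first by rewrite linear0 !normr0 mulr0.
have nx : 0 < `|x| by rewrite normr_gt0.
rewrite -ler_pdivrMr//; apply: sup_upper_bound; first exact: opnorm_has_sup.
exists (`|x|^-1 *: x).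
  by split => //=; rewrite normrZ ger0_norm ?invr_ge0// mulVf// gt_eqF.
by rewrite linearZ/= normrZ ger0_norm ?invr_ge0// mulrC.
Qed.

Lemma opnorm_le f M : (forall x, `|x| <= 1 -> `|f x| <= M) ->
  opnorm_on setT f <= M.
Proof.
move=> fM; apply: ge_sup; first by have [] := opnorm_has_sup f.
by move=> _ [x [_ /= x1] <-]; exact: fM.
Qed.

Lemma blinD f g x : (f + g) x = f x + g x.
Proof. by []. Qed.

Lemma blinZ (a : R) f x : (a *: f) x = a *: f x.
Proof. by []. Qed.

Fact opnormD f g :
  opnorm_on setT (f + g) <= opnorm_on setT f + opnorm_on setT g.
Proof.
apply: opnorm_le => x x1.
apply: (le_trans (ler_normD _ _)); apply: lerD;
  by apply: (le_trans (ler_opnorm _ _)); rewrite ler_piMr// opnorm_ge0.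
Qed.

Fact opnormZ (a : R) f : opnorm_on setT (a *: f) = `|a| * opnorm_on setT f.
Proof.
have le b g : opnorm_on setT (b *: g) <= `|b| * opnorm_on setT g.
  apply: opnorm_le => x x1; rewrite blinZ normrZ ler_wpM2l//.
  by apply: (le_trans (ler_opnorm _ _)); rewrite ler_piMr// opnorm_ge0.
have [->|a0] := eqVneq a 0.
  by apply/eqP; rewrite eq_le le normr0 mul0r; exact: opnorm_ge0.
apply/eqP; rewrite eq_le le -ler_pdivlMl ?normr_gt0// -normfV.
by rewrite -[in leLHS](scalerK a0 f) le.
Qed.

Fact opnorm_eq0 f : opnorm_on setT f = 0 -> f = 0.
Proof.
move=> f0; apply/val_inj/funext => x /=.
by apply/eqP; rewrite -normr_le0 (le_trans (ler_opnorm f x))// f0 mul0r.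
Qed.

HB.instance Definition _ := @Lmodule_isNormed.Build R (blin X Y)
  (fun f => opnorm_on setT f) opnormD opnormZ opnorm_eq0.

Lemma blin_normE f : `|f| = opnorm_on setT f.
Proof. by []. Qed.

End blin_theory.

Fact blin_id_prop {R : realType} (X : normedModType R) :
  id \in @bounded_linear R X X.
Proof. by apply/asboolP; split=> // x; exact: cvg_id. Qed.

Definition blin_id {R : realType} (X : normedModType R) : blin X X :=
  Blin (blin_id_prop X).

Fact blin_comp_prop {R : realType} (X Y Z : normedModType R)
  (g : blin Y Z) (f : blin X Y) : g \o f \in @bounded_linear R X Z.
Proof.
apply/asboolP; split=> [a x y|x]; first by rewrite /= !linearP.
by apply: continuous_comp; exact: blin_continuous.
Qed.

Definition blin_comp {R : realType} (X Y Z : normedModType R)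
  (g : blin Y Z) (f : blin X Y) : blin X Z := Blin (blin_comp_prop g f).

Section cones.
Context {R : realType} {X : normedModType R}.
Implicit Type C : set X.

Definition is_cone C : Prop :=
  forall l : R, 0 < l -> [set l *: x | x in C] `<=` C.

Definition cone_le C (x y : X) : Prop := (C `|` [set 0]) (y - x).

Definition adapted C (D : R) : Prop :=
  forall x y : X, C y ->
    (C `|` [set 0]) (y + x) -> (C `|` [set 0]) (y - x) -> `|x| <= D * `|y|.

Record nice_cone C : Prop := NiceCone {
  nice_is_cone : is_cone C ;
  nice_convex : convex_set (C : set (convex_lmodType X)) ;
  nice_not0 : ~ C 0 ;
  nice_salient : C `&` [set - x | x in C] = set0 ;
  nice_closed : closed (C `|` [set 0]) ;
  nice_generating : [set x - y | x in C & y in C] = [set: X] ;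
  nice_adapted : exists2 D : R, 1 <= D & adapted C D }.

Definition proj_alpha C (v w : X) : \bar R :=
  ereal_sup [set l%:E | l in [set l : R | 0 <= l /\ cone_le C (l *: v) w]].

Definition proj_beta C (v w : X) : \bar R :=
  ereal_inf [set m%:E | m in [set m : R | 0 <= m /\ cone_le C w (m *: v)]].

(* For [v] and [w] in a nice cone, [proj_alpha] is never [+oo] and
   [proj_beta] is nonzero, so that [fine] loses nothing in the last branch. *)
Definition proj_metric C (v w : X) : \bar R :=
  if (proj_alpha C v w == 0%E) || (proj_beta C v w == +oo%E) then +oo%E
  else (ln (fine (proj_beta C v w) / fine (proj_alpha C v w)))%:E.

Definition proj_diam C (S : set X) : \bar R :=
  ereal_sup [set proj_metric C v w | v in S & w in S].

End cones.

Notation borel T := (g_sigma_algebraType (@open T)).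

Definition separable (T : topologicalType) : Prop :=
  exists2 D : set T, countable D & dense D.

(* [T] is homeomorphic to a Borel subset of a Polish space: the third clause
   says that [h] is an embedding. *)
Definition borel_in_polish (R : realType) (T : topologicalType) : Prop :=
  exists (P : completePseudoMetricType R) (h : T -> P),
    [/\ hausdorff_space P /\ separable P,
        injective h,
        @open T = [set h @^-1` U | U in @open P] &
        <<s @open P >> (range h)].

(* [f] is only relevant on [D]; the plain notion is the case [D = setT]. *)
Definition mu_continuous (R : realType) (T : ptopologicalType)
    (mu : probability (borel T) R) (D : set T)
    (Y : topologicalType) (f : T -> Y) : Prop :=
  exists K : nat -> set T,
    [/\ forall n, compact (K n),
        forall n, K n `<=` D,
        forall n, K n `<=` K n.+1,
        mu (\bigcup_n K n) = 1%E &
        forall n, {within K n, continuous f}].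

(* For separable [X] this is measurability with respect to the Borel
   sigma-algebra of the strong operator topology. *)
Definition strongly_measurable (R : realType) d (Omega : measurableType d)
    (X Y : normedModType R) (D : set Omega) (f : Omega -> blin X Y) : Prop :=
  forall x : X, measurable_fun D (fun w => f w x : borel Y).

Record ergodic_invertible (R : realType) d (Omega : measurableType d)
    (mu : probability Omega R) (sigma : Omega -> Omega) : Prop := {
  erg_measurable : measurable_fun setT sigma ;
  erg_invertible : exists2 tau : Omega -> Omega,
    cancel sigma tau /\ cancel tau sigma & measurable_fun setT tau ;
  erg_preserving : forall A, measurable A -> mu (sigma @^-1` A) = mu A ;
  erg_ergodic : forall A, measurable A -> sigma @^-1` A = A ->
    mu A = 0%E \/ mu A = 1%E }.

Definition homeomorphism (T : topologicalType) (sigma : T -> T) : Prop :=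
  continuous sigma /\ exists2 tau : T -> T,
    cancel sigma tau /\ cancel tau sigma & continuous tau.

(* What measurability means for functions from a subset of [Omega]
   to [X], to the dual of [X], and to the bounded operators on [X]. *)
Record regularity (R : realType) (X : normedModType R) (Omega : Type) := {
  reg_vec : set Omega -> (Omega -> X) -> Prop ;
  reg_dual : set Omega -> (Omega -> blin X R^o) -> Prop ;
  reg_op : set Omega -> (Omega -> blin X X) -> Prop }.

Definition measurable_regularity (R : realType) (X : normedModType R)
    d (Omega : measurableType d) : regularity X Omega := {|
  reg_vec := fun D v => measurable_fun D (v : Omega -> borel X) ;
  reg_dual := fun D eta =>
    forall x : X, measurable_fun D (fun w => eta w x : R) ;
  reg_op := fun D P => strongly_measurable D P |}.

Definition mu_continuous_regularity (R : realType) (X : normedModType R)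
    (T : ptopologicalType) (mu : probability (borel T) R) :
    regularity X (borel T) := {|
  reg_vec := fun D v => mu_continuous mu D v ;
  reg_dual := fun D eta => mu_continuous mu D eta ;
  reg_op := fun D P => mu_continuous mu D P |}.

(* The two kinds of random dynamical systems, each with its notion of
   measurability. *)
Inductive is_rds (R : realType) (X : completeNormedModType R) :
  forall d (Omega : measurableType d), probability Omega R ->
    (Omega -> Omega) -> (Omega -> blin X X) -> regularity X Omega -> Prop :=
| StronglyMeasurableRDS d (Omega : measurableType d)
    (mu : probability Omega R) (sigma : Omega -> Omega)
    (L : Omega -> blin X X) :
    ergodic_invertible mu sigma ->
    separable X ->
    strongly_measurable setT L ->
    is_rds mu sigma L (measurable_regularity X Omega)
| MuContinuousRDS (T : ptopologicalType)
    (mu : probability (borel T) R) (sigma : T -> T) (L : T -> blin X X) :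
    ergodic_invertible mu (sigma : borel T -> borel T) ->
    borel_in_polish R T ->
    homeomorphism sigma ->
    mu_continuous mu setT L ->
    @is_rds R X _ (borel T) mu sigma L (mu_continuous_regularity X mu).

Section cocycles.
Context {R : realType} {X : normedModType R} {Omega : Type}.
Variables (sigma : Omega -> Omega) (L : Omega -> blin X X).

Fixpoint cocycle (n : nat) (w : Omega) : blin X X :=
  if n is m.+1 then blin_comp (L (iter m sigma w)) (cocycle m w)
  else blin_id X.

(* [lne 0 = -oo], so a vector that is eventually killed has exponent [-oo]. *)
Definition log_rate (a : nat -> R) : nat -> \bar R :=
  fun n => ((n%:R^-1)%:E * lne (a n)%:E)%E.

Definition lyapunov_exponent (w : Omega) (x : X) : \bar R :=
  limn_esup (log_rate (fun n => `|cocycle n w x|)).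

Definition growth_rate_on (V : set X) (w : Omega) : \bar R :=
  limn_esup (log_rate (fun n => opnorm_on V (cocycle n w))).

End cocycles.

(* Integrability with respect to the completion of [mu]: a [mu]-continuous
   function need only be Borel measurable off a null set. *)
Definition ae_integrable (R : realType) d (Omega : measurableType d)
    (mu : probability Omega R) (f : Omega -> R) : Prop :=
  exists A : set Omega,
    [/\ measurable A, mu A = 1%E & mu.-integrable A (EFin \o f)].

Definition log_plus (R : realType) (x : R) : R := Num.max 0 (ln x).

Definition is_max_lyapunov_exponent (R : realType) (X : normedModType R)
    d (Omega : measurableType d) (mu : probability Omega R)
    (sigma : Omega -> Omega) (L : Omega -> blin X X) (l : \bar R) : Prop :=
  (l < +oo)%E /\
  {ae mu, forall w, log_rate (fun n => `|cocycle sigma L n w|) @ \oo --> l}.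

Section decompositions.
Context {R : realType} {X : normedModType R}.

Definition line (v : X) : set X := [set a *: v | a in [set: R]].

Definition ker (f : blin X R^o) : set X := [set x | f x = 0].

Definition direct_sum (V W : set X) : Prop :=
  [set x + y | x in V & y in W] = [set: X] /\ V `&` W = [set 0].

Definition projection_along (V W : set X) (P : X -> X) : Prop :=
  forall x y, V x -> W y -> P (x + y) = x.

End decompositions.

Definition tanh (R : realType) (x : R) : R :=
  (expR x - expR (- x)) / (expR x + expR (- x)).

(* Main.v *)
Require Import Defs.
From HB Require Import structures.
From mathcomp Require Import all_boot all_order all_algebra.
From mathcomp Require Import all_classical all_reals all_analysis.
From mathcomp Require Import measurable_realfun ring lra zify.

Set Implicit Arguments.
Unset Strict Implicit.
Unset Printing Implicit Defensive.

Import Order.TTheory GRing.Theory Num.Theory.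
Import numFieldNormedType.Exports.

Local Open Scope classical_set_scope.
Local Open Scope ring_scope.

(* If a v <= x <= b v in the order of the cone, the images of x and v are again
   related by such bounds, and by Hopf's lemma an operator whose image has projective
   diameter D_P shrinks the width b - a by the factor tanh (D_P / 4).  A visit to G_P
   starts a block of k_P steps which contracts in this way, so after n steps the
   width has been multiplied by tanh (D_P / 4) to a power of about
   mu(G_P) n / k_P.  Pushing a vector of the cone forward from the past therefore
   converges to a direction v, while for x in the cone the ratio of L(n) x to
   L(n) v converges to a number eta(x), linear in x:
   |L(n) x - eta(x) L(n) v| is at most a constant times
   tanh (D_P / 4)^(mu(G_P) n / k_P) |x| |L(n) v|, which for x in ker eta is the
   spectral gap.

   The growth of |L(n) v| is a Birkhoff sum of log |L v|, which is integrable
   from above but possibly not from below, whence the exponent -oo.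

   Both v and eta are limits of explicit functions of the cocycle.  In the
   separable case measurability passes to pointwise limits; in the mu-continuous
   case the limits are uniform on compact sets of measure close to 1, on which
   all the approximations are continuous, so the limits are continuous there. *)

(** * Contraction of the order of a nice cone *)

(** The order estimates only see vectors of the cone, while the theorem concerns all of [X]. The
    bridge is quantitative: by Baire's theorem a generating cone decomposes every x as y - z with
    |y| and |z| at most M |x|, and by [D]-adaptedness order bounds become norm bounds. The rate is
    tanh (D_P / 4) because a diameter D_P bounds ratios by q^2 with q = exp (D_P / 2), and the
    oscillation lemma contracts by (q - 1) / (q + 1). Overlapping returns to G_P cannot all be used,
    so the blocks are chosen disjoint, which costs the factor 1 / k_P. The direction v depends on
    visits in the past and eta on visits in the future, so points are required to be recurrent both
    ways. As L need not be onto, the growth rate on the kernel is only shown to be monotone along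
    orbits; invariance of the measure and ergodicity still make it constant. As log |L v| may have
    integral -oo, the ergodic theorem takes a one-sided form: affine upper bounds for every slope
    above the mean, affine lower bounds for every slope below it. *)

Section cone_order.
Context {R : realType} {X : normedModType R}.
Variables (C : set X).
Hypothesis niceC : nice_cone C.
Implicit Types (a b : R) (x y z v w : X).

Local Notation K := (C `|` [set 0]).
Local Notation "x <=: y" := (cone_le C x y) (at level 70).

Lemma cone_scale a x : 0 < a -> C x -> C (a *: x).
Proof. by move=> a0 Cx; apply: (nice_is_cone niceC a0); exists x. Qed.

Lemma cone_neq0 x : C x -> x != 0.
Proof. by move=> Cx; apply/eqP => x0; apply: (nice_not0 niceC); rewrite -x0. Qed.

Lemma cone_add x y : C x -> C y -> C (x + y).
Proof.
move=> Cx Cy.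
have cC := nice_convex niceC.
have h0 : (0 : R) <= 2^-1 by rewrite invr_ge0.
have h1 : (2^-1 : R) <= 1 by rewrite invf_le1 ?ler1n.
have := cC x y (Itv01 h0 h1); rewrite !inE => /(_ Cx Cy) h.
have -> : x + y = 2 *: (2^-1 *: x + (1 - 2^-1) *: y).
  rewrite scalerDr !scalerA mulrBr mulr1 mulfV ?pnatr_eq0// scale1r.
  by rewrite [2 - 1](_ : _ = 1 :> R) ?scale1r//; ring.
exact: cone_scale.
Qed.

Lemma cone0_add x y : K x -> K y -> K (x + y).
Proof.
move=> [Cx|->]; last by rewrite add0r.
by move=> [Cy|->]; [left; exact: cone_add|rewrite addr0; left].
Qed.

Lemma cone_addr x y : C x -> K y -> C (x + y).
Proof. by move=> Cx [Cy|->]; [exact: cone_add|rewrite addr0]. Qed.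

Lemma cone0_scale a x : 0 <= a -> K x -> K (a *: x).
Proof.
rewrite le_eqVlt => /predU1P[<-|a0]; first by rewrite scale0r; right.
by move=> [Cx|->]; [left; exact: cone_scale|rewrite scaler0; right].
Qed.

Lemma cone0N x : C x -> ~ K (- x).
Proof.
move=> Cx [CNx|/eqP]; last by rewrite oppr_eq0 (negPf (cone_neq0 Cx)).
have : (C `&` [set - y | y in C]) (- x) by split => //; exists x.
by rewrite (nice_salient niceC).
Qed.

Lemma cone_nonempty : exists g, C g.
Proof.
have : [set: X] 0 by [].
by rewrite -(nice_generating niceC) => -[x Cx _]; exists x.
Qed.

Lemma cone_le0 x : 0 <=: x = K x.
Proof. by rewrite /cone_le subr0. Qed.

Lemma cone_lexx x : x <=: x.
Proof. by rewrite /cone_le subrr; right. Qed.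

Lemma cone_le_trans y x z : x <=: y -> y <=: z -> x <=: z.
Proof.
by move=> xy yz; rewrite /cone_le -(subrK y z) -addrA; exact: cone0_add.
Qed.

Lemma cone_leD x y z w : x <=: y -> z <=: w -> x + z <=: y + w.
Proof. by move=> xy zw; rewrite /cone_le opprD addrACA; exact: cone0_add. Qed.

Lemma cone_leN x y : x <=: y -> - y <=: - x.
Proof. by rewrite /cone_le opprK addrC. Qed.

Lemma cone_leZr a b v : K v -> a <= b -> a *: v <=: b *: v.
Proof.
by move=> Kv ab; rewrite /cone_le -scalerBl; apply: cone0_scale => //; rewrite subr_ge0.
Qed.

Lemma cone_leZr_inv a b v : C v -> a *: v <=: b *: v -> a <= b.
Proof.
move=> Cv; rewrite /cone_le -scalerBl leNgt => Kab; apply/negP => ba.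
apply: (@cone0N ((a - b) *: v)); first by apply: cone_scale; rewrite ?subr_gt0.
by rewrite -scaleNr opprB.
Qed.

Lemma cone_le_blin (A : blin X X) x y : [set A x | x in C] `<=` C ->
  x <=: y -> A x <=: A y.
Proof.
rewrite /cone_le => Apos [Cxy|xy0]; rewrite -raddfB; first by left; apply: Apos; exists (y - x).
by rewrite (xy0 : y - x = 0) raddf0; right.
Qed.

Lemma cone_le_cvg (x y : nat -> X) (a b : X) : x @ \oo --> a -> y @ \oo --> b ->
  (forall n, x n <=: y n) -> a <=: b.
Proof.
move=> xa yb xy; have cvgyx : (fun n => y n - x n) @ \oo --> b - a by exact: cvgB.
rewrite /cone_le.
apply: (@closed_cvg _ _ _ _ _ K (nice_closed niceC) _ _ cvgyx).
by apply: nearW => n; exact: xy.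
Qed.

Lemma cone_le_cone v w a : 0 < a -> C v -> a *: v <=: w -> C w.
Proof.
move=> a0 Cv; rewrite /cone_le => h; rewrite -(subrKC (a *: v) w).
by apply: cone_addr => //; exact: cone_scale.
Qed.

Lemma cone_le_anti x y : x <=: y -> y <=: x -> x = y.
Proof.
rewrite /cone_le => -[Cxy|]; last by move/eqP; rewrite subr_eq0 => /eqP.
by rewrite -opprB => /(cone0N Cxy).
Qed.

Section norms.
Variable D : R.
Hypothesis Dad : adapted C D.

Lemma adapted_mono x y : K x -> x <=: y -> C y -> `|x| <= D * `|y|.
Proof. by move=> Kx xy Cy; apply: Dad => //; apply: cone0_add => //; left. Qed.

(** Adaptedness compares [w - c *: v] with [(b - a) *: v]: the two vectors to test split as
    [(w - a *: v) + (b - c) *: v] and [(b *: v - w) + (c - a) *: v]. When [a = b] the second vector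
    of the comparison is 0, outside the cone, and antisymmetry is used instead. *)
Lemma adapted_osc a b c v w : C v -> a *: v <=: w -> w <=: b *: v ->
  a <= c -> c <= b -> `|w - c *: v| <= D * ((b - a) * `|v|).
Proof.
move=> Cv avw wbv ac cb.
have [ba|ab] := leP b a.
  have [ab cc] : a = b /\ c = b by lra.
  rewrite cc (@cone_le_anti w (b *: v)) ?ab ?subrr ?normr0 ?mul0r ?mulr0//.
  by rewrite -ab.
have ab0 : 0 < b - a by rewrite subr_gt0.
rewrite -(gtr0_norm ab0) -normrZ; apply: Dad.
- exact: cone_scale.
- rewrite [_ + _](_ : _ = (w - a *: v) + (b - c) *: v); last first.
    rewrite addrCA -addrA; congr (_ + _); rewrite -!scaleNr -!scalerDl.
    by congr (_ *: _); ring.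
  by apply: cone0_add => //; apply: cone0_scale; [rewrite subr_ge0|left].
- rewrite [_ - _](_ : _ = (b *: v - w) + (c - a) *: v); last first.
    rewrite [RHS]addrAC opprB addrA -!scalerDl.
    by congr (_ *: _ - _); ring.
  by apply: cone0_add => //; apply: cone0_scale; [rewrite subr_ge0|left].
Qed.

End norms.

(* Hopf's oscillation lemma: both [w - a v] and [b v - w] lie in the cone, so
   that their images are comparable, and this improves both bounds. *)
Lemma hopf_contraction (A : blin X X) q v w a b : 1 < q ->
  [set A x | x in C] `<=` C ->
  (forall x y, C x -> C y ->
    exists2 l, 0 < l & l *: A x <=: A y /\ A y <=: (q ^+ 2 * l) *: A x) ->
  C v -> a *: v <=: w -> w <=: b *: v ->
  exists a' b', [/\ a <= a', b' <= b, b' - a' <= (q - 1) / (q + 1) * (b - a),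
    a' *: A v <=: A w & A w <=: b' *: A v].
Proof.
move=> q1 Apos Abnd Cv avw wbv.
have ab : a <= b by apply: (cone_leZr_inv Cv); exact: cone_le_trans wbv.
have t0 : 0 <= (q - 1) / (q + 1) * (b - a).
  by rewrite mulr_ge0 ?divr_ge0 ?subr_ge0//; lra.
have := avw; rewrite /cone_le => -[Cw|/eqP]; last first.
  rewrite subr_eq0 => /eqP wE; exists a, a.
  by rewrite subrr wE linearZ; split => //; exact: cone_lexx.
have := wbv; rewrite /cone_le => -[Cb|/eqP]; last first.
  rewrite subr_eq0 => /eqP wE; exists b, b.
  by rewrite subrr -wE linearZ; split => //; exact: cone_lexx.
have [l l0 []] := Abnd _ _ Cw Cb.
set V := A v; set W := A w.
have -> : A (w - a *: v) = W - a *: V by rewrite raddfB /= linearZ.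
have -> : A (b *: v - w) = b *: V - W by rewrite raddfB /= linearZ.
move=> h1 h2.
pose m := q ^+ 2 * l; have m0 : 0 < m by rewrite mulr_gt0// exprn_gt0//; lra.
(* With [p = m] and [p = l] this turns the two comparisons of [W - a *: V] with [b *: V - W] into a
   lower and an upper bound of [W] by multiples of [V]. *)
have key (p : R) : 0 < p -> p *: (W - a *: V) - (b *: V - W) =
    (1 + p) *: (W - ((b + p * a) / (1 + p)) *: V).
  move=> p0; rewrite [in RHS]scalerBr scalerA [(1 + p) * _]mulrC divfK; last first.
    by rewrite gt_eqF//; lra.
  rewrite scalerBr scalerA !scalerDl scale1r opprB opprD addrACA [p *: W + W]addrC.
  by congr (_ + _); exact: addrC.
exists ((b + m * a) / (1 + m)), ((b + l * a) / (1 + l)).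
split.
- by rewrite ler_pdivlMr; nra.
- by rewrite ler_pdivrMr; nra.
- rewrite [leLHS](_ : _ = (b - a) * ((m - l) / ((1 + l) * (1 + m)))); last first.
    by field; rewrite !gt_eqF//; lra.
  rewrite mulrC ler_wpM2r ?subr_ge0// ler_pdivrMr; last by apply: mulr_gt0; lra.
  rewrite mulrAC ler_pdivlMr; last by lra.
  (* The ratio [(m - l) / ((1 + l) * (1 + m))] is largest at [l = q^-1], where it equals
     [(q - 1) / (q + 1)]; the square measures the defect elsewhere. *)
  rewrite -subr_ge0 [leRHS](_ : _ = (q - 1) * (q * l - 1) ^+ 2); last by rewrite /m; ring.
  by rewrite mulr_ge0 ?sqr_ge0//; lra.
- rewrite /cone_le -(scalerK (_ : 1 + m != 0) (W - _)); last by rewrite gt_eqF//; lra.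
  apply: cone0_scale; first by rewrite invr_ge0; lra.
  by rewrite -key.
- rewrite /cone_le -(scalerK (_ : 1 + l != 0) (_ - W)); last by rewrite gt_eqF//; lra.
  apply: cone0_scale; first by rewrite invr_ge0; lra.
  by rewrite -[_ - W]opprB scalerN -key// opprB.
Qed.

(** Adaptedness bounds the admissible multiples, and closedness of the cone with 0 makes the
    supremum itself admissible. *)
Lemma proj_alphaP v w : C v -> C w ->
  exists2 a, 0 <= a & proj_alpha C v w = a%:E /\ a *: v <=: w.
Proof.
move=> Cv Cw.
pose S := [set l : R | 0 <= l /\ l *: v <=: w].
have S0 : S 0 by split => //; rewrite scale0r cone_le0; left.
have [B SB] : exists B : R, forall l, S l -> l <= B.
  have [D D1 Dad] := nice_adapted niceC.
  exists (D * `|w| / `|v|) => l [l0 lv].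
  rewrite ler_pdivlMr ?normr_gt0 ?cone_neq0// -{1}(ger0_norm l0) -normrZ.
  by apply: adapted_mono lv Cw => //; apply: cone0_scale => //; left.
have hs : has_sup S by split; [exists 0|exists B].
have sup0 : 0 <= sup S by exact: sup_upper_bound.
exists (sup S) => //; split.
  by rewrite /proj_alpha ereal_sup_EFin; [|exists B|exists 0].
have h n : exists l, S l /\ sup S - n.+1%:R^-1 < l.
  have n0 : 0 < n.+1%:R^-1 :> R by rewrite invr_gt0 ltr0n.
  by have [l Sl ll] := sup_adherent n0 hs; exists l.
have /choice[u uP] := h.
have uS : u @ \oo --> sup S.
  apply/cvgrPdist_lt => e e0; near=> n.
  have [Su /ltW uu] := uP n.
  rewrite ger0_norm ?subr_ge0; last exact: sup_upper_bound.
  rewrite ltrBlDr -ltrBlDl; apply: le_lt_trans (_ : sup S - n.+1%:R^-1 < _).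
    rewrite lerD2l lerN2 ltW//; near: n; exact: near_infty_natSinv_lt (PosNum e0).
  by have [] := uP n.
apply: (@cone_le_cvg (fun n => u n *: v) (fun=> w)).
- by apply: cvgZr_tmp.
- exact: cvg_cst.
- by move=> n; have [[]] := uP n.
Unshelve. all: by end_near. Qed.

(** The infimum is attained by closedness, and it is positive since otherwise [- w] would lie in the
    cone with 0. *)
Lemma proj_betaP v w : C v -> C w -> proj_beta C v w != +oo%E ->
  exists2 b, 0 < b & proj_beta C v w = b%:E /\ w <=: b *: v.
Proof.
move=> Cv Cw bfin.
pose S := [set l : R | 0 <= l /\ w <=: l *: v].
have [l1 Sl1] : S !=set0.
  apply/set0P/eqP => S0; move: bfin; rewrite /proj_beta -/S S0 image_set0.
  by rewrite ereal_inf0 eqxx.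
have hs : has_inf S by split; [exists l1|exists 0 => l []].
have infle : w <=: inf S *: v.
  have h n : exists l, S l /\ l < inf S + n.+1%:R^-1.
    have n0 : 0 < n.+1%:R^-1 :> R by rewrite invr_gt0 ltr0n.
    by have [l Sl ll] := inf_adherent n0 hs; exists l.
  have /choice[u uP] := h.
  have uS : u @ \oo --> inf S.
    apply/cvgrPdist_lt => e e0; near=> n.
    have [Su uu] := uP n.
    rewrite distrC ger0_norm ?subr_ge0; last by apply: ge_inf => //; case: hs.
    rewrite ltrBlDl (lt_trans uu)// ltrD2l.
    by near: n; exact: near_infty_natSinv_lt (PosNum e0).
  apply: (@cone_le_cvg (fun=> w) (fun n => u n *: v)).
  - exact: cvg_cst.
  - by apply: cvgZr_tmp.
  - by move=> n; have [[]] := uP n.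
exists (inf S); last first.
  by split => //; rewrite /proj_beta ereal_inf_EFin; [|case: hs|case: hs].
rewrite ltNge; apply/negP => i0; apply: (cone0N Cw); rewrite -cone_le0 -[0]oppr0.
apply: cone_leN; apply: cone_le_trans infle _.
by rewrite -[X in _ <=: X](scale0r v); apply: cone_leZr => //; left.
Unshelve. all: by end_near. Qed.

(** A finite diameter excludes the branch [+oo], so both extremal constants exist and are attained;
    [l] is [proj_alpha], and the bound on the logarithm of the ratio is exponentiated. *)
Lemma proj_diam_bound (A : X -> X) r : (forall x, C x -> C (A x)) ->
  (proj_diam C [set A x | x in C] <= r%:E)%E ->
  forall x y, C x -> C y ->
    exists2 l, 0 < l & l *: A x <=: A y /\ A y <=: (expR r * l) *: A x.
Proof.
move=> Apos Ar x y Cx Cy.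
have : (proj_metric C (A x) (A y) <= r%:E)%E.
  apply: le_trans Ar; apply: ereal_sup_ubound.
  by exists (A x); [exists x|exists (A y); [exists y|]].
rewrite /proj_metric; case: ifPn => [_|]; first by rewrite leye_eq.
rewrite negb_or => /andP[a0 bfin].
have [b b_gt0 [-> Ab]] := proj_betaP (Apos _ Cx) (Apos _ Cy) bfin.
have [a a_ge0 [aE Aa]] := proj_alphaP (Apos _ Cx) (Apos _ Cy).
move: a0; rewrite aE /= lee_fin eqe => a0.
have {a0}a_gt0 : 0 < a by rewrite lt_neqAle eq_sym a0.
move=> lnr; exists a => //; split => //.
apply: cone_le_trans Ab _; apply: cone_leZr; first by left; exact: Apos.
rewrite -ler_pdivrMr// -(lnK (_ : b / a \is Num.pos)) ?ler_expR//.
by rewrite posrE divr_gt0.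
Qed.

End cone_order.

(** The difference is [(x - y) / |y|] plus a multiple of [x] that corrects the norm, and each of the
    two has norm at most [|x - y| / |y|]. *)
Lemma dist_normalize (R : realType) (X : normedModType R) (x y : X) :
  x != 0 -> y != 0 ->
  `| `|x|^-1 *: x - `|y|^-1 *: y| <= 2 * `|x - y| / `|y|.
Proof.
move=> x0 y0; have nx : 0 < `|x| by rewrite normr_gt0.
have ny : 0 < `|y| by rewrite normr_gt0.
rewrite [_ - _](_ : _ = `|y|^-1 *: (x - y) + (`|x|^-1 - `|y|^-1) *: x); last first.
  by rewrite scalerBr scalerBl [RHS]addrC addrA addrNK.
apply: (le_trans (ler_normD _ _)).
rewrite !normrZ (gtr0_norm (_ : 0 < `|y|^-1)) ?invr_gt0//.
have -> : 2 * `|x - y| / `|y| = `|y|^-1 * `|x - y| + `|x - y| / `|y| by ring.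
rewrite lerD2l.
have -> : `|x|^-1 - `|y|^-1 = (`|y| - `|x|) / `|x| / `|y|.
  by field; rewrite !gt_eqF.
rewrite !normrM !normfV !normr_id [leLHS](_ : _ = `| `|y| - `|x| | / `|y|); last first.
  by field; rewrite !gt_eqF.
by rewrite ler_wpM2r ?invr_ge0// distrC ler_dist_dist.
Qed.

(** * Norm-controlled decomposition along a generating cone *)

Section bounded_decomposition.
Context {R : realType} {X : completeNormedModType R}.
Variables (C : set X).
Hypothesis niceC : nice_cone C.

Local Notation K := (C `|` [set 0]).

Let B (n : nat) : set X :=
  [set x | exists y z, [/\ K y, K z, `|y| <= n%:R, `|z| <= n%:R & x = y - z]].

(** The sets [B n] cover the space because the cone is generating, so by Baire's theorem some
    closure contains a ball. Subtracting approximations of its centre moves the ball to the origin;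
    sums of cone vectors stay in the cone, at the price of doubling the bound [n]. *)
Lemma approx_decomposition_ball : exists (N : nat) (r : R), 0 < r /\
  forall h e, `|h| < r -> 0 < e ->
    exists y z, [/\ K y, K z, `|y| <= N%:R, `|z| <= N%:R & `|h - (y - z)| < e].
Proof.
have [n [x0 nx0]] : exists n x0, interior (closure (B n)) x0.
  apply: contrapT => noint.
  have dF n : open (~` closure (B n)) /\ dense (~` closure (B n)).
    split; first by apply: closed_openC; exact: closed_closure.
    move=> O [x Ox] oO; apply: contrapT => OB; apply: noint; exists n, x.
    apply: filterS (open_nbhs_nbhs (conj oO Ox)).
    by move=> y Oy; apply: contrapT => nBy; apply: OB; exists y.
  have [x [_ xB]] := Baire dF (ex_intro _ 0 (I : [set: X] 0)) openT.
  have : [set: X] x by [].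
  rewrite -(nice_generating niceC) => -[y Cy [z Cz yzx]].
  have [m ym] : exists m : nat, `|y| <= m%:R /\ `|z| <= m%:R.
    exists (Num.truncn (`|y| + `|z|)).+1.
    have /andP[_ h] := truncn_itv (addr_ge0 (normr_ge0 y) (normr_ge0 z)).
    by split; apply: le_trans (ltW h); rewrite ?lerDl ?lerDr.
  apply: (xB m) => //; apply: subset_closure.
  by exists y, z; case: ym => ? ?; split => //; left.
have /nbhs_ballP[r /= r0 rB] : nbhs x0 (closure (B n)) by exact: nx0.
exists (n + n)%N, r; split => // h e hr e0.
have e20 : 0 < e / 2 by rewrite divr_gt0.
have c1 : closure (B n) (x0 + h).
  by apply: rB; rewrite -ball_normE /= opprD addrA subrr sub0r normrN.
have c2 : closure (B n) x0 by apply: rB; exact: ballxx.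
have [_ [[y1 [z1 [Ky1 Kz1 y1n z1n ->]]]]] := c1 _ (nbhsx_ballx _ _ e20).
rewrite -ball_normE /= => d1.
have [_ [[y2 [z2 [Ky2 Kz2 y2n z2n ->]]]]] := c2 _ (nbhsx_ballx _ _ e20).
rewrite -ball_normE /= => d2.
exists (y1 + z2), (z1 + y2); rewrite natrD; split.
- exact: cone0_add.
- exact: cone0_add.
- by rewrite (le_trans (ler_normD _ _))// lerD.
- by rewrite (le_trans (ler_normD _ _))// lerD.
rewrite [h - _](_ : _ = (x0 + h - (y1 - z1)) - (x0 - (y2 - z2))); last first.
  have -> : y1 + z2 - (z1 + y2) = (y1 - z1) - (y2 - z2) by rewrite opprD addrACA opprB.
  rewrite [in LHS]opprB [in RHS](opprB x0) [x0 + h]addrC [_ - x0]addrC.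
  move: (y1 - z1) (y2 - z2) => a b.
  by rewrite -!addrA; congr (_ + _); rewrite [RHS]addrCA addNKr addrC.
by rewrite (le_lt_trans (ler_normB _ _))// [e]splitr ltrD.
Qed.

(** Rescaling to norm [r / 2] and asking for an error below [r / 4] makes the error relative, with
    ratio one half. The components are packed as a pair so that a choice function can be
    extracted. *)
Lemma approx_decomposition : exists M : R, 0 < M /\ forall h,
  exists yz : X * X, [/\ K yz.1, K yz.2, `|yz.1| <= M * `|h|, `|yz.2| <= M * `|h| &
    `|h - (yz.1 - yz.2)| <= `|h| / 2].
Proof.
have [N [r [r0 Nr]]] := approx_decomposition_ball.
exists (2 * N.+1%:R / r); split; first by rewrite !mulr_gt0 ?invr_gt0// ltr0n.
move=> h; have [->|h0] := eqVneq h 0.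
  by exists (0, 0); rewrite !normr0 !mulr0 !subr0 normr0 mul0r; split => //; right.
have nh : 0 < `|h| by rewrite normr_gt0.
pose s := r / 2 / `|h|; have s0 : 0 < s by rewrite !divr_gt0.
have sh : s * `|h| = r / 2 by rewrite /s divfK// gt_eqF.
have [||y [z [Ky Kz yN zN hyz]]] := Nr (s *: h) (r / 4).
  by rewrite normrZ gtr0_norm// sh; lra.
  by rewrite divr_gt0.
have sN : s^-1 = 2 / r * `|h| by rewrite /s; field; rewrite !gt_eqF.
have bd (u : X) : `|u| <= N%:R -> `|s^-1 *: u| <= 2 * N.+1%:R / r * `|h|.
  move=> uN; rewrite normrZ gtr0_norm ?invr_gt0// sN.
  rewrite [leRHS](_ : _ = 2 / r * `|h| * N.+1%:R); last by ring.
  apply: ler_wpM2l; first by rewrite !mulr_ge0 ?invr_ge0// ltW.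
  by rewrite (le_trans uN)// ler_nat.
exists (s^-1 *: y, s^-1 *: z) => /=; split.
- by apply: cone0_scale => //; rewrite invr_ge0 ltW.
- by apply: cone0_scale => //; rewrite invr_ge0 ltW.
- exact: bd.
- exact: bd.
have -> : h - (s^-1 *: y - s^-1 *: z) = s^-1 *: (s *: h - (y - z)).
  by rewrite -scalerBr [RHS]scalerBr scalerA mulVf ?scale1r// gt_eqF.
rewrite normrZ gtr0_norm ?invr_gt0// sN.
rewrite [leRHS](_ : _ = 2 / r * `|h| * (r / 4)); last by field; rewrite gt_eqF.
by apply: ler_wpM2l; [rewrite !mulr_ge0 ?invr_ge0// ltW|exact: ltW].
Qed.

(* The successive approximation argument of the open mapping theorem. *)
Lemma bounded_decomposition : exists M : R, 0 < M /\ forall x,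
  exists y z, [/\ K y, K z, `|y| <= M * `|x|, `|z| <= M * `|x| & x = y - z].
Proof.
have [M [M0 /choice[f fP]]] := approx_decomposition.
exists (2 * M); split; first by rewrite mulr_gt0.
(* [h n] is the residual left after [n] corrections; its norm at least halves at each step. *)
move=> x; pose h n := iter n (fun u => u - ((f u).1 - (f u).2)) x.
have hS n : h n.+1 = h n - ((f (h n)).1 - (f (h n)).2) by [].
have hn n : `|h n| <= `|x| * 2^-1 ^+ n.
  elim: n => [|n IH]; first by rewrite expr0 mulr1.
  have [_ _ _ _ hh] := fP (h n).
  rewrite hS (le_trans hh)// exprS mulrCA mulrC.
  by rewrite ler_pM2l ?invr_gt0.
have geo n : \sum_(0 <= i < n) `|x| * 2^-1 ^+ i <= 2 * `|x|.
  rewrite -mulr_sumr mulrC ler_wpM2r//.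
  have -> : \sum_(0 <= i < n) (2^-1 : R) ^+ i = 2 - 2 * 2^-1 ^+ n.
    elim: n => [|n IH]; first by rewrite big_nil expr0 mulr1 subrr.
    by rewrite big_nat_recr//= IH exprS; field.
  by rewrite lerBlDr lerDl mulr_ge0// exprn_ge0// invr_ge0.
(* The corrections are absolutely summable since the residuals are geometric, and the sum of the
   geometric series is the factor 2 in the bound. The partial sums stay in [K], which is closed. *)
have key (g : X -> X) : (forall u, K (g u)) -> (forall u, `|g u| <= M * `|u|) ->
    exists y, [/\ series (fun n => g (h n)) @ \oo --> y, K y & `|y| <= 2 * M * `|x|].
  move=> Kg gM.
  have bnd n : \sum_(0 <= i < n) `|g (h i)| <= 2 * M * `|x|.
    apply: le_trans (_ : \sum_(0 <= i < n) M * (`|x| * 2^-1 ^+ i) <= _).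
      by apply: ler_sum => i _; rewrite (le_trans (gM _))// ler_pM2l.
    by rewrite -mulr_sumr -mulrA [2 * (M * _)]mulrCA ler_pM2l.
  have cv : cvgn (series (fun n => g (h n))).
    apply: normed_cvg; apply: nondecreasing_is_cvgn.
      change (nondecreasing_seq (fun n => \sum_(0 <= i < n) `|g (h i)|)).
      by apply/nondecreasing_seqP => n; rewrite big_nat_recr//= lerDl.
    by exists (2 * M * `|x|) => _ [n _ <-]; exact: bnd.
  exists (limn (series (fun n => g (h n)))); split => //.
    apply: (@closed_cvg _ _ _ _ _ K (nice_closed niceC) _ _ cv).
    apply: nearW => n; rewrite /series /=.
    elim: n => [|n IH]; first by rewrite big_nil; right.
    by rewrite big_nat_recr//=; exact: cone0_add.
  have cvn : (fun n => `|series (fun n => g (h n)) n|) @ \oo -->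
      `|limn (series (fun n => g (h n)))| by exact: cvg_norm.
  rewrite -(cvg_lim _ cvn)//; apply: limr_le.
    by apply/cvg_ex; exists `|limn (series (fun n => g (h n)))|.
  by apply: nearW => n; apply: le_trans (bnd n); rewrite /series /=; exact: ler_norm_sum.
have [y [cy Ky yM]] := key (fun u => (f u).1)
  (fun u => let: And5 a _ _ _ _ := fP u in a) (fun u => let: And5 _ _ a _ _ := fP u in a).
have [z [cz Kz zM]] := key (fun u => (f u).2)
  (fun u => let: And5 _ a _ _ _ := fP u in a) (fun u => let: And5 _ _ _ a _ := fP u in a).
exists y, z; split => //.
have h0 : h @ \oo --> (0 : X).
  apply/cvgr0Pnorm_le => e e0.
  have : (fun n => `|x| * 2^-1 ^+ n) @ \oo --> `|x| * (0 : R).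
    apply: cvgMl_tmp; apply: cvg_expr; rewrite ger0_norm ?invr_ge0//.
    by rewrite invf_lt1// ltr1n.
  rewrite mulr0 => /cvgr0Pnorm_le/(_ e e0); apply: filterS => n.
  by apply: le_trans; rewrite (le_trans (hn n))// ler_norm.
have : (fun n => h n + (series (fun n => (f (h n)).1) n - series (fun n => (f (h n)).2) n))
    @ \oo --> 0 + (y - z).
  by apply: cvgD => //; exact: cvgB.
rewrite add0r => cyz; apply: (@cvg_unique _ _ _ _ _ _ _ cyz) => //=.
rewrite [X in X @ _ --> _](_ : _ = cst x); first exact: cvg_cst.
apply/funext => n /=; elim: n => [|n IH].
  by rewrite /series /= !big_nil subrr addr0.
rewrite hS /series /= !big_nat_recr//= -[RHS]IH /series /=.
set a := (f (h n)).1; set b := (f (h n)).2.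
set S1 := \sum_(_ <= _ < _) (f _).1; set S2 := \sum_(_ <= _ < _) (f _).2.
have -> : S1 + a - (S2 + b) = (S1 - S2) + (a - b) by rewrite opprD addrACA.
by rewrite -addrA; congr (_ + _); rewrite addrCA addNr addr0.
Qed.

End bounded_decomposition.

(** * Cocycles preserving a cone *)

Section cocycle_theory.
Context {R : realType} {X : normedModType R} {Omega : Type}.
Variables (sigma : Omega -> Omega) (L : Omega -> blin X X).
Implicit Types (m n : nat) (w : Omega) (x : X).

Lemma cocycleD m n w x :
  cocycle sigma L (m + n) w x = cocycle sigma L m (iter n sigma w) (cocycle sigma L n w x).
Proof. by elim: m => [//|m IH]; rewrite addSn /= IH -iterD. Qed.

Lemma cocycleSr n w x : cocycle sigma L n.+1 w x = cocycle sigma L n (sigma w) (L w x).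
Proof. by rewrite -addn1 cocycleD. Qed.

Variable C : set X.
Hypothesis LC : forall w, [set L w x | x in C] `<=` C.

Lemma cocycle_cone n w : [set cocycle sigma L n w x | x in C] `<=` C.
Proof.
move=> _ [x Cx <-]; elim: n => [//|n IH] /=.
by apply: (LC (w := iter n sigma w)); exists (cocycle sigma L n w x).
Qed.

Lemma cocycle_in_cone n w x : C x -> C (cocycle sigma L n w x).
Proof. by move=> Cx; apply: (@cocycle_cone n w); exists x. Qed.

End cocycle_theory.

(** * Visits to a set along an orbit *)

Section visits.
Context {Omega : Type}.
Variables (GP : set Omega).
Implicit Types (f : Omega -> Omega) (w : Omega).

Definition visits f n w : nat := (\sum_(0 <= i < n) (iter i f w \in GP))%N.

Lemma visitsS f n w : visits f n.+1 w = ((w \in GP) + visits f n (f w))%N.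
Proof.
rewrite /visits big_nat_recl//=; congr (_ + _)%N.
by apply: eq_bigr => i _; rewrite -iterSr.
Qed.

Lemma visitsSr f n w : visits f n.+1 w = (visits f n w + (iter n f w \in GP))%N.
Proof. by rewrite /visits big_nat_recr. Qed.

Lemma visitsD f m n w : visits f (m + n) w = (visits f n w + visits f m (iter n f w))%N.
Proof.
elim: m => [|m IH]; first by rewrite /visits big_nil addn0.
by rewrite addSn !visitsSr IH addnA iterD.
Qed.

Lemma visits_le f n w : (visits f n w <= n)%N.
Proof.
elim: n => [|n IH]; first by rewrite /visits big_nil.
by rewrite visitsSr -addn1 leq_add// leq_b1.
Qed.

Lemma visits_mono f n m w : (n <= m)%N -> (visits f n w <= visits f m w)%N.
Proof. by move=> nm; rewrite -(subnK nm) visitsD leq_addr. Qed.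

(** An orbit segment is read backwards, from its last point, which [g] recovers from the end point.
    Contraction of pullbacks from the past can thus be counted by visits along the inverse map. *)
Lemma visits_inv f g n w : cancel f g -> visits f n w = visits g n (g (iter n f w)).
Proof.
move=> fg; elim: n => [|n IH]; first by rewrite /visits !big_nil.
by rewrite visitsSr IH [RHS]visitsS /= fg addnC.
Qed.

Definition recurrent f w : Prop := forall m, exists n, (m <= visits f n w)%N.

Lemma recurrent_image f w : recurrent f w -> recurrent f (f w).
Proof.
move=> rw m; have [n nm] := rw m.+1; exists n.
have := leq_trans nm (visits_mono f w (leqnSn n)); rewrite visitsS.
by case: (w \in GP) => /=; lia.
Qed.

Lemma recurrent_preimage f w : recurrent f (f w) -> recurrent f w.
Proof.
by move=> rw m; have [n nm] := rw m; exists n.+1; rewrite visitsS (leq_trans nm)// leq_addl.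
Qed.

(* Along [n] steps there are at least [visits %/ k] disjoint blocks of length [k]
   starting in [GP], up to a bounded loss which the truncated [.-2] absorbs. *)
Definition decay_exponent k f n w : nat := (visits f n w %/ k).-2.

Lemma decay_exponent_large k f j n w : (0 < k)%N -> (j.+4 * k <= visits f n w)%N ->
  (2 * k <= visits f n w)%N /\ (j <= decay_exponent k f n w)%N.
Proof.
move=> k0 h; split; first by apply: leq_trans h; rewrite leq_mul2r; lia.
by move: h => /(leq_div2r k); rewrite mulnK// /decay_exponent; lia.
Qed.

Lemma decay_exponentS k f n w : (decay_exponent k f n (f w) <= decay_exponent k f n.+1 w)%N.
Proof.
rewrite /decay_exponent visitsS -!subn2 leq_sub2r//; apply: leq_div2r; exact: leq_addl.
Qed.

Lemma visits_le_decay k f n w : (0 < k)%N ->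
  (visits f n w <= (decay_exponent k f n w + 3) * k)%N.
Proof.
move=> k0; apply: leq_trans (ltnW (ltn_ceil (visits f n w) k0)) _.
by rewrite leq_mul2r /decay_exponent; apply/orP; right; lia.
Qed.

Lemma recurrent_decay k f w : (0 < k)%N -> recurrent f w -> forall j, exists n0, forall n,
  (n0 <= n)%N -> (2 * k <= visits f n w)%N /\ (j <= decay_exponent k f n w)%N.
Proof.
move=> k0 fw j; have [n0 h] := fw (j.+4 * k)%N; exists n0 => n n0n.
by apply: decay_exponent_large => //; apply: leq_trans h _; exact: visits_mono.
Qed.

End visits.

Definition normalize {R : realType} {X : normedModType R} (x : X) : X := `|x|^-1 *: x.

Section normalize.
Context {R : realType} {X : normedModType R}.
Implicit Types x : X.

Lemma normalizeZ (a : R) x : 0 < a -> normalize (a *: x) = normalize x.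
Proof.
move=> a0; rewrite /normalize normrZ gtr0_norm// scalerA invfM mulrC mulrA mulfV ?mul1r//.
by rewrite gt_eqF.
Qed.

Lemma norm_normalize x : x != 0 -> `|normalize x| = 1.
Proof.
by move=> x0; rewrite normrZ ger0_norm ?invr_ge0// mulVf// normr_eq0.
Qed.

Lemma normalize_cvg (u : nat -> X) x : x != 0 -> u @ \oo --> x ->
  (fun n => normalize (u n)) @ \oo --> normalize x.
Proof.
move=> x0 ux; apply: cvgZ => //; apply: cvgV; first by rewrite normr_eq0.
exact: cvg_norm.
Qed.

End normalize.

(** * Hopf contraction along recurrent orbits *)

Section hopf_cocycle.
Context {R : realType} {X : completeNormedModType R} {Omega : Type}.
Variables (sigma : Omega -> Omega) (L : Omega -> blin X X).
Variable C : set X.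
Hypothesis niceC : nice_cone C.
Hypothesis LC : forall w, [set L w x | x in C] `<=` C.
Variables (GP : set Omega) (k : nat) (q : R).
Hypotheses (k0 : (0 < k)%N) (q1 : 1 < q).
Hypothesis GPq : forall w, GP w -> forall x y, C x -> C y ->
  exists2 l, 0 < l & cone_le C (l *: cocycle sigma L k w x) (cocycle sigma L k w y) /\
    cone_le C (cocycle sigma L k w y) ((q ^+ 2 * l) *: cocycle sigma L k w x).
Implicit Types (m n : nat) (w : Omega) (x y v : X).

Local Notation "x <=: y" := (cone_le C x y) (at level 70).
Local Notation coc := (cocycle sigma L).
Local Notation N := (visits GP sigma).

(* This is [tanh (Delta / 4)] for [q = expR (Delta / 2)]. *)
Definition hopf_rate : R := (q - 1) / (q + 1).
Local Notation t := hopf_rate.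

Lemma hopf_rate_gt0 : 0 < t.
Proof. by rewrite divr_gt0//; have := q1; lra. Qed.

Lemma hopf_rate_lt1 : t < 1.
Proof. by rewrite ltr_pdivrMr; have := q1; lra. Qed.

Lemma hopf_rate_expr_le i j : (i <= j)%N -> t ^+ j <= t ^+ i.
Proof.
by move=> ij; apply: ler_wiXn2l => //; apply: ltW; [exact: hopf_rate_gt0|exact: hopf_rate_lt1].
Qed.

Lemma cone_le_coc n w x y : x <=: y -> coc n w x <=: coc n w y.
Proof. by apply: cone_le_blin; exact: cocycle_cone. Qed.

Lemma coc_in n w x : C x -> C (coc n w x).
Proof. exact: cocycle_in_cone. Qed.

(* Greedily chosen disjoint blocks of length [k] starting in [GP]: each of them
   uses up at most [k] visits. *)
Lemma osc_contraction n w v x a b : C v -> a *: v <=: x -> x <=: b *: v ->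
  exists j a' b', [/\ (N n w <= j.+1 * k)%N, a <= a', b' <= b, b' - a' <= t ^+ j * (b - a) &
    a' *: coc n w v <=: coc n w x /\ coc n w x <=: b' *: coc n w v].
Proof.
elim/ltn_ind: n w v x a b => n IH w v x a b Cv avx xbv.
have [nk|kn] := ltnP n k.
  (* No complete block fits into fewer than [k] steps; the at most [k] visits there are the extra
     unit in [j.+1]. *)
  exists 0%N, a, b; rewrite mul1n expr0 mul1r; split => //.
    exact: leq_trans (visits_le _ _ _ _) (ltnW nk).
  by rewrite -!linearZ; split; exact: cone_le_coc.
have n0 : (0 < n)%N by exact: leq_trans kn.
case: (boolP (w \in GP)) => wGP; last first.
  (* Outside [GP] a single step preserves the bounds and uses up no visit. *)
  case: n n0 kn IH => // n _ kn IH.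
  have Lle y z : y <=: z -> L w y <=: L w z by apply: cone_le_blin.
  have Cv' : C (L w v) by apply: (LC (w := w)); exists v.
  have avx' : a *: L w v <=: L w x by rewrite -linearZ; exact: Lle.
  have xbv' : L w x <=: b *: L w v by rewrite -linearZ; exact: Lle.
  have [j [a' [b' [Nj aa' b'b ba' [h1 h2]]]]] := IH n (ltnSn n) (sigma w) _ _ _ _ Cv' avx' xbv'.
  by exists j, a', b'; rewrite visitsS (negPf wGP) !cocycleSr.
have GPw : GP w by move: wGP; rewrite inE.
have [a1 [b1 [aa1 b1b ab1 h1 h2]]] := hopf_contraction niceC q1
  (@cocycle_cone _ _ _ sigma L C LC k w) (GPq GPw) Cv avx xbv.
have nk : (n - k < n)%N by rewrite ltn_subrL k0.
have [j [a' [b' [Nj aa' b'b ba' [h1' h2']]]]] := IH (n - k)%N nk (iter k sigma w) _ _ _ _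
  (coc_in k w Cv) h1 h2.
exists j.+1, a', b'; rewrite -(subnK kn) !cocycleD; split => //.
- rewrite visitsD [X in (_ <= X)%N]mulSn leq_add//; exact: visits_le.
- exact: le_trans aa1 aa'.
- exact: le_trans b'b b1b.
- rewrite (le_trans ba')// exprSr -mulrA ler_wpM2l//.
  by apply: exprn_ge0; apply: ltW; exact: hopf_rate_gt0.
Qed.

Local Notation blocks n w := (decay_exponent GP k sigma n w).

(** Two cone vectors need not be comparable at time 0, so the first block only makes their images
    comparable, within a ratio [q ^+ 2]; the later blocks shrink the width. This block and the
    incomplete one at the end are the two units removed in [decay_exponent]. The width is measured
    relative to [a], the form that survives normalization. *)
Lemma pair_bound n w x y : (2 * k <= N n w)%N -> C x -> C y ->
  exists a b, [/\ 0 < a, b <= q ^+ 2 * a, b - a <= (q ^+ 2 - 1) * t ^+ blocks n w * a &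
    a *: coc n w x <=: coc n w y /\ coc n w y <=: b *: coc n w x].
Proof.
elim: n w x y => [|n IH] w x y.
  by rewrite /visits big_nil leqn0 muln_eq0/= -leqn0 leqNgt k0.
case: (boolP (w \in GP)) => wGP; last first.
  rewrite visitsS (negPf wGP) add0n => kN Cx Cy.
  have LC' z : C z -> C (L w z) by move=> Cz; apply: (LC (w := w)); exists z.
  have [a [b]] := IH _ _ _ kN (LC' _ Cx) (LC' _ Cy).
  rewrite -!cocycleSr => h; exists a, b.
  by rewrite /decay_exponent visitsS (negPf wGP).
move=> kN Cx Cy.
have GPw : GP w by move: wGP; rewrite inE.
have kn : (k <= n.+1)%N.
  by apply: leq_trans (visits_le GP sigma n.+1 w); apply: leq_trans kN; rewrite leq_pmull.
have [l l0 [lxy yx]] := GPq GPw Cx Cy.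
have [j [a [b [Nj la bl ba [h1 h2]]]]] :=
  osc_contraction (n.+1 - k) (iter k sigma w) (coc_in k w Cx) lxy yx.
have q2 : 0 <= q ^+ 2 - 1 by rewrite subr_ge0 exprn_ege1// ltW.
exists a, b; rewrite -{2 3 4 5}(subnK kn) !cocycleD; split => //.
- exact: lt_le_trans la.
- by rewrite (le_trans bl)// ler_wpM2l// exprn_ge0// (le_trans ler01)// ltW.
- rewrite (le_trans ba)//.
  have -> : q ^+ 2 * l - l = (q ^+ 2 - 1) * l by ring.
  rewrite mulrA [t ^+ j * _]mulrC; apply: ler_pM => //.
  + by rewrite mulr_ge0// exprn_ge0// ltW// hopf_rate_gt0.
  + exact: ltW.
  rewrite ler_wpM2l//; apply: hopf_rate_expr_le; rewrite /decay_exponent.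
  have : (N n.+1 w <= j.+2 * k)%N.
    rewrite -(subnK kn) visitsD [X in (_ <= X)%N]mulSn leq_add//; exact: visits_le.
  move=> /(leq_div2r k); rewrite mulnK//; lia.
Qed.

Variable D : R.
Hypotheses (D1 : 1 <= D) (Dad : adapted C D).

Let D0 : 0 <= D. Proof. exact: le_trans D1. Qed.

Let q2 : 0 <= q ^+ 2 - 1. Proof. by rewrite subr_ge0 exprn_ege1// ltW. Qed.

Lemma small_hopf_rate c e : 0 < e -> exists j0, forall j, (j0 <= j)%N -> c * t ^+ j < e.
Proof.
move=> e0; have : (fun j => c * t ^+ j) @ \oo --> c * (0 : R).
  apply: cvgMl_tmp; apply: cvg_expr; rewrite ger0_norm; first exact: hopf_rate_lt1.
  exact: ltW hopf_rate_gt0.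
rewrite mulr0 => /cvgr0Pnorm_lt/(_ e e0)[j0 _ h]; exists j0 => j /h.
by apply: le_lt_trans; exact: ler_norm.
Qed.

Section functional.
Variable M : R.
Hypothesis Mdec : forall x, exists y z, [/\ (C `|` [set 0]) y, (C `|` [set 0]) z,
  `|y| <= M * `|x|, `|z| <= M * `|x| & x = y - z].

Lemma coc_gt0 n w v : C v -> 0 < `|coc n w v|.
Proof. by move=> Cv; rewrite normr_gt0; apply: (cone_neq0 niceC); exact: coc_in. Qed.

Lemma cone0_bound n w v y : (2 * k <= N n w)%N -> C v -> (C `|` [set 0]) y ->
  exists a b, [/\ 0 <= a, a <= b, b <= q ^+ 2 * D * `|coc n w y| / `|coc n w v|,
    b - a <= (q ^+ 2 - 1) * t ^+ blocks n w * a &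
    a *: coc n w v <=: coc n w y /\ coc n w y <=: b *: coc n w v].
Proof.
move=> Nn Cv [Cy|->]; last first.
  exists 0, 0; rewrite raddf0 normr0 !mulr0 mul0r subrr scale0r; split => //.
  by split; exact: cone_lexx.
have [a [b [a0 ba bae [h1 h2]]]] := pair_bound Nn Cv Cy.
exists a, b; split => //.
- exact: ltW.
- by apply: (@cone_leZr_inv _ _ _ niceC _ _ (coc n w v)); [exact: coc_in|exact: cone_le_trans h2].
rewrite (le_trans ba)// -2!mulrA; apply: ler_wpM2l; first exact: sqr_ge0.
rewrite mulrA ler_pdivlMr ?coc_gt0// -{1}(gtr0_norm a0) -normrZ.
apply: (adapted_mono niceC Dad) => //; last exact: coc_in.
by apply: cone0_scale (ltW a0) _ => //; left; exact: coc_in.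
Qed.

(** Both relations are pushed forward to the later of the two times, where they compare multiples of
    one cone vector. *)
Lemma cone_le_cross n m w v x a b : C v -> a *: coc n w v <=: coc n w x ->
  coc m w x <=: b *: coc m w v -> a <= b.
Proof.
move=> Cv h1 h2.
apply: (@cone_leZr_inv _ _ _ niceC _ _ (coc (maxn m n) w v)); first exact: coc_in.
apply: (cone_le_trans niceC (y := coc (maxn m n) w x)).
  rewrite -(subnK (leq_maxr m n)) !cocycleD -linearZ; exact: cone_le_coc.
by rewrite -(subnK (leq_maxl m n)) !cocycleD -linearZ; exact: cone_le_coc.
Qed.

(** Bounds the coefficients of the unit ball at time [n]: [M] comes from decomposing along the cone,
    [D] from adaptedness and [q ^+ 2] from the ratio of the two order bounds. *)
Definition dist_const n w v : R := q ^+ 2 * D * M * `|coc n w| / `|coc n w v|.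

(** The coefficients of [y - z] are differences of those of [y] and [z], hence the factor 2 in the
    width. Sizes are controlled at a fixed time [n0], which keeps the constant independent of [n],
    and the width at time [n]. *)
Lemma functional_bound n0 n w v x : (n0 <= n)%N -> (2 * k <= N n0 w)%N -> C v ->
  exists a b, [/\ `|a| <= dist_const n0 w v * `|x|, `|b| <= dist_const n0 w v * `|x|,
    b - a <= 2 * ((q ^+ 2 - 1) * t ^+ blocks n w * (dist_const n0 w v * `|x|)) &
    a *: coc n w v <=: coc n w x /\ coc n w x <=: b *: coc n w v].
Proof.
move=> n0n N0 Cv; have [y [z [Ky Kz yM zM xyz]]] := Mdec x.
have Nn : (2 * k <= N n w)%N by apply: leq_trans N0 _; exact: visits_mono.
have q0 : 0 < q by apply: lt_trans q1.
have key u : (C `|` [set 0]) u -> `|u| <= M * `|x| ->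
    exists a b, [/\ 0 <= a, a <= b, b <= dist_const n0 w v * `|x|,
      b - a <= (q ^+ 2 - 1) * t ^+ blocks n w * (dist_const n0 w v * `|x|) &
      a *: coc n w v <=: coc n w u /\ coc n w u <=: b *: coc n w v].
  move=> Ku uM.
  have [a1 [b1 [a10 ab1 bB1 _ [h11 h12]]]] := cone0_bound N0 Cv Ku.
  have [a [b [a0 ab _ bae [h1 h2]]]] := cone0_bound Nn Cv Ku.
  have b1B : b1 <= dist_const n0 w v * `|x|.
    rewrite (le_trans bB1)// /dist_const.
    rewrite [leRHS](_ : _ = q ^+ 2 * D * (`|coc n0 w| * (M * `|x|)) / `|coc n0 w v|); last by ring.
    rewrite ler_wpM2r ?invr_ge0//; apply: ler_wpM2l; first by rewrite mulr_ge0 ?sqr_ge0.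
    by rewrite (le_trans (ler_opnorm _ _))// ler_wpM2l// opnorm_ge0.
  have ab1' : a <= b1 := cone_le_cross Cv h1 h12.
  (* The bound [b] from time [n] is close to [a], and [b1] from time [n0] has the uniform size; the
     minimum has both properties. *)
  exists a, (Order.min b b1); split => //.
  - by rewrite le_min ab ab1'.
  - by rewrite ge_min b1B orbT.
  - apply: le_trans (_ : b - a <= _); first by rewrite lerD2r ge_min lexx.
    rewrite (le_trans bae)// ler_wpM2l ?(le_trans ab1')//.
    by rewrite mulr_ge0// exprn_ge0// ltW// hopf_rate_gt0.
  split => //; have [_|_] := leP b b1 => //.
  by rewrite -(subnK n0n) !cocycleD -linearZ; exact: cone_le_coc.
have [a1 [b1 [a10 ab1 bB1 e1 [h11 h12]]]] := key _ Ky yM.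
have [a2 [b2 [a20 ab2 bB2 e2 [h21 h22]]]] := key _ Kz zM.
exists (a1 - b2), (b1 - a2); split.
- by rewrite ler_norml; apply/andP; split; lra.
- by rewrite ler_norml; apply/andP; split; lra.
- lra.
rewrite xyz raddfB !scalerBl; split; apply: cone_leD => //; exact: cone_leN.
Qed.

(* The optimal lower bounds for [coc n w x] in terms of [coc n w v] increase
   with [n]. *)
Definition eta_val w v x : R :=
  sup [set a | exists n, a *: coc n w v <=: coc n w x].

Section eta_theory.
Variables (w : Omega) (v : X).
Hypotheses (fw : recurrent GP sigma w) (Cv : C v).

Local Notation eta := (eta_val w v).

Let n0P : exists n0, (2 * k <= N n0 w)%N.
Proof. by have [n h] := recurrent_decay k0 fw 0; exists n; have [] := h n (leqnn n). Qed.

Lemma eta_ge n a x : a *: coc n w v <=: coc n w x -> a <= eta x.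
Proof.
move=> h; apply: ub_le_sup; last by exists n.
have [n0 N0] := n0P.
have [_ [b [_ _ _ [_ hb]]]] := functional_bound x (leqnn n0) N0 Cv.
exists b => c [m hc]; exact: cone_le_cross hc hb.
Qed.

Lemma eta_le n b x : coc n w x <=: b *: coc n w v -> eta x <= b.
Proof.
move=> h; apply: ge_sup; last by move=> c [m hc]; exact: cone_le_cross hc h.
have [n0 N0] := n0P.
by have [a [_ [_ _ _ [ha _]]]] := functional_bound x (leqnn n0) N0 Cv; exists a, n0.
Qed.

Lemma eta_self : eta v = 1.
Proof.
have h : 1 *: coc 0 w v <=: coc 0 w v by rewrite scale1r; exact: cone_lexx.
have h' : coc 0 w v <=: 1 *: coc 0 w v by rewrite scale1r; exact: cone_lexx.
by apply/eqP; rewrite eq_le (eta_le h') (eta_ge h).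
Qed.

Lemma eta_norm_le n0 x : (2 * k <= N n0 w)%N -> `|eta x| <= dist_const n0 w v * `|x|.
Proof.
move=> N0; have [a [b [aB bB _ [ha hb]]]] := functional_bound x (leqnn n0) N0 Cv.
rewrite ler_norml; apply/andP; split.
  by rewrite (le_trans _ (eta_ge ha))// lerNl (le_trans (ler_norm _))// normrN.
by rewrite (le_trans (eta_le hb))// (le_trans (ler_norm _)).
Qed.

Lemma eta_err n0 n x : (n0 <= n)%N -> (2 * k <= N n0 w)%N ->
  `|coc n w x - eta x *: coc n w v| <=
    2 * D * (q ^+ 2 - 1) * dist_const n0 w v * t ^+ blocks n w * `|x| * `|coc n w v|.
Proof.
move=> n0n N0; have [a [b [_ _ ba [ha hb]]]] := functional_bound x n0n N0 Cv.
apply: le_trans (adapted_osc niceC Dad (coc_in n w Cv) ha hb (eta_ge ha) (eta_le hb)) _.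
rewrite mulrA ler_wpM2r// (le_trans (ler_wpM2l D0 ba))//.
by rewrite le_eqVlt; apply/orP; left; apply/eqP; ring.
Qed.

(** Both [c] and [eta x] approximate [coc n w x] within a multiple of [t ^+ blocks n w], which tends
    to 0. Linearity of [eta] and invariance of its kernel are obtained from this characterization,
    without manipulating the supremum. *)
Lemma eta_unique x c B0 : (forall j, exists n, (j <= blocks n w)%N /\
    `|coc n w x - c *: coc n w v| <= B0 * t ^+ blocks n w * `|coc n w v|) -> eta x = c.
Proof.
move=> h; apply/eqP; rewrite -subr_eq0 -normr_le0; apply/ler_addgt0Pr => e e0; rewrite add0r.
have [n0 N0] := n0P.
pose B1 := 2 * D * (q ^+ 2 - 1) * dist_const n0 w v * `|x|.
have [j0 j0P] := small_hopf_rate (B0 + B1) e0.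
(* Asking for this many blocks also forces [n0 <= n], as the number of blocks is at most [n] and [k]
   is positive. *)
have [n [jn hn]] := h (j0 + n0.+4 * k)%N.
have n0n : (n0 <= n)%N.
  have : (blocks n w <= n)%N.
    rewrite /decay_exponent; have := visits_le GP sigma n w; have := leq_div (N n w) k; lia.
  have : (n0.+4 * 1 <= n0.+4 * k)%N by rewrite leq_mul2l; lia.
  lia.
have cv := coc_gt0 n w Cv.
rewrite -(ler_pM2r cv) -normrZ [_ *: _](_ : _ =
  (coc n w x - c *: coc n w v) - (coc n w x - eta x *: coc n w v)); last first.
  by rewrite opprB [RHS]addrC [RHS]addrA addrNK scalerBl.
rewrite (le_trans (ler_normB _ _))// (le_trans (lerD hn (eta_err x n0n N0)))//.
rewrite [leLHS](_ : _ = ((B0 + B1) * t ^+ blocks n w) * `|coc n w v|); last by rewrite /B1; ring.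
rewrite ler_wpM2r// ltW// j0P//; lia.
Qed.

Lemma eta_linear : linear (eta : X -> R^o).
Proof.
move=> c x y; have [n0 N0] := n0P.
pose B x := 2 * D * (q ^+ 2 - 1) * dist_const n0 w v * `|x|.
apply: (@eta_unique _ _ (`|c| * B x + B y)) => j.
have [n1 n1P] := recurrent_decay k0 fw j.
have [_ jb] := n1P _ (leq_maxr n0 n1).
exists (maxn n0 n1); split => //; set n := maxn n0 n1.
have h x' := eta_err x' (leq_maxl n0 n1) N0.
rewrite linearP [X in `|X|](_ : _ =
  c *: (coc n w x - eta x *: coc n w v) + (coc n w y - eta y *: coc n w v)); last first.
  by rewrite scalerBr addrACA -opprD scalerDl scalerA.
rewrite (le_trans (ler_normD _ _))// normrZ.
rewrite (le_trans (lerD (ler_wpM2l (normr_ge0 c) (h x)) (h y)))//.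
by rewrite le_eqVlt; apply/orP; left; apply/eqP; rewrite /B -/n; ring.
Qed.

End eta_theory.

End functional.

Section direction.
Variable tau : Omega -> Omega.
Hypotheses (sigmaK : cancel sigma tau) (tauK : cancel tau sigma).
Variable g : X.
Hypothesis Cg : C g.

Local Notation bN n w := (visits GP tau n (tau w)).

Definition pre_dir n w : X := normalize (coc n (iter n tau w) g).

Definition dir w : X := limn (fun n => pre_dir n w).

Lemma iter_sigmaK n w : iter n sigma (iter n tau w) = w.
Proof. by elim: n => //= n IH; rewrite -iterS iterSr tauK. Qed.

Lemma bvisitsE n w : N n (iter n tau w) = bN n w.
Proof. by rewrite (visits_inv _ _ _ sigmaK) iter_sigmaK. Qed.

(** Normalization does not see the factor [a], so [x] may be replaced by [a *: x], from which [y]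
    differs by at most [D * e] times its norm. *)
Lemma normalize_close x y a b e : C x -> 0 < a -> a *: x <=: y -> y <=: b *: x ->
  b - a <= e * a -> `|normalize y - normalize x| <= 2 * D * e.
Proof.
move=> Cx a0 axy ybx bae.
have Cy : C y by exact: cone_le_cone axy.
have Cax : C (a *: x) by exact: cone_scale.
have x0 := cone_neq0 niceC Cx.
have ab : a <= b by apply: (cone_leZr_inv niceC Cx); exact: cone_le_trans ybx.
rewrite -(normalizeZ x a0).
rewrite (le_trans (dist_normalize (cone_neq0 niceC Cy) (cone_neq0 niceC Cax)))//.
rewrite normrZ gtr0_norm// ler_pdivrMr ?mulr_gt0 ?normr_gt0// -!mulrA ler_pM2l//.
have := adapted_osc niceC Dad Cx axy ybx (lexx a) ab.
move=> /le_trans; apply; rewrite ler_wpM2l// mulrA ler_wpM2r//.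
Qed.

(** Starting [m] steps earlier only replaces the seed [g] by another cone vector; the last [n] steps
    are the same operator and bring the two images together. *)
Lemma pre_dir_dist m n w : (2 * k <= bN n w)%N ->
  `|pre_dir (m + n) w - pre_dir n w| <=
    2 * D * ((q ^+ 2 - 1) * t ^+ blocks n (iter n tau w)).
Proof.
rewrite -bvisitsE => kN.
rewrite /pre_dir addnC cocycleD [in iter m sigma _]addnC iterD iter_sigmaK.
have Cg' : C (coc m (iter (n + m) tau w) g) by exact: coc_in.
have [a [b [a0 ba bae [h1 h2]]]] := pair_bound kN Cg Cg'.
by apply: normalize_close a0 h1 h2 bae; exact: coc_in.
Qed.

Lemma backward_blocksP w : recurrent GP tau (tau w) -> forall j, exists n0, forall n,
  (n0 <= n)%N -> (2 * k <= bN n w)%N /\ (j <= blocks n (iter n tau w))%N.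
Proof.
move=> bw j; have [n0 h] := bw (j.+4 * k)%N; exists n0 => n n0n.
rewrite -bvisitsE; apply: decay_exponent_large => //.
by rewrite bvisitsE; apply: leq_trans h _; exact: visits_mono.
Qed.

Lemma dir_cvg w : recurrent GP tau (tau w) -> (fun n => pre_dir n w) @ \oo --> dir w.
Proof.
move=> bw; apply: cauchy_cvg; apply: cauchy_exP => e e0.
have [j0 j0P] := small_hopf_rate (2 * D * (q ^+ 2 - 1)) e0.
have [n0 n0P] := backward_blocksP bw j0.
have [kN jb] := n0P n0 (leqnn _).
exists (pre_dir n0 w), n0 => // n /= n0n.
rewrite -ball_normE /= distrC -(subnK n0n) (le_lt_trans (pre_dir_dist _ kN))//.
by rewrite mulrA j0P.
Qed.

Lemma pre_dir_err n w : recurrent GP tau (tau w) -> (2 * k <= bN n w)%N ->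
  `|pre_dir n w - dir w| <= 2 * D * (q ^+ 2 - 1) * t ^+ blocks n (iter n tau w).
Proof.
move=> bw kN; rewrite -mulrA.
have cv : (fun m => `|pre_dir n w - pre_dir m w|) @ \oo --> `|pre_dir n w - dir w|.
  by apply: cvg_norm; apply: cvgB; [exact: cvg_cst|exact: dir_cvg].
rewrite -(cvg_lim _ cv)//; apply: limr_le; first by apply/cvg_ex; exists `|pre_dir n w - dir w|.
exists n => // m /= nm; rewrite distrC -(subnK nm); exact: pre_dir_dist.
Qed.

Lemma pre_dir_cone n w : C (pre_dir n w).
Proof.
have Cc := coc_in n (iter n tau w) Cg.
by apply: cone_scale => //; rewrite invr_gt0 normr_gt0; exact: cone_neq0 Cc.
Qed.

Lemma dir_norm w : recurrent GP tau (tau w) -> `|dir w| = 1.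
Proof.
move=> bw; have cv : (fun n => `|pre_dir n w|) @ \oo --> `|dir w|.
  by apply: cvg_norm; exact: dir_cvg.
apply: (cvg_unique _ cv) => //.
have E : (fun n => `|pre_dir n w|) = cst 1.
  apply/funext => n; rewrite norm_normalize//.
  by apply: (cone_neq0 niceC); exact: coc_in.
by rewrite /= E; exact: cvg_cst.
Qed.

Lemma dir_cone w : recurrent GP tau (tau w) -> C (dir w).
Proof.
move=> bw; have : (C `|` [set 0]) (dir w).
  apply: (@closed_cvg _ _ _ _ _ _ (nice_closed niceC) _ _ (dir_cvg bw)).
  by apply: nearW => n; left; exact: pre_dir_cone.
case=> // /= d0; have := dir_norm bw; rewrite d0 normr0 => /eqP.
by rewrite eq_sym oner_eq0.
Qed.

(** [L w] maps the approximation with [n] steps at [w] to a positive multiple of the one with [n.+1]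
    steps at [sigma w]; the limit is taken after normalizing. *)
Lemma dir_equivariant w : recurrent GP tau (tau w) ->
  L w (dir w) = `|L w (dir w)| *: dir (sigma w).
Proof.
move=> bw.
have Ld : C (L w (dir w)) by apply: (LC (w := w)); exists (dir w) => //; exact: dir_cone.
have Ld0 := cone_neq0 niceC Ld.
suff -> : dir (sigma w) = normalize (L w (dir w)).
  by rewrite /normalize scalerA mulfV ?scale1r// normr_eq0.
have bs : recurrent GP tau (tau (sigma w)) by rewrite sigmaK; exact: recurrent_preimage.
have cv1 := dir_cvg bs.
have cv2 : (fun n => pre_dir n.+1 (sigma w)) @ \oo --> dir (sigma w).
  by have := cv1; rewrite -cvg_shiftS.
apply: (cvg_unique _ cv2) => //.
have -> : (fun n => pre_dir n.+1 (sigma w)) = (fun n => normalize (L w (pre_dir n w))).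
  apply/funext => n; rewrite /pre_dir iterSr sigmaK /= iter_sigmaK.
  rewrite [normalize (coc _ _ _)]/normalize linearZ normalizeZ// invr_gt0 normr_gt0.
  by apply: (cone_neq0 niceC); exact: coc_in.
apply: normalize_cvg => //.
by apply: (continuous_cvg _ (@blin_continuous _ _ _ (L w) _)); exact: dir_cvg.
Qed.

End direction.

End hopf_cocycle.

Section make_blin.
Context {R : realType} {X Y : normedModType R}.

Lemma bounded_linear_norm_le (f : X -> Y) B : linear f -> (forall x, `|f x| <= B * `|x|) ->
  f \in @bounded_linear R X Y.
Proof.
move=> lf fB; apply/asboolP; split => // x.
have f_sub y z : f (y - z) = f y - f z.
  by rewrite addrC -scaleN1r lf scaleN1r addrC.
apply/cvgrPdist_lt => e e0; near=> y.
rewrite -f_sub (le_lt_trans (fB _))//.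
apply: (@le_lt_trans _ _ (`|B| * `|x - y|)); first by rewrite ler_wpM2r// ler_norm.
have B0 : 0 < `|B| + 1 by rewrite ltr_wpDl.
apply: (@le_lt_trans _ _ ((`|B| + 1) * `|x - y|)); first by rewrite ler_wpM2r// lerDl.
rewrite mulrC -ltr_pdivlMr//; near: y.
by apply: cvgr_dist_lt => //; rewrite divr_gt0.
Unshelve. all: by end_near. Qed.

(** The default [0] makes [eta] total: off the recurrent points the map need not be bounded or
    linear. *)
Definition make_blin (f : X -> Y) : blin X Y :=
  if pselect (f \in @bounded_linear R X Y) is left h then Blin h else 0.

Lemma make_blinE (f : X -> Y) B : linear f -> (forall x, `|f x| <= B * `|x|) ->
  make_blin f = f :> (X -> Y).
Proof.
move=> lf fB; rewrite /make_blin; case: pselect => // h; exfalso; apply: h.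
exact: bounded_linear_norm_le lf fB.
Qed.

End make_blin.

(** * The equivariant splitting and its error bounds *)

Section splitting.
Context {R : realType} {X : completeNormedModType R} {Omega : Type}.
Variables (sigma tau : Omega -> Omega) (L : Omega -> blin X X).
Hypotheses (sigmaK : cancel sigma tau) (tauK : cancel tau sigma).
Variable C : set X.
Hypothesis niceC : nice_cone C.
Hypothesis LC : forall w, [set L w x | x in C] `<=` C.
Variables (GP : set Omega) (k : nat) (q : R).
Hypotheses (k0 : (0 < k)%N) (q1 : 1 < q).
Hypothesis GPq : forall w, GP w -> forall x y, C x -> C y ->
  exists2 l, 0 < l & cone_le C (l *: cocycle sigma L k w x) (cocycle sigma L k w y) /\
    cone_le C (cocycle sigma L k w y) ((q ^+ 2 * l) *: cocycle sigma L k w x).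

Local Notation coc := (cocycle sigma L).
Local Notation Nf n w := (visits GP sigma n w).
Local Notation Nb n w := (visits GP tau n (tau w)).
Local Notation jf n w := (decay_exponent GP k sigma n w).
Local Notation jb n w := (decay_exponent GP k tau n (tau w)).
Local Notation t := (hopf_rate q).

(** Forward visits make [eta] converge and backward visits make [v] converge. The pullback over [n]
    steps applies [L] at the points from [iter n tau w] up to [tau w], so the backward count begins
    at [tau w]. *)
Definition good (w : Omega) := recurrent GP sigma w /\ recurrent GP tau (tau w).

(* The last two inequalities make [eta] the uniform limit, on the unit ball, of
   the ratios of [coc n w x] to [coc n w (v w)]. *)
Record splitting (g : X) (c : R) (v : Omega -> X) (eta : Omega -> blin X R^o) : Prop := {
  split_seed : C g ;
  split_const : 0 < c ;
  split_cone : forall w, good w -> C (v w) ;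
  split_norm : forall w, good w -> `|v w| = 1 ;
  split_eta1 : forall w, good w -> eta w (v w) = 1 ;
  split_eta_ge0 : forall w x, good w -> (C `|` [set 0]) x -> 0 <= eta w x ;
  split_vec : forall w, good w -> L w (v w) = `|L w (v w)| *: v (sigma w) ;
  split_ker : forall w x, good w -> eta w x = 0 -> eta (sigma w) (L w x) = 0 ;
  split_vec_err : forall w n, good w -> (2 * k <= Nb n w)%N ->
    `|normalize (coc n (iter n tau w) g) - v w| <= c * t ^+ jb n w ;
  split_eta_le : forall w n x, good w -> (2 * k <= Nf n w)%N ->
    `|eta w x| <= c * (`|coc n w| / `|coc n w (v w)|) * `|x| ;
  split_eta_err : forall w n0 n x, good w -> (n0 <= n)%N -> (2 * k <= Nf n0 w)%N ->
    `|coc n w x - eta w x *: coc n w (v w)| <=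
      c * (`|coc n0 w| / `|coc n0 w (v w)|) * t ^+ jf n w * `|x| * `|coc n w (v w)| }.

Lemma good_sigma w : good w -> good (sigma w).
Proof.
by move=> [fw bw]; split; [exact: recurrent_image|rewrite sigmaK; exact: recurrent_preimage].
Qed.

Lemma coc_vec_prod v n w : (forall w, good w -> L w (v w) = `|L w (v w)| *: v (sigma w)) ->
  good w -> coc n w (v w) = (\prod_(0 <= i < n) `|L (iter i sigma w) (v (iter i sigma w))|) *:
     v (iter n sigma w).
Proof.
move=> Lv gw.
have gi i : good (iter i sigma w) by elim: i => //= i; exact: good_sigma.
elim: n => [|n IH]; first by rewrite big_nil scale1r.
by rewrite big_nat_recr//= IH linearZ /= {1}Lv// scalerA.
Qed.

(** For [s = q ^+ 2] a single constant dominates those in the error of [v], the size of [eta] and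
    the error of [eta]. *)
Lemma splitting_const (D M s : R) : 1 <= D -> 0 < M -> 1 < s ->
  [/\ 2 * D * (s - 1) <= 2 * D * s * (1 + s * D * M),
    s * D * M <= 2 * D * s * (1 + s * D * M) &
    2 * D * (s - 1) * (s * D * M) <= 2 * D * s * (1 + s * D * M)].
Proof.
move=> D1 M0 s1.
have D0 : 0 < D by lra.
have s0 : 0 < s by lra.
have u0 : 0 < s * D * M by rewrite !mulr_gt0.
have w1 : 1 <= D * s by nra.
rewrite -[2 * D * s]mulrA; set u := s * D * M in u0 *; set r := D * s in w1 *.
have rE : 2 * D * (s - 1) = 2 * r - 2 * D by rewrite /r; ring.
by rewrite rE; clearbody u r; split; nra.
Qed.

Lemma splitting_exists : exists g c v eta, splitting g c v eta.
Proof.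
have [D D1 Dad] := nice_adapted niceC.
have [M [M0 Mdec]] := bounded_decomposition niceC.
have [g Cg] := cone_nonempty niceC.
pose v := dir sigma L tau g.
pose eta w : blin X R^o := make_blin (eta_val sigma L C w (v w) : X -> R^o).
have D0 : 0 < D by exact: lt_le_trans D1.
have q20 : 0 < q ^+ 2 by rewrite exprn_gt0//; apply: lt_trans q1.
pose c := 2 * D * q ^+ 2 * (1 + q ^+ 2 * D * M).
have c0 : 0 < c.
  rewrite /c; move: (q ^+ 2) q20 => s s0.
  have h1 : 0 < 2 * D * s by rewrite !mulr_gt0.
  have h2 : 0 < s * D * M by rewrite !mulr_gt0.
  by rewrite mulr_gt0// addr_gt0.
have Cv w : good w -> C (v w).
  by move=> -[_ bw]; exact: (dir_cone niceC LC k0 q1 GPq D1 Dad sigmaK tauK Cg).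
have etaE w : good w -> eta w = eta_val sigma L C w (v w) :> (X -> R).
  move=> gw; have [fw bw] := gw; have [n h] := fw (2 * k)%N.
  apply: (make_blinE (B := dist_const sigma L q D M n w (v w))).
    exact: (eta_linear niceC LC k0 q1 GPq D1 Dad Mdec fw (Cv _ gw)).
  move=> x; exact (eta_norm_le niceC LC k0 q1 GPq D1 Dad Mdec fw (Cv _ gw) x h).
have vE w : good w -> L w (v w) = `|L w (v w)| *: v (sigma w).
  by move=> [fw bw]; exact: (dir_equivariant niceC LC k0 q1 GPq D1 Dad sigmaK tauK Cg).
have dcE n w : dist_const sigma L q D M n w (v w) =
      q ^+ 2 * D * M * (`|coc n w| / `|coc n w (v w)|).
  by rewrite /dist_const mulrA.
have q21 : 1 < q ^+ 2 by rewrite exprn_egt1.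
have [ca1 ca2 ca3] := splitting_const D1 M0 q21.
have ratio0 n w : 0 <= `|coc n w| / `|coc n w (v w)| :> R.
  by rewrite divr_ge0.
have t0 i : 0 <= t ^+ i by rewrite exprn_ge0// ltW// hopf_rate_gt0.
exists g, c, v, eta; split => //.
- by move=> w [_ bw]; exact: (dir_norm niceC LC k0 q1 GPq D1 Dad sigmaK tauK Cg).
- move=> w gw; rewrite (etaE _ gw).
  exact: (eta_self niceC LC k0 q1 GPq D1 Dad Mdec gw.1 (Cv _ gw)).
- move=> w x gw Kx; rewrite (etaE _ gw).
  apply: (@eta_ge _ _ _ sigma L C niceC LC GP k q k0 q1 GPq D D1 Dad M Mdec w _ gw.1 (Cv _ gw) 0%N).
  by rewrite scale0r cone_le0.
(* When [eta w x = 0], the error bound for [x] along the orbit of [w] is an error bound for [L w x]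
   along the orbit of [sigma w], with coefficient 0; [eta_unique] then identifies the value. *)
- move=> w x gw ex0; rewrite (etaE _ (good_sigma gw)).
  have gs := good_sigma gw.
  pose phi := `|L w (v w)|.
  have phi0 : 0 <= phi by exact: normr_ge0.
  have ex : eta_val sigma L C w (v w) x = 0 by rewrite -(etaE _ gw).
  have [n0 n0P] := gw.1 (2 * k)%N.
  apply: (@eta_unique _ _ _ sigma L C niceC LC GP k q k0 q1 GPq D D1 Dad M Mdec
    (sigma w) (v (sigma w)) gs.1 (Cv _ gs) _ _
    (2 * D * (q ^+ 2 - 1) * dist_const sigma L q D M n0 w (v w) * `|x| * phi)) => j.
  have [n1 n1P] := recurrent_decay k0 gs.1 j.
  have [_ jb] := n1P _ (leq_maxr n0 n1); set n := maxn n0 n1 in jb.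
  exists n; split => //.
  rewrite scale0r subr0 -cocycleSr.
  have n0n : (n0 <= n.+1)%N by rewrite (leq_trans (leq_maxl n0 n1)).
  have := eta_err niceC LC k0 q1 GPq D1 Dad Mdec gw.1 (Cv _ gw) x n0n n0P.
  rewrite ex scale0r subr0 => /le_trans; apply.
  rewrite [coc n.+1 w (v w)]cocycleSr vE// -/phi linearZ normrZ.
  rewrite (ger0_norm phi0).
  set B := 2 * D * (q ^+ 2 - 1) * _.
  have B0 : 0 <= B.
    rewrite /B dcE; apply: mulr_ge0.
      by apply: mulr_ge0; [rewrite mulr_ge0// ltW|rewrite subr_ge0 exprn_ege1// ltW].
    apply: mulr_ge0 => //; apply: mulr_ge0; last exact: ltW.
    by apply: mulr_ge0; apply: ltW.
  clearbody B.
  rewrite [leLHS](_ : _ =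
    B * `|x| * phi * `|coc n (sigma w) (v (sigma w))| * t ^+ decay_exponent GP k sigma n.+1 w); last by ring.
  rewrite [leRHS](_ : _ =
    B * `|x| * phi * `|coc n (sigma w) (v (sigma w))| * t ^+ decay_exponent GP k sigma n (sigma w)); last by ring.
  apply: ler_wpM2l.
    by rewrite !mulr_ge0.
  apply: hopf_rate_expr_le => //.
  exact: decay_exponentS.
- move=> w n gw kN.
  have := pre_dir_err niceC LC k0 q1 GPq D1 Dad sigmaK tauK Cg gw.2 kN.
  rewrite /decay_exponent (bvisitsE _ sigmaK tauK) => /le_trans; apply.
  by rewrite ler_wpM2r.
- move=> w n x gw kN; rewrite (etaE _ gw).
  rewrite (le_trans (eta_norm_le niceC LC k0 q1 GPq D1 Dad Mdec gw.1 (Cv _ gw) x kN))//.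
  by rewrite dcE ler_wpM2r// ler_wpM2r.
- move=> w n0 n x gw n0n kN; rewrite (etaE _ gw).
  rewrite (le_trans (eta_err niceC LC k0 q1 GPq D1 Dad Mdec gw.1 (Cv _ gw) x n0n kN))//.
  by rewrite dcE !ler_wpM2r// mulrA ler_wpM2r.
Qed.

End splitting.

(** * The ergodic theorem *)

Section full_sets.
Context {R : realType} {d} {Omega : measurableType d} (mu : probability Omega R).

Definition full (A : set Omega) : Prop := measurable A /\ mu A = 1%E.

Lemma fullP A : full A <-> measurable A /\ mu.-negligible (~` A).
Proof.
split=> -[mA h]; split => //.
  apply/negligibleP; first exact: measurableC.
  by have := probability_setC mu mA; rewrite h subee.
have /negligibleP := h => /(_ (measurableC mA)) h0.
by rewrite -[A]setCK probability_setC ?h0 ?sube0//; exact: measurableC.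
Qed.

Lemma fullT : full setT.
Proof. by split; [exact: measurableT|exact: probability_setT]. Qed.

Lemma full_bigcap (A : nat -> set Omega) : (forall n, full (A n)) -> full (\bigcap_n A n).
Proof.
move=> fA; apply/fullP; split; first by apply: bigcap_measurable => // n _; have [] := fA n.
rewrite setC_bigcap; apply: negligible_bigcup => n.
by have /fullP[] := fA n.
Qed.

Lemma fullI A B : full A -> full B -> full (A `&` B).
Proof.
move=> /fullP[mA nA] /fullP[mB nB]; apply/fullP; split; first exact: measurableI.
by rewrite setCI; exact: negligibleU.
Qed.

Lemma full_sub A B : measurable B -> A `<=` B -> full A -> full B.
Proof.
move=> mB AB /fullP[mA nA]; apply/fullP; split => //.
by apply: negligibleS nA; exact: subsetC.
Qed.

Lemma full_ae A (P : Omega -> Prop) : full A -> (forall w, A w -> P w) -> {ae mu, forall w, P w}.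
Proof.
by move=> /fullP[mA nA] AP; apply: negligibleS nA => w /= nP Aw; apply: nP; exact: AP.
Qed.

Lemma full_bigcap_countable (J : countType) (A : J -> set Omega) :
  (forall i, full (A i)) -> full (\bigcap_i A i).
Proof.
move=> fA.
have -> : \bigcap_i A i = \bigcap_n (if unpickle n is Some i then A i else setT).
  apply/seteqP; split => w h => [n _|i _]; first by case: unpickle => // i; exact: h.
  by have := h (pickle i) I; rewrite pickleK.
by apply: full_bigcap => n; case: unpickle => [i|]; [exact: fA|exact: fullT].
Qed.

End full_sets.

Lemma erat_between (R : realType) (x y : \bar R) : (x < y)%E ->
  exists r : rat, (x < (ratr r)%:E < y)%E.
Proof.
have rl (a b : R) : a < b -> exists r : rat, (a%:E < (ratr r)%:E < b%:E)%E.
  by move=> /rat_in_itvoo[r]; rewrite in_itv /= => rab; exists r; rewrite !lte_fin.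
case: x => [x| |]; case: y => [y| |] xy; try by move: xy; rewrite ltNge ?leey ?leNye.
- exact: rl.
- have [|r /andP[xr _]] := rl x (x + 1); first by lra.
  by exists r; rewrite xr ltry.
- have [|r /andP[_ ry]] := rl (y - 1) y; first by lra.
  by exists r; rewrite ry ltNyr.
- by exists 0; rewrite ltNyr ltry.
Qed.

Section birkhoff.
Context {R : realType} {d} {Omega : measurableType d} (mu : probability Omega R).
Variable sigma : Omega -> Omega.
Hypothesis msigma : measurable_fun setT sigma.
Hypothesis pres : forall A, measurable A -> mu (sigma @^-1` A) = mu A.
Hypothesis erg : forall A, measurable A -> sigma @^-1` A = A -> mu A = 0%E \/ mu A = 1%E.
Implicit Types F : Omega -> R.

Lemma measurable_iter n : measurable_fun setT (iter n sigma).
Proof. by elim: n => [|n IH]; [exact: measurable_id|exact: measurableT_comp msigma IH]. Qed.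

Lemma measurable_preimage A : measurable A -> measurable (sigma @^-1` A).
Proof. by move=> mA; rewrite -[_ @^-1` _]setTI; exact: msigma. Qed.

Lemma full_preimage A : full mu A -> full mu (sigma @^-1` A).
Proof. by move=> [mA A1]; split; [exact: measurable_preimage|rewrite pres]. Qed.

Lemma integral_preserving (f : Omega -> \bar R) : measurable_fun setT f ->
  (forall w, (0 <= f w)%E) -> (\int[mu]_w f (sigma w) = \int[mu]_w f w)%E.
Proof.
move=> mf f0.
have := ge0_integral_pushforward msigma mu measurableT mf (fun y _ => f0 y).
rewrite preimage_setT => <-; apply: eq_measure_integral => A mA _.
exact: pres.
Qed.

Definition birkhoff_sum F n w : R := \sum_(0 <= i < n) F (iter i sigma w).

Lemma birkhoff_sumS F n w : birkhoff_sum F n.+1 w = F w + birkhoff_sum F n (sigma w).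
Proof.
by rewrite /birkhoff_sum big_nat_recl//; congr (_ + _); apply: eq_bigr => i _; rewrite -iterSr.
Qed.

(** This is the maximum of the Birkhoff sums of lengths 0 to [n]; the recursive form is the relation
    between [w] and [sigma w] that the maximal ergodic theorem uses. *)
Fixpoint maximal_sum F n w : R :=
  if n is m.+1 then Num.max 0 (F w + maximal_sum F m (sigma w)) else 0.

Lemma maximal_sum_ge0 F n w : 0 <= maximal_sum F n w.
Proof. by case: n => //= n; rewrite le_max lexx. Qed.

Lemma birkhoff_sum_le_maximal F n w : birkhoff_sum F n w <= maximal_sum F n w.
Proof.
elim: n w => [|n IH] w; first by rewrite /birkhoff_sum big_nil.
by rewrite birkhoff_sumS /= le_max lerD2l IH orbT.
Qed.

Lemma maximal_sum_nd F n m w : (n <= m)%N -> maximal_sum F n w <= maximal_sum F m w.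
Proof.
elim: n m w => [|n IH] [|m] w //= nm; first by rewrite le_max lexx.
by rewrite ge_max !le_max lexx/= lerD2l IH ?orbT.
Qed.

Lemma measurable_maximal_sum F n : measurable_fun setT F ->
  measurable_fun setT (maximal_sum F n).
Proof.
move=> mF; elim: n => [|n IH]; first exact: measurable_cst.
apply: measurable_maxr; first exact: measurable_cst.
by apply: measurable_funD => //; exact: measurableT_comp IH msigma.
Qed.

Definition maximal_unbounded F : set Omega :=
  [set w | forall j : nat, exists n, j%:R < maximal_sum F n w].

Lemma measurable_maximal_unbounded F : measurable_fun setT F ->
  measurable (maximal_unbounded F).
Proof.
move=> mF.
have -> : maximal_unbounded F = \bigcap_(j : nat) \bigcup_n [set w | j%:R < maximal_sum F n w].
  by apply/seteqP; split => [w h j _|w h j]; [have [n] := h j; exists n|have [n] := h j I; exists n].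
apply: bigcap_measurable => // j _; apply: bigcup_measurable => n _.
rewrite -[X in measurable X]setTI.
exact: (measurable_fun_ltr (measurable_cst _) (measurable_maximal_sum n mF)).
Qed.

(** Passing from [w] to [sigma w] changes the maximal sums by at most the finite amount [F w], up to
    a shift of the index. *)
Lemma maximal_unbounded_invariant F : sigma @^-1` maximal_unbounded F = maximal_unbounded F.
Proof.
apply/seteqP; split => w /= h j.
  have [n hn] := h (Num.truncn (`|F w| + j%:R)).+1; exists n.+1 => /=.
  rewrite lt_max; apply/orP; right.
  have /andP[_ h1] := truncn_itv (addr_ge0 (normr_ge0 (F w)) (ler0n R j)).
  have := lt_trans h1 hn; have := ler_norm (- F w); rewrite normrN; lra.
have [n] := h (Num.truncn (`|F w| + j%:R)).+1.
have /andP[_ h1] := truncn_itv (addr_ge0 (normr_ge0 (F w)) (ler0n R j)).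
have aj : 0 <= `|F w| + j%:R by rewrite addr_ge0.
move=> hn; have := lt_trans h1 hn; case: n {hn} => [|n] /=; first by lra.
rewrite lt_max => /orP[|]; first by lra.
by have := ler_norm (F w); exists n; lra.
Qed.

(** Finiteness allows the integrals of the maximal sums to be cancelled in the maximal ergodic
    theorem. *)
Lemma maximal_sum_integral_fin F n : measurable_fun setT F ->
  (\int[mu]_w (Num.max 0 (F w))%:E < +oo)%E ->
  (\int[mu]_w (maximal_sum F n w)%:E < +oo)%E.
Proof.
move=> mF Ffin; elim: n => [|n IH]; first by rewrite integral0 ltry.
have mM := measurable_maximal_sum n mF.
apply: (@le_lt_trans _ _ (\int[mu]_w ((Num.max 0 (F w))%:E + (maximal_sum F n (sigma w))%:E))%E).
  apply: ge0_le_integral => //.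
  - by move=> w _; rewrite lee_fin maximal_sum_ge0.
  - by apply/measurable_EFinP; exact: measurable_maximal_sum.
  - apply: emeasurable_funD; apply/measurable_EFinP.
      by apply: measurable_maxr => //; exact: measurable_cst.
    exact: measurableT_comp mM msigma.
  - move=> w _; rewrite -EFinD lee_fin /= ge_max.
    rewrite addr_ge0 ?maximal_sum_ge0 ?le_max ?lexx//= lerD2r.
    by rewrite le_max lexx orbT.
rewrite ge0_integralD//.
- rewrite (integral_preserving (f := fun w => (maximal_sum F n w)%:E)).
  + exact: lte_add_pinfty.
  + by apply/measurable_EFinP.
  + by move=> w; rewrite lee_fin maximal_sum_ge0.
- by move=> w _; rewrite lee_fin le_max lexx.
- by apply/measurable_EFinP; apply: measurable_maxr => //; exact: measurable_cst.
- by move=> w _; rewrite lee_fin maximal_sum_ge0.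
- by apply/measurable_EFinP; exact: measurableT_comp mM msigma.
Qed.

(* On the invariant set where the maximal sums are unbounded, [M_(n+1) - M_n o
   sigma = max (- M_n o sigma) F] decreases to [F], while its integral is
   nonnegative by invariance of [mu]. *)
Lemma maximal_ergodic F : measurable_fun setT F ->
  (\int[mu]_w (Num.max 0 (F w))%:E < \int[mu]_w (Num.max 0 (- F w))%:E)%E ->
  full mu (~` maximal_unbounded F).
Proof.
move=> mF Fneg.
have mE := measurable_maximal_unbounded mF.
have [E0|E1] := erg mE (maximal_unbounded_invariant F).
  split; first exact: measurableC.
  by have := probability_setC mu mE; rewrite E0 sube0.
exfalso; move: Fneg; apply/negP; rewrite -leNgt.
set E := maximal_unbounded F in mE E1 *.
pose M := maximal_sum F.
have mM n : measurable_fun setT (M n) := measurable_maximal_sum n mF.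
have mMs n : measurable_fun setT (fun w => M n (sigma w)) := measurableT_comp (mM n) msigma.
have M0 n w : 0 <= M n w := maximal_sum_ge0 F n w.
have [Finf|Ffin] := leP +oo%E (\int[mu]_w (Num.max 0 (F w))%:E)%E.
  by rewrite (le_trans (leey _) Finf).
(* Subtracting from the positive part of [F] gives a nonnegative nondecreasing sequence, to which
   monotone convergence applies even if the negative part has infinite integral. On the invariant
   set its limit is that negative part. *)
pose h n w := Num.max 0 (F w) - (M n.+1 w - M n (sigma w)).
have mFp : measurable_fun setT (fun w => Num.max 0 (F w)).
  by apply: measurable_maxr => //; exact: measurable_cst.
have mFn : measurable_fun setT (fun w => Num.max 0 (- F w)).
  by apply: measurable_maxr; [exact: measurable_cst|exact: measurableT_comp].
have mh n : measurable_fun setT (h n).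
  by apply: measurable_funB => //; apply: measurable_funB.
have hE n w : h n w = Num.max 0 (F w) - Num.max (- M n (sigma w)) (F w).
  by rewrite /h /M /= -/(M n (sigma w)); congr (_ - _); rewrite /Num.max; do 2 case: ifPn; lra.
have h0 n w : 0 <= h n w.
  by rewrite hE subr_ge0 ge_max !le_max lexx oppr_le0 M0 /= orbT.
have hnd n m w : (n <= m)%N -> h n w <= h m w.
  move=> nm; rewrite !hE lerD2l lerN2 ge_max !le_max lexx lerN2.
  by rewrite (maximal_sum_nd F (sigma w) nm) orbT.
have hint n : (\int[mu]_w (h n w)%:E <= \int[mu]_w (Num.max 0 (F w))%:E)%E.
  have Mfin m : (\int[mu]_w (M m w)%:E)%E \is a fin_num.
    rewrite ge0_fin_numE; first exact: maximal_sum_integral_fin.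
    by apply: integral_ge0 => w _; rewrite lee_fin.
  have : (\int[mu]_w ((h n w)%:E + (M n.+1 w)%:E) =
          \int[mu]_w ((Num.max 0 (F w))%:E + (M n (sigma w))%:E))%E.
    by apply: eq_integral => w _; rewrite -!EFinD /h; congr (_%:E); ring.
  rewrite ge0_integralD//=; last 4 first.
  - by move=> w _; rewrite lee_fin.
  - exact/measurable_EFinP.
  - by move=> w _; rewrite lee_fin.
  - exact/measurable_EFinP.
  rewrite ge0_integralD//=; last 4 first.
  - by move=> w _; rewrite lee_fin le_max lexx.
  - exact/measurable_EFinP.
  - by move=> w _; rewrite lee_fin.
  - exact/measurable_EFinP.
  rewrite (integral_preserving (f := fun w => (M n w)%:E)); last 2 first.
  - exact/measurable_EFinP.
  - by move=> w; rewrite lee_fin.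
  move=> eqh; rewrite -(@leeD2rE _ (\int[mu]_w (M n.+1 w)%:E)%E)// eqh leeD2l//.
  apply: ge0_le_integral => //.
  - by move=> w _; rewrite lee_fin.
  - exact/measurable_EFinP.
  - exact/measurable_EFinP.
  - by move=> w _; rewrite lee_fin; exact: maximal_sum_nd.
have mono := @cvg_monotone_convergence _ _ _ mu E mE (fun n w => (h n w)%:E).
have : (\int[mu]_(w in E) limn (fun n => (h n w)%:E) <= \int[mu]_w (Num.max 0 (F w))%:E)%E.
  have cv : (fun n => \int[mu]_(w in E) (h n w)%:E)%E @ \oo -->
      (\int[mu]_(w in E) limn (fun n => (h n w)%:E))%E.
    apply: mono.
    - by move=> n; apply: measurable_funTS; exact/measurable_EFinP.
    - by move=> n w _; rewrite lee_fin.
    - by move=> w _ n m nm; rewrite lee_fin; exact: hnd.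
  rewrite -(cvg_lim _ cv)//; apply: lime_le; first by apply/cvg_ex; eexists; exact: cv.
  apply: nearW => n; apply: le_trans (hint n); apply: ge0_subset_integral => //.
  - exact/measurable_EFinP.
  - by move=> w _; rewrite lee_fin.
apply: le_trans; rewrite le_eqVlt; apply/orP; left; apply/eqP.
rewrite (@ge0_negligible_integral _ _ _ mu setT (~` E)) //; last 4 first.
- exact: measurableC.
- exact/measurable_EFinP.
- by move=> w _; rewrite lee_fin le_max lexx.
- by have := probability_setC mu mE; rewrite E1 subee.
rewrite setTD setCK; apply: eq_integral => w; rewrite inE => Ew.
(* Once the maximal sum at [sigma w] exceeds [- F w], the sequence [h n w] is constant in [n]. *)
have [n0 n0P] : exists n0, forall n, (n0 <= n)%N -> - M n (sigma w) <= F w.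
  have : E (sigma w) by move: Ew; rewrite /E -{1}(maximal_unbounded_invariant F).
  move=> /(_ (Num.truncn `|F w|).+1)[n0 hn0]; exists n0 => n n0n.
  have /andP[_ h1] := truncn_itv (normr_ge0 (F w)).
  have := maximal_sum_nd F (sigma w) n0n; have := lt_trans h1 hn0.
  by have := ler_norm (- F w); rewrite normrN /M; lra.
apply/esym/cvg_lim => //; apply: cvg_near_cst.
exists n0 => // n /= n0n; rewrite hE (max_r (n0P _ n0n)); congr (_%:E).
by rewrite /Num.max; do 2 case: ifPn; lra.
Qed.

Lemma max0B (x : R) : Num.max 0 x - Num.max 0 (- x) = x.
Proof. by rewrite /Num.max; do 2 case: ifPn; lra. Qed.

(* The integral of a function that is only quasi-integrable from above. *)
Definition birkhoff_mean F : \bar R :=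
  (\int[mu]_w (Num.max 0 (F w))%:E - \int[mu]_w (Num.max 0 (- F w))%:E)%E.

(** [F - c] has negative mean, so almost everywhere its maximal sums are bounded, and [B] is such a
    bound. *)
Lemma birkhoff_upper F c : measurable_fun setT F ->
  (\int[mu]_w (Num.max 0 (F w))%:E < +oo)%E -> (birkhoff_mean F < c%:E)%E ->
  exists A, full mu A /\ forall w, A w -> exists B, forall n, birkhoff_sum F n w <= c * n%:R + B.
Proof.
move=> mF Ffin Fc.
have mFc : measurable_fun setT (fun w => F w - c) by apply: measurable_funB.
have mpos (f : Omega -> R) : measurable_fun setT f ->
    measurable_fun setT (fun w => (Num.max 0 (f w))%:E).
  by move=> mf; apply/measurable_EFinP; apply: measurable_maxr => //; exact: measurable_cst.
have mneg (f : Omega -> R) : measurable_fun setT f ->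
    measurable_fun setT (fun w => (Num.max 0 (- f w))%:E).
  by move=> mf; apply: mpos; exact: measurableT_comp.
have ge0 (f : Omega -> R) w : (0 <= (Num.max 0 (f w))%:E)%E by rewrite lee_fin le_max lexx.
have i0 (f : Omega -> R) : (0 <= \int[mu]_w (Num.max 0 (f w))%:E)%E by exact: integral_ge0.
have icst (a : R) : (\int[mu]_(w in setT) a%:E)%E = a%:E.
  by rewrite integral_cst// -[RHS]mule1; congr (_ * _)%E; exact: probability_setT.
exists (~` maximal_unbounded (fun w => F w - c)); split.
  apply: maximal_ergodic => //.
  (* The splitting of [F - c] into positive and negative parts is written with sums only, so it
     stays meaningful when the negative part has integral [+oo]. *)
  have eqi : (\int[mu]_w (Num.max 0 (F w - c))%:E + (\int[mu]_w (Num.max 0 (- F w))%:E + (Num.max 0 c)%:E) =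
     \int[mu]_w (Num.max 0 (- (F w - c)))%:E + (\int[mu]_w (Num.max 0 (F w))%:E + (Num.max 0 (- c))%:E))%E.
    rewrite -{1}(icst (Num.max 0 c)) -{1}(icst (Num.max 0 (- c))).
    rewrite -!ge0_integralD; try by repeat first [exact: measurableT | exact: mneg |
      exact: mpos | exact: measurable_cst | apply: emeasurable_funD |
      by move=> w _; rewrite ?adde_ge0// lee_fin le_max lexx].
    apply: eq_integral => w _; rewrite -!EFinD; congr (_%:E).
    have := max0B (F w - c); have := max0B (F w); have := max0B c; lra.
  have pfin : (\int[mu]_w (Num.max 0 (F w - c))%:E < +oo)%E.
    apply: (@le_lt_trans _ _ (\int[mu]_w ((Num.max 0 (F w))%:E + (`|c|)%:E))%E).
      apply: ge0_le_integral; try by repeat first [exact: measurableT |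
        exact: mpos | exact: measurable_cst | apply: emeasurable_funD |
        by move=> w _; rewrite lee_fin le_max lexx].
      move=> w _; rewrite -EFinD lee_fin; have := ler_norm (- c); rewrite normrN.
      by have := ler_norm c; have := normr_ge0 c; rewrite /Num.max; do 2 case: ifPn; lra.
    rewrite ge0_integralD; try by repeat first [exact: measurableT |
      exact: mpos | exact: measurable_cst | by move=> w _; rewrite lee_fin ?le_max ?lexx].
    by rewrite icst lte_add_pinfty// ltry.
  move: Fc eqi pfin; rewrite /birkhoff_mean.
  move: Ffin (i0 F) (i0 (fun w => - F w)) (i0 (fun w => F w - c)) (i0 (fun w => - (F w - c))) => /=.
  move: (\int[mu]_w _)%E (\int[mu]_w _)%E (\int[mu]_w _)%E (\int[mu]_w _)%E.
  move=> [a| |] [b| |] [p| |] [m| |] //=; rewrite ?lte_fin ?lee_fin// => _ _ _ _ _.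
  by move=> abc [] + _; have := max0B c; lra.
move=> w /=; rewrite /maximal_unbounded /= => /existsNP[j /forallNP hj].
exists j%:R => n.
have := birkhoff_sum_le_maximal (fun w => F w - c) n w.
have : maximal_sum (fun w => F w - c) n w <= j%:R by rewrite leNgt; apply/negP; exact: hj.
have -> : birkhoff_sum (fun w => F w - c) n w = birkhoff_sum F n w - c * n%:R.
  rewrite /birkhoff_sum sumrB; congr (_ - _).
  by rewrite sumr_const_nat subn0 mulr_natr.
lra.
Qed.

(** Affine bounds for all slopes express convergence of the averages, including to [-oo]. One full
    set serves all [c] because rational slopes suffice. The lower bounds are upper bounds for [- F],
    whose positive part is integrable as soon as some slope lies below the mean. *)
Theorem birkhoff F : measurable_fun setT F -> (\int[mu]_w (Num.max 0 (F w))%:E < +oo)%E ->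
  exists A, full mu A /\ forall w, A w ->
    (forall c, (birkhoff_mean F < c%:E)%E ->
      exists B, forall n, birkhoff_sum F n w <= c * n%:R + B) /\
    (forall c, (c%:E < birkhoff_mean F)%E ->
      exists B, forall n, c * n%:R - B <= birkhoff_sum F n w).
Proof.
move=> mF Ffin.
have i0 (f : Omega -> R) : (0 <= \int[mu]_w (Num.max 0 (f w))%:E)%E.
  by apply: integral_ge0 => w _; rewrite lee_fin le_max lexx.
have hup (r : rat) : exists A, full mu A /\ forall w, A w -> (birkhoff_mean F < (ratr r)%:E)%E ->
      exists B, forall n, birkhoff_sum F n w <= ratr r * n%:R + B.
  have [h|h] := pselect (birkhoff_mean F < (ratr r)%:E)%E; last by exists setT; split => //; exact: fullT.
  have [A [fA AP]] := birkhoff_upper mF Ffin h.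
  by exists A; split => // w Aw _; exact: AP.
have hlow (r : rat) : exists A, full mu A /\ forall w, A w -> ((ratr r)%:E < birkhoff_mean F)%E ->
      exists B, forall n, ratr r * n%:R - B <= birkhoff_sum F n w.
  have [h|h] := pselect ((ratr r)%:E < birkhoff_mean F)%E; last by exists setT; split => //; exact: fullT.
  have FNfin : (\int[mu]_w (Num.max 0 (- F w))%:E < +oo)%E.
    by rewrite ltNge; apply/negP; rewrite leye_eq => /eqP e; move: h; rewrite /birkhoff_mean e /= addeNy.
  have mFN : measurable_fun setT (fun w => - F w) by exact: measurableT_comp.
  have hN : (birkhoff_mean (fun w => - F w)%R < (- ratr r)%:E)%E.
    move: h; rewrite /birkhoff_mean.
    rewrite (_ : (\int[mu]_w (Num.max 0 (- - F w))%:E)%E = (\int[mu]_w (Num.max 0 (F w))%:E)%E); last first.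
      by apply: eq_integral => w _; rewrite opprK.
    move: Ffin FNfin (i0 F) (i0 (fun w => - F w)) => /=.
    move: (\int[mu]_w _)%E (\int[mu]_w _)%E => [a| |] [b| |] //= _ _ _ _.
    by rewrite -!EFinD !lte_fin; lra.
  have [A [fA AP]] := birkhoff_upper mFN FNfin hN.
  exists A; split => // w Aw _; have [B BP] := AP w Aw; exists B => n.
  have := BP n; rewrite /birkhoff_sum sumrN; lra.
have /choice[U UP] := hup; have /choice[V VP] := hlow.
exists ((\bigcap_r U r) `&` (\bigcap_r V r)); split.
  by apply: fullI; apply: full_bigcap_countable => r; [have [] := UP r|have [] := VP r].
move=> w [Uw Vw]; split => c /erat_between[r /andP[h1 h2]].
- have [B BP] := (UP r).2 w (Uw r I) h1; exists B => n.
  by rewrite (le_trans (BP n))// lerD2r ler_wpM2r// ltW// -lte_fin.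
- have [B BP] := (VP r).2 w (Vw r I) h2; exists B => n.
  by rewrite (le_trans _ (BP n))// lerD2r ler_wpM2r// ltW// -lte_fin.
Qed.

(** Each superlevel set at a rational level is contained in its preimage and has the same measure.
    The increasing union of its iterated preimages is invariant and also has that measure, so
    ergodicity makes it 0 or 1; the constant is the supremum of the levels of measure 1. *)
Lemma subinvariant_constant (A0 : set Omega) (g : Omega -> \bar R) : full mu A0 ->
  sigma @^-1` A0 = A0 -> measurable_fun A0 g -> (forall w, A0 w -> (g w <= g (sigma w))%E) ->
  exists c A, full mu A /\ forall w, A w -> g w = c.
Proof.
move=> fA0 invA0 mg gle.
pose U (r : rat) := [set w | A0 w /\ ((ratr r)%:E <= g w)%E].
have mA0 : measurable A0 by have [] := fA0.
have mU r : measurable (U r).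
  have -> : U r = A0 `&` g @^-1` `[(ratr r)%:E, +oo[%classic.
    by apply/seteqP; split => w [A0w] /=; rewrite in_itv /= andbT.
  by apply: mg => //; exact: emeasurable_itv.
have sA0 w : A0 w -> A0 (sigma w) by rewrite -{1}invA0.
have U01 r : mu (U r) = 0%E \/ mu (U r) = 1%E.
  pose Un n := iter n sigma @^-1` U r.
  have mUn n : measurable (Un n) by rewrite -[Un n]setTI; exact: measurable_iter.
  have sub w : U r w -> U r (sigma w).
    by move=> [A0w rw]; split; [exact: sA0|exact: le_trans (gle _ A0w)].
  have mUUn : measurable (\bigcup_n Un n) by exact: bigcup_measurable.
  have muUn n : mu (Un n) = mu (U r).
    elim: n => // n <-; rewrite -[RHS]pres//; congr (mu _).
    by apply/seteqP; split => w; rewrite /Un /= -iterS iterSr.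
  have <- : mu (\bigcup_n Un n) = mu (U r).
    have cv : (mu \o Un) @ \oo --> mu (\bigcup_n Un n).
      apply: nondecreasing_cvg_mu => //.
      by apply/nondecreasing_seqP => n; apply/subsetPset => w; exact: sub.
    apply: (cvg_unique _ cv) => //=.
    rewrite (_ : mu \o Un = cst (mu (U r))); first exact: cvg_cst.
    by apply/funext => n /=.
  apply: erg => //; apply/seteqP; split => w /= [n _ Unw].
    by exists n.+1 => //; rewrite /Un /= -iterS iterSr.
  by exists n => //; rewrite /Un /= -iterSr iterS; exact: sub.
pose c : \bar R := ereal_sup [set x | exists r : rat, mu (U r) = 1%E /\ x = (ratr r)%:E].
exists c, (A0 `&` \bigcap_r (if pselect (mu (U r) = 1%E) then U r else ~` U r)); split.
  apply: fullI => //; apply: full_bigcap_countable => r; case: pselect => [h|nh] /=; first by split.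
  split; first exact: measurableC.
  have [h0|//] := U01 r.
  by have := probability_setC mu (mU r); rewrite h0 sube0.
move=> w [A0w Uw]; apply/eqP; rewrite eq_le; apply/andP; split.
  rewrite leNgt; apply/negP => /erat_between[r /andP[cr rg]].
  have := Uw r I; case: pselect => [h _|nh]; last by apply; split => //; exact: ltW.
  move: cr; rewrite ltNge => /negP; apply.
  by apply: ereal_sup_ubound; exists r.
apply: ge_ereal_sup => _ [r [h ->]].
by have := Uw r I; case: pselect => // _ [].
Qed.

End birkhoff.

Section invariant_core.
Context {R : realType} {d} {Omega : measurableType d} (mu : probability Omega R).
Variables sigma tau : Omega -> Omega.
Hypotheses (sigmaK : cancel sigma tau) (tauK : cancel tau sigma).
Hypotheses (msigma : measurable_fun setT sigma) (mtau : measurable_fun setT tau).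
Hypothesis pres : forall A, measurable A -> mu (sigma @^-1` A) = mu A.

Lemma preserving_inverse A : measurable A -> mu (tau @^-1` A) = mu A.
Proof.
move=> mA; have mtA := measurable_preimage mtau mA.
by rewrite -(pres mtA); congr (mu _); apply/seteqP; split => w /=; rewrite sigmaK.
Qed.

Lemma ergodic_inverse :
  (forall A, measurable A -> sigma @^-1` A = A -> mu A = 0%E \/ mu A = 1%E) ->
  forall A, measurable A -> tau @^-1` A = A -> mu A = 0%E \/ mu A = 1%E.
Proof.
move=> erg A mA invA; apply: erg => //; rewrite -{1}invA.
by apply/seteqP; split => w /=; rewrite sigmaK.
Qed.

(** Intersecting over the iterates of both [sigma] and its inverse gives equality of the preimage,
    not only an inclusion. *)
Lemma full_invariant_core A : full mu A ->
  exists A', [/\ full mu A', sigma @^-1` A' = A' & A' `<=` A].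
Proof.
move=> fA.
pose A' := (\bigcap_n (iter n sigma @^-1` A)) `&` (\bigcap_n (iter n tau @^-1` A)).
have fit f : measurable_fun setT f -> (forall B, measurable B -> mu (f @^-1` B) = mu B) ->
    forall n, full mu (iter n f @^-1` A).
  move=> mf pf; elim=> [//|n IH].
  have -> : iter n.+1 f @^-1` A = f @^-1` (iter n f @^-1` A).
    by apply/seteqP; split => w /=; rewrite -iterS iterSr.
  exact: full_preimage.
exists A'; split.
- apply: fullI; apply: full_bigcap; first exact: fit.
  by apply: fit => //; exact: preserving_inverse.
- apply/seteqP; split => w [fw bw]; split => n _ /=.
  + case: n => [|n]; last by have := fw n I; rewrite /= -iterS iterSr.
    by have := bw 1%N I; rewrite /= sigmaK.
  + by have := bw n.+1 I; rewrite /preimage /= -iterS iterSr sigmaK.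
  + by have := fw n.+1 I; rewrite /= -iterS iterSr.
  + case: n => [|n]; first by have := fw 1%N I.
    by have := bw n I; rewrite /= -iterS iterSr sigmaK.
- by move=> w [fw _]; exact: (fw 0%N I).
Qed.

End invariant_core.

(** * Lyapunov exponents *)

Section log_rates.
Context {R : realType}.
Implicit Types (u : nat -> \bar R) (a b : nat -> R) (l : \bar R) (c r : R).

Lemma limn_esup_inf u : limn_esup u = ereal_inf (range (esups u)).
Proof. by rewrite limn_esup_lim; apply/cvg_lim => //; exact: cvg_esups_inf. Qed.

Lemma limn_esup_le u l N : (forall n, (N <= n)%N -> (u n <= l)%E) -> (limn_esup u <= l)%E.
Proof.
move=> ul; rewrite limn_esup_inf; apply: (@le_trans _ _ (esups u N)).
  by apply: ereal_inf_lbound; exists N.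
by apply: ge_ereal_sup => _ [n /= Nn <-]; exact: ul.
Qed.

Lemma limn_esup_lt u l : (limn_esup u < l)%E -> exists N, forall n, (N <= n)%N -> (u n < l)%E.
Proof.
rewrite limn_esup_inf => /ereal_inf_lt[_ [N _ <-] Nl]; exists N => n Nn.
by apply: le_lt_trans Nl; apply: ereal_sup_ubound; exists n.
Qed.

Lemma ecvg_sandwich u l :
  (forall c, (l < c%:E)%E -> exists N, forall n, (N <= n)%N -> (u n <= c%:E)%E) ->
  (forall c, (c%:E < l)%E -> exists N, forall n, (N <= n)%N -> (c%:E <= u n)%E) ->
  u @ \oo --> l.
Proof.
move=> up lo.
have h1 : (ereal_inf (range (esups u)) <= l)%E.
  rewrite leNgt; apply/negP => /erat_between[r /andP[lr rE]].
  have [N uN] := up _ lr; move: rE; rewrite ltNge => /negP; apply.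
  apply: (@le_trans _ _ (esups u N)); first by apply: ereal_inf_lbound; exists N.
  by apply: ge_ereal_sup => _ [n /= Nn <-]; exact: uN.
have h2 : (l <= ereal_sup (range (einfs u)))%E.
  rewrite leNgt; apply/negP => /erat_between[r /andP[Er rl]].
  have [N uN] := lo _ rl; move: Er; rewrite ltNge => /negP; apply.
  apply: (@le_trans _ _ (einfs u N)); last by apply: ereal_sup_ubound; exists N.
  by apply: le_ereal_inf_tmp => _ [n /= Nn <-]; exact: uN.
have h3 : (ereal_sup (range (einfs u)) <= ereal_inf (range (esups u)))%E.
  rewrite -(cvg_lim _ (@cvg_esups_inf _ u))// -(cvg_lim _ (@cvg_einfs_sup _ u))//.
  apply: lee_lim; [exact: is_cvg_einfs|exact: is_cvg_esups|].
  by apply: nearW => n; exact: einfs_le_esups.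
have e1 : ereal_inf (range (esups u)) = l.
  by apply/eqP; rewrite eq_le h1 (le_trans h2 h3).
have e2 : ereal_sup (range (einfs u)) = l.
  by apply/eqP; rewrite eq_le h2 (le_trans h3 h1).
apply: (@squeeze_cvge _ _ _ _ (einfs u) _ (esups u)).
- apply: nearW => n; apply/andP; split.
    by apply: ereal_inf_lbound; exists n => /=.
  by apply: ereal_sup_ubound; exists n => /=.
- by rewrite -e2; exact: cvg_einfs_sup.
- by rewrite -e1; exact: cvg_esups_inf.
Qed.

(** A nonpositive value has rate [-oo] and lies below every exponential, so no positivity is
    assumed. At time 0 the convention [0^-1 = 0] makes the rate 0 whatever [a] is, hence [0 < n]. *)
Lemma log_rate_le a n c : (0 < n)%N -> (log_rate a n <= c%:E)%E = (a n <= expR (c * n%:R)).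
Proof.
move=> n0; have n0' : 0 < n%:R :> R by rewrite ltr0n.
rewrite /log_rate /lne; case: ifPn => [an0|].
  rewrite mulrNy gtr0_sg ?invr_gt0// mul1e leNye; apply/esym.
  exact: le_trans an0 (expR_ge0 _).
rewrite -ltNge => an0.
rewrite -EFinM lee_fin mulrC ler_pdivrMr//.
by rewrite -{2}(lnK (_ : a n \is Num.pos)) ?posrE// ler_expR.
Qed.

Lemma log_rate_ge a n c : (0 < n)%N -> (c%:E <= log_rate a n)%E = (expR (c * n%:R) <= a n).
Proof.
move=> n0; have n0' : 0 < n%:R :> R by rewrite ltr0n.
rewrite /log_rate /lne; case: ifPn => [an0|].
  rewrite mulrNy gtr0_sg ?invr_gt0// mul1e leeNy_eq /=; apply/esym/negbTE.
  by rewrite -ltNge (le_lt_trans an0)// expR_gt0.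
rewrite -ltNge => an0.
rewrite -EFinM lee_fin mulrC ler_pdivlMr//.
by rewrite -{2}(lnK (_ : a n \is Num.pos)) ?posrE// ler_expR.
Qed.

Lemma affine_le_linear c c' B : c < c' ->
  exists N, forall n, (N <= n)%N -> c * n%:R + B <= c' * n%:R.
Proof.
move=> cc'; have d0 : 0 < c' - c by rewrite subr_gt0.
exists (Num.truncn (`|B| / (c' - c))).+1 => n Nn.
have /andP[_ h] := truncn_itv (divr_ge0 (normr_ge0 B) (ltW d0)).
have : `|B| / (c' - c) <= n%:R by apply: le_trans (ltW h) _; rewrite ler_nat.
rewrite ler_pdivrMr//; have := ler_norm B; lra.
Qed.

(** The slack [B] makes this stable under positive constant factors and under a shift of time. *)
Definition exp_bounded a c := exists B N, forall n, (N <= n)%N -> a n <= expR (c * n%:R + B).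

Lemma exp_bounded_log_rate a c c' : exp_bounded a c -> c < c' ->
  exists N, forall n, (N <= n)%N -> (log_rate a n <= c'%:E)%E.
Proof.
move=> [B [N aN]] cc'; have [N1 N1P] := affine_le_linear B cc'.
exists (maxn 1 (maxn N N1)) => n; rewrite !geq_max => /and3P[n0 Nn N1n].
by rewrite log_rate_le// (le_trans (aN _ Nn))// ler_expR N1P.
Qed.

Lemma limsup_log_rate_le a l : (forall c, (l < c%:E)%E -> exp_bounded a c) ->
  (limn_esup (log_rate a) <= l)%E.
Proof.
move=> h; rewrite leNgt; apply/negP => /erat_between[r /andP[lr rE]].
have [r' /andP[lr' r'r]] := erat_between lr.
rewrite lte_fin in r'r.
have [N aN] := exp_bounded_log_rate (h _ lr') r'r.
by move: rE; rewrite ltNge => /negP; apply; exact: limn_esup_le aN.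
Qed.

Lemma limsup_log_rate_lt a c : (limn_esup (log_rate a) < c%:E)%E -> exp_bounded a c.
Proof.
move=> /limn_esup_lt[N aN]; exists 0, (maxn 1 N) => n; rewrite geq_max => /andP[n0 Nn].
by rewrite addr0 -log_rate_le// ltW// aN.
Qed.

Lemma log_rate_cvg a l : (forall c, (l < c%:E)%E -> exp_bounded a c) ->
  (forall c, (c%:E < l)%E -> exists B, forall n, expR (c * n%:R - B) <= a n) ->
  log_rate a @ \oo --> l.
Proof.
move=> up lo; apply: ecvg_sandwich => c.
- move=> /erat_between[r /andP[lr rc]]; rewrite lte_fin in rc.
  exact: exp_bounded_log_rate (up _ lr) rc.
- move=> /erat_between[r /andP[cr rl]]; rewrite lte_fin in cr.
  have [B aB] := lo _ rl; have [N NP] := affine_le_linear B cr.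
  exists (maxn 1 N) => n; rewrite geq_max => /andP[n0 Nn].
  rewrite log_rate_ge// (le_trans _ (aB n))// ler_expR.
  by have := NP _ Nn; lra.
Qed.

Lemma exp_bounded_le a b c K N : 0 < K -> (forall n, (N <= n)%N -> a n <= K * b n) ->
  exp_bounded b c -> exp_bounded a c.
Proof.
move=> K0 ab [B [N1 bN]]; exists (B + ln K), (maxn N N1) => n.
rewrite geq_max => /andP[Nn N1n]; rewrite (le_trans (ab _ Nn))//.
by rewrite addrA expRD (lnK (_ : K \is Num.pos)) ?posrE// mulrC ler_wpM2r ?bN// ltW.
Qed.

Lemma exp_bounded_shift a b c K : 0 < K -> (forall n, a n.+1 <= K * b n) ->
  exp_bounded b c -> exp_bounded a c.
Proof.
move=> K0 ab [B [N bN]]; exists (B + ln K - c), N.+1 => -[//|n] Nn.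
rewrite (le_trans (ab _))//.
rewrite (_ : c * n.+1%:R + _ = (c * n%:R + B) + ln K); last by rewrite -natr1; ring.
by rewrite expRD (lnK (_ : K \is Num.pos)) ?posrE// mulrC ler_wpM2r ?bN// ltW.
Qed.

End log_rates.

Section opnorm_on.
Context {R : realType} {X Y : normedModType R}.
Variables (V : set X) (f : blin X Y).
Hypotheses (V0 : V 0) (VZ : forall (a : R) x, V x -> V (a *: x)).

Let has_sup_on : has_sup [set `|f x| | x in V `&` [set x | `|x| <= 1]].
Proof.
split; first by exists `|f 0|, 0 => //; split => //=; rewrite normr0.
have [_ [M MP]] := opnorm_has_sup f; exists M => _ [x [_ x1] <-].
by apply: MP; exists x.
Qed.

Lemma opnorm_on_ge0 : 0 <= opnorm_on V f.
Proof.
apply: sup_upper_bound => //.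
by exists 0; [split => //=; rewrite normr0|rewrite linear0 normr0].
Qed.

Lemma ler_opnorm_on x : V x -> `|f x| <= opnorm_on V f * `|x|.
Proof.
move=> Vx; have [->|x0] := eqVneq x 0; first by rewrite linear0 !normr0 mulr0.
have nx : 0 < `|x| by rewrite normr_gt0.
rewrite -ler_pdivrMr//; apply: sup_upper_bound => //.
exists (`|x|^-1 *: x).
  by split; [exact: VZ|rewrite /= normrZ ger0_norm ?invr_ge0// mulVf// gt_eqF].
by rewrite linearZ/= normrZ ger0_norm ?invr_ge0// mulrC.
Qed.

Lemma opnorm_on_le M : (forall x, V x -> `|x| <= 1 -> `|f x| <= M) -> opnorm_on V f <= M.
Proof.
move=> fM; apply: ge_sup; first by have [] := has_sup_on.
by move=> _ [x [Vx /= x1] <-]; exact: fM.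
Qed.

End opnorm_on.

Section rank_one.
Context {R : realType} {X : normedModType R}.

Definition rank_one (f : blin X R^o) (v : X) : blin X X := make_blin (fun x => f x *: v).

Lemma rank_oneE f v x : rank_one f v x = f x *: v.
Proof.
rewrite /rank_one (make_blinE (B := opnorm_on setT f * `|v|))//.
- by move=> a y z; rewrite linearP scalerDl scalerA.
- by move=> y; rewrite normrZ mulrAC ler_wpM2r//; exact: ler_opnorm.
Qed.

Definition co_rank_one (f : blin X R^o) (v : X) : blin X X := blin_id X - rank_one f v.

Lemma co_rank_oneE f v x : co_rank_one f v x = x - f x *: v.
Proof. by rewrite -rank_oneE. Qed.

Variables (f : blin X R^o) (v : X).
Hypothesis fv : f v = 1.

Let fD y a : f (y + a *: v) = f y + a.
Proof. by rewrite raddfD /= linearZ /= fv -[_ *: _]/(a * 1) mulr1. Qed.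

Let fZ a : f (a *: v) = a.
Proof. by rewrite -[a *: v]add0r fD linear0 add0r. Qed.

Lemma ker_co_rank_one x : f (co_rank_one f v x) = 0.
Proof. by rewrite co_rank_oneE -scaleNr fD subrr. Qed.

Lemma rank_one_decomposition : v != 0 /\ direct_sum (line v) (ker f).
Proof.
have v0 : v != 0.
  by apply/eqP => v0; move: fv; rewrite v0 linear0 => /eqP; rewrite eq_sym oner_eq0.
split => //; split.
  apply/seteqP; split => // x _; exists (f x *: v); first by exists (f x).
  exists (x - f x *: v); last by rewrite addrC subrK.
  by rewrite -co_rank_oneE; exact: ker_co_rank_one.
apply/seteqP; split => [x [[a _ <-]]|x ->]; last first.
  by split; [exists 0; rewrite ?scale0r|rewrite /ker /= linear0].
by rewrite /ker /= fZ => ->; rewrite scale0r.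
Qed.

Lemma rank_one_projections : projection_along (line v) (ker f) (rank_one f v) /\
  projection_along (ker f) (line v) (co_rank_one f v).
Proof.
split=> [_ y [a _ <-] fy|x _ fx [a _ <-]].
  by rewrite rank_oneE addrC fD (fy : f y = 0) add0r.
by rewrite co_rank_oneE fD (fx : f x = 0) add0r addrK.
Qed.

Lemma co_rank_one_ker x : f x = 0 -> co_rank_one f v x = x.
Proof. by move=> fx; rewrite co_rank_oneE fx scale0r subr0. Qed.

End rank_one.

Lemma fine_probability (R : realType) d (T : measurableType d)
    (mu : probability T R) (A : set T) :
  measurable A -> (fine (mu A))%:E = mu A.
Proof. by move=> mA; rewrite fineK// fin_num_measure. Qed.

Section visits_measure.
Context {R : realType} {d} {Omega : measurableType d} (mu : probability Omega R).
Variable (GP : set Omega).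
Hypotheses (mGP : measurable GP).
Variable f : Omega -> Omega.
Hypothesis mf : measurable_fun setT f.

Lemma visits_birkhoff n w : (visits GP f n w)%:R = birkhoff_sum f (\1_GP) n w :> R.
Proof. by rewrite /visits /birkhoff_sum natr_sum. Qed.

Lemma measurable_visits_ge m n : measurable [set w | (m <= visits GP f n w)%N].
Proof.
have -> : [set w | (m <= visits GP f n w)%N] = [set w | (m%:R : R) <= birkhoff_sum f (\1_GP) n w].
  by apply/seteqP; split => w /=; rewrite -visits_birkhoff ler_nat.
have mS : measurable_fun setT (birkhoff_sum f (\1_GP : Omega -> R) n).
  by apply: measurable_sum => i; apply: measurableT_comp;
    [exact: measurable_indic|exact: measurable_iter].
by rewrite -[X in measurable X]setTI; exact: (measurable_fun_ler (measurable_cst _) mS).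
Qed.

Hypothesis pres : forall A, measurable A -> mu (f @^-1` A) = mu A.
Hypothesis erg : forall A, measurable A -> f @^-1` A = A -> mu A = 0%E \/ mu A = 1%E.

Lemma visits_asymptotic : exists A, full mu A /\ forall w, A w ->
  forall c, c < fine (mu GP) -> exists B, forall n, c * n%:R - B <= (visits GP f n w)%:R.
Proof.
have m1 : measurable_fun setT (\1_GP : Omega -> R) by exact: measurable_indic.
have pE : (\int[mu]_w (Num.max 0 ((\1_GP : Omega -> R) w))%:E = mu GP)%E.
  rewrite -[in RHS](setIT GP) -integral_indic//; apply: eq_integral => w _; congr (_%:E).
  by apply/max_idPr; rewrite indicE ler0n.
have nE : (\int[mu]_w (Num.max 0 (- (\1_GP : Omega -> R) w))%:E = 0)%E.
  rewrite -(integral0 mu setT); apply: eq_integral => w _; congr (_%:E).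
  by apply/max_idPl; rewrite oppr_le0 indicE ler0n.
have mean : birkhoff_mean mu (\1_GP : Omega -> R) = mu GP.
  by rewrite /birkhoff_mean pE nE sube0.
have [|A [fA AP]] := @birkhoff _ _ _ mu f mf pres erg _ m1.
  by rewrite pE -fine_probability// ltry.
exists A; split => // w Aw c cG.
have [|B BP] := (AP w Aw).2 c; first by rewrite mean -fine_probability// lte_fin.
by exists B => n; rewrite visits_birkhoff.
Qed.

Lemma recurrent_full : (0 < mu GP)%E -> full mu (recurrent GP f).
Proof.
move=> GP0; have [A [fA AP]] := visits_asymptotic.
apply: full_sub fA.
  have -> : recurrent GP f = \bigcap_m \bigcup_n [set w | (m <= visits GP f n w)%N].
    by apply/seteqP; split => [w h m _|w h m]; [have [n] := h m; exists n|have [n] := h m I; exists n].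
  by apply: bigcap_measurable => // m _; apply: bigcup_measurable => n _; exact: measurable_visits_ge.
move=> w Aw m.
have G0 : 0 < fine (mu GP) by rewrite -lte_fin fine_probability.
have [|B BP] := AP w Aw (fine (mu GP) / 2); first by lra.
have G2 : 0 < fine (mu GP) / 2 by rewrite divr_gt0.
have [N NP] := affine_le_linear (`|B| + m%:R) G2.
exists N; rewrite -(ler_nat R) (le_trans _ (BP N))//.
by have := NP N (leqnn _); rewrite mul0r add0r; have := ler_norm B; lra.
Qed.

End visits_measure.

Lemma measurable_lne_EFin (R : realType) : measurable_fun setT (fun x : R => lne x%:E).
Proof.
rewrite /lne; apply: measurable_fun_ifT.
- by apply: measurable_fun_ler; [exact: measurable_id|exact: measurable_cst].
- exact: measurable_cst.
- by apply/measurable_EFinP; exact: measurable_ln.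
Qed.

(** * Growth rates along the splitting *)

Section growth.
Context {R : realType} {X : completeNormedModType R} {d} {Omega : measurableType d}.
Variables (mu : probability Omega R) (sigma tau : Omega -> Omega) (L : Omega -> blin X X).
Hypotheses (sigmaK : cancel sigma tau) (tauK : cancel tau sigma).
Hypotheses (msigma : measurable_fun setT sigma) (mtau : measurable_fun setT tau).
Hypothesis pres : forall A, measurable A -> mu (sigma @^-1` A) = mu A.
Hypothesis erg : forall A, measurable A -> sigma @^-1` A = A -> mu A = 0%E \/ mu A = 1%E.
Hypothesis log_int : ae_integrable mu (fun w => log_plus `|L w|).
Variables (C : set X) (GP : set Omega) (k : nat) (q : R).
Hypotheses (niceC : nice_cone C) (LC : forall w, [set L w x | x in C] `<=` C).
Hypotheses (mGP : measurable GP) (GP0 : (0 < mu GP)%E) (k0 : (0 < k)%N) (q1 : 1 < q).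
Variables (g : X) (c0 : R) (v : Omega -> X) (eta : Omega -> blin X R^o).
Hypothesis sp : splitting sigma tau L C GP k q g c0 v eta.

Local Notation coc := (cocycle sigma L).
Local Notation good := (good sigma tau GP).
Local Notation phi w := `|L w (v w)|.
Local Notation Q w := (co_rank_one (eta w) (v w)).
Local Notation t := (hopf_rate q).

Hypothesis mphi : exists A, full mu A /\ measurable_fun A (fun w => phi w).
Hypothesis mQ : forall n, exists A, full mu A /\
  measurable_fun A (fun w => `|blin_comp (coc n w) (Q w)|).

Lemma good_full : full mu good.
Proof.
apply: fullI; first exact: recurrent_full.
apply: (@full_preimage _ _ _ mu tau mtau) => //.
  by move=> A mA; exact: (preserving_inverse sigmaK mtau pres).
apply: recurrent_full => //.
- by move=> A mA; exact: (preserving_inverse sigmaK mtau pres).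
- exact: (ergodic_inverse sigmaK erg).
Qed.

Lemma phi_gt0 w : good w -> 0 < phi w.
Proof.
move=> gw; rewrite normr_gt0; apply: (cone_neq0 niceC); apply: (LC (w := w)).
by exists (v w) => //; exact: split_cone sp _ gw.
Qed.

Lemma good_iter n w : good w -> good (iter n sigma w).
Proof. by move=> gw; elim: n => //= n; exact: good_sigma. Qed.

Lemma norm_coc_vec n w : good w ->
  `|coc n w (v w)| = expR (birkhoff_sum sigma (fun w => ln (phi w)) n w).
Proof.
move=> gw; rewrite (coc_vec_prod sigmaK n (split_vec sp) gw) normrZ.
rewrite (split_norm sp (good_iter n gw)) mulr1 /birkhoff_sum.
rewrite ger0_norm; last by apply: prodr_ge0.
elim: n => [|n IH]; first by rewrite !big_nil expR0.
rewrite !big_nat_recr//= expRD IH; congr (_ * _).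
by rewrite lnK// posrE; apply: phi_gt0; exact: good_iter.
Qed.

(** By equivariance the logarithm of [|coc n w (v w)|] is a Birkhoff sum of [ln (phi w)]. Since
    [|v w| = 1], its positive part is dominated by [log_plus |L w|]. *)
Lemma vector_growth : exists l : \bar R, (l < +oo)%E /\ exists A, full mu A /\
  forall w, A w -> good w -> (forall i, A (iter i sigma w)) ->
    (forall c, (l < c%:E)%E -> exists B, forall n, `|coc n w (v w)| <= expR (c * n%:R + B)) /\
    (forall c, (c%:E < l)%E -> exists B, forall n, expR (c * n%:R - B) <= `|coc n w (v w)|).
Proof.
have [A1 [mA1 A11 iA1]] := log_int.
have [A2 [fA2 mphiA2]] := mphi.
pose A := A1 `&` A2 `&` good.
have fA : full mu A by apply: fullI good_full; apply: fullI.
have mA : measurable A by have [] := fA.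
(* Cutting off outside [A] gives a function measurable on the whole space; the Birkhoff sums are
   unchanged on orbits that stay in [A]. *)
pose F w := if w \in A then ln (phi w) else 0.
have mF : measurable_fun setT F.
  apply: measurable_fun_if => //.
  - apply: (measurable_fun_bool true); rewrite setTI (_ : _ @^-1` _ = A)//.
    by apply/seteqP; split => w /= h; [exact/set_mem|exact/mem_set].
  - apply: measurableT_comp; first exact: measurable_ln.
    apply: measurable_funS mphiA2; first by have [] := fA2.
    by rewrite setTI => w /= /set_mem[[]].
have mFp : measurable_fun setT (fun w => (Num.max 0 (F w))%:E).
  by apply/measurable_EFinP; apply: measurable_maxr => //; exact: measurable_cst.
have Fp0 w : (0 <= (Num.max 0 (F w))%:E)%E by rewrite lee_fin le_max lexx.
have Ffin : (\int[mu]_w (Num.max 0 (F w))%:E < +oo)%E.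
  have /fullP[_ /negligibleP nA] := fA.
  rewrite (@ge0_negligible_integral _ _ _ mu setT (~` A)) //; last 2 first.
  - exact: measurableC.
  - by apply: nA; exact: measurableC.
  rewrite setTD setCK.
  have iA : mu.-integrable A (EFin \o (fun w => log_plus `|L w|)).
    by apply: integrableS iA1 => // w [[]].
  have [mlA] := integrableP _ _ _ iA; apply: le_lt_trans.
  apply: ge0_le_integral => //.
  - exact: measurable_funTS.
  - by apply: measurableT_comp mlA; exact: abse_measurable.
  move=> w Aw; rewrite /= lee_fin /F (mem_set Aw).
  rewrite (le_trans _ (ler_norm _))// /log_plus ge_max !le_max lexx/=.
  have [_ gw] := Aw; have p0 := phi_gt0 gw.
  have pL : phi w <= `|L w|.
    by rewrite (le_trans (ler_opnorm _ _))// (split_norm sp gw) mulr1.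
  by rewrite ler_ln ?posrE ?pL ?orbT// (lt_le_trans p0).
have [A3 [fA3 A3P]] := @birkhoff _ _ _ mu sigma msigma pres erg F mF Ffin.
exists (birkhoff_mean mu F); split.
  rewrite /birkhoff_mean; apply: (@le_lt_trans _ _ (\int[mu]_w (Num.max 0 (F w))%:E)%E) => //.
  by apply: geeDl; rewrite oppe_le0; apply: integral_ge0 => w _; rewrite lee_fin le_max lexx.
exists (A `&` A3); split; first exact: fullI.
move=> w [Aw A3w] gw Aiw.
have SF n : `|coc n w (v w)| = expR (birkhoff_sum sigma F n w).
  rewrite norm_coc_vec//; congr expR; apply: eq_bigr => i _.
  by rewrite /F mem_set//; have [] := Aiw i.
split=> c hc.
- by have [B BP] := (A3P w A3w).1 c hc; exists B => n; rewrite SF ler_expR.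
- by have [B BP] := (A3P w A3w).2 c hc; exists B => n; rewrite SF ler_expR.
Qed.

Lemma t_gt0 : 0 < t. Proof. exact: hopf_rate_gt0. Qed.

Lemma t_expr_le1 n : t ^+ n <= 1.
Proof. by apply: exprn_ile1; apply: ltW; [exact: t_gt0|exact: hopf_rate_lt1]. Qed.

Lemma coc_vec_gt0 n w : good w -> 0 < `|coc n w (v w)|.
Proof. by move=> gw; rewrite norm_coc_vec ?expR_gt0. Qed.

(** The converse comparison holds because [v w] is a unit vector, so the growth rate of [v] is the
    maximal exponent. *)
Lemma coc_norm_le w : good w -> exists K n0, 0 < K /\ forall n, (n0 <= n)%N ->
  `|coc n w| <= K * `|coc n w (v w)|.
Proof.
move=> gw; have [n0 n0P] := gw.1 (2 * k)%N.
pose r := `|coc n0 w| / `|coc n0 w (v w)|.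
have r0 : 0 <= r by rewrite divr_ge0.
have c00 := split_const sp.
exists (2 * c0 * r + 1), n0; split; first by rewrite ltr_wpDl// !mulr_ge0// ltW.
move=> n n0n; apply: opnorm_le => x x1.
have e1 := split_eta_err sp x gw n0n n0P; have e2 := split_eta_le sp x gw n0P.
rewrite -/r in e1 e2.
rewrite -[coc n w x](subrK (eta w x *: coc n w (v w))) (le_trans (ler_normD _ _))//.
rewrite normrZ (le_trans (lerD e1 (ler_wpM2r (normr_ge0 _) e2)))// -mulrDl ler_wpM2r//.
have cr : 0 <= c0 * r by rewrite mulr_ge0// ltW.
have h1 : c0 * r * t ^+ decay_exponent GP k sigma n w * `|x| <= c0 * r.
  rewrite -mulrA -[leRHS]mulr1 ler_wpM2l// mulr_ile1// ?t_expr_le1//.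
  by rewrite exprn_ge0// ltW// t_gt0.
have h2 : c0 * r * `|x| <= c0 * r by rewrite -[leRHS]mulr1 ler_wpM2l.
lra.
Qed.

Lemma ker0 w : ker (eta w) 0.
Proof. by rewrite /ker /= linear0. Qed.

Lemma kerZ w (a : R) x : ker (eta w) x -> ker (eta w) (a *: x).
Proof. by rewrite /ker /= linearZ /= => ->; rewrite scaler0. Qed.

Lemma coc_ker_le n w : good w ->
  opnorm_on (ker (eta w)) (coc n w) <= `|blin_comp (coc n w) (Q w)|.
Proof.
move=> gw; apply: opnorm_on_le => [|x kx x1]; first exact: ker0.
rewrite -{1}(co_rank_one_ker (v w) kx).
rewrite (le_trans (ler_opnorm (blin_comp (coc n w) (Q w)) x))// ler_piMr//.
exact: opnorm_ge0.
Qed.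

Lemma coc_ker_ge n w : good w ->
  `|blin_comp (coc n w) (Q w)| <= (`|Q w| + 1) * opnorm_on (ker (eta w)) (coc n w).
Proof.
move=> gw; have o0 : 0 <= opnorm_on (ker (eta w)) (coc n w) by apply: opnorm_on_ge0; exact: ker0.
apply: opnorm_le => x x1.
have kQ : ker (eta w) (Q w x) by exact: ker_co_rank_one (split_eta1 sp gw) x.
rewrite (le_trans (ler_opnorm_on _ (ker0 w) (@kerZ w) kQ))// mulrC ler_wpM2r//.
rewrite (le_trans (ler_opnorm _ _))// (@le_trans _ _ `|Q w|) ?lerDl//.
by rewrite ler_piMr// opnorm_ge0.
Qed.

Local Notation growth w := (growth_rate_on sigma L (ker (eta w)) w).

(** The kernel varies with [w]; composing with the projection onto it replaces the restricted norm
    by an operator norm on the whole space, whose measurability can be established. *)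
Lemma growthE w : good w -> growth w = limn_esup (log_rate (fun n => `|blin_comp (coc n w) (Q w)|)).
Proof.
move=> gw; apply/eqP; rewrite eq_le; apply/andP; split.
  apply: limsup_log_rate_le => c /limsup_log_rate_lt.
  by apply: (@exp_bounded_le _ _ _ _ 1 0%N) => // n _; rewrite mul1r coc_ker_le.
apply: limsup_log_rate_le => c /limsup_log_rate_lt.
apply: (@exp_bounded_le _ _ _ _ (`|Q w| + 1) 0%N) => [|n _]; last exact: coc_ker_ge.
by rewrite ltr_wpDl.
Qed.

(** Only an inequality: [L w] maps the kernel into the next kernel but need not map onto it. *)
Lemma growth_sigma w : good w -> (growth w <= growth (sigma w))%E.
Proof.
move=> gw; apply: limsup_log_rate_le => c /limsup_log_rate_lt.
apply: (@exp_bounded_shift _ _ _ _ (`|L w| + 1)) => [|n]; first by rewrite ltr_wpDl.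
have o0 : 0 <= opnorm_on (ker (eta (sigma w))) (coc n (sigma w)).
  by apply: opnorm_on_ge0; exact: ker0.
apply: opnorm_on_le => [|x kx x1]; first exact: ker0.
rewrite cocycleSr.
have kL : ker (eta (sigma w)) (L w x) by exact: split_ker sp _ _ gw kx.
rewrite (le_trans (ler_opnorm_on _ (ker0 _) (@kerZ _) kL))// mulrC ler_wpM2r//.
rewrite (le_trans (ler_opnorm _ _))// (@le_trans _ _ `|L w|) ?lerDl//.
by rewrite ler_piMr// opnorm_ge0.
Qed.

Lemma growth_gap w (l : R) : good w ->
  (forall c, l < c -> exists B, forall n, `|coc n w (v w)| <= expR (c * n%:R + B)) ->
  (forall c, c < fine (mu GP) -> exists B, forall n, c * n%:R - B <= (visits GP sigma n w)%:R) ->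
  (growth w <= (l - fine (mu GP) / k%:R * ln t^-1)%:E)%E.
Proof.
move=> gw hup hvis; apply: limsup_log_rate_le => c; rewrite lte_fin => hc.
have kR : 0 < k%:R :> R by rewrite ltr0n.
have kap0 : 0 < ln t^-1.
  by rewrite ln_gt0// invf_gt1 ?hopf_rate_lt1// t_gt0.
set kap := ln t^-1 in hc kap0.
set m := fine (mu GP) in hc hvis.
(* Losing [e] both in the growth rate of [v] and in the frequency of visits costs
   [e * (1 + kap / k%:R)], exactly the room between [c] and the claimed bound. *)
pose e := (c - (l - m / k%:R * kap)) / (1 + kap / k%:R).
have d0 : 0 < 1 + kap / k%:R by rewrite ltr_pwDl// divr_ge0// ltW.
have e0 : 0 < e by rewrite divr_gt0// subr_gt0.
have [|B1 B1P] := hup (l + e); first by rewrite ltrDl.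
have [|B2 B2P] := hvis (m - e); first by rewrite gtrDl oppr_lt0.
have [n0 n0P] := gw.1 (2 * k)%N.
pose r := c0 * (`|coc n0 w| / `|coc n0 w (v w)|).
have r0 : 0 <= r by rewrite mulr_ge0 ?divr_ge0// ltW// (split_const sp).
have r1 : 0 < r + 1 by rewrite ltr_wpDl.
exists (B1 + (3 + B2 / k%:R) * kap + ln (r + 1)), n0 => n n0n.
apply: opnorm_on_le => [|x kx x1]; first exact: ker0.
have := split_eta_err sp x gw n0n n0P; rewrite (kx : eta w x = 0) scale0r subr0 -/r => /le_trans; apply.
have tE : t = expR (- kap) by rewrite /kap lnV ?posrE ?t_gt0// opprK lnK// posrE t_gt0.
have tj : t ^+ decay_exponent GP k sigma n w <= expR (- kap * ((m - e) * n%:R / k%:R - B2 / k%:R - 3)).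
  rewrite tE -expRM_natr ler_expR !mulNr lerN2 ler_pM2l//.
  rewrite -mulrBl lerBlDr.
  have h : ((visits GP sigma n w)%:R / k%:R <= (decay_exponent GP k sigma n w)%:R + 3 :> R).
    by rewrite ler_pdivrMr// -natrD -natrM ler_nat; exact: visits_le_decay.
  apply: le_trans h; rewrite ler_pM2r ?invr_gt0//; exact: B2P.
have t1 : 0 <= t ^+ decay_exponent GP k sigma n w by rewrite exprn_ge0// ltW// t_gt0.
apply: (@le_trans _ _ ((r + 1) * expR (- kap * ((m - e) * n%:R / k%:R - B2 / k%:R - 3)) * expR ((l + e) * n%:R + B1))).
  apply: ler_pM => //; first exact: mulr_ge0 (mulr_ge0 r0 t1) (normr_ge0 x).
  rewrite (@le_trans _ _ (r * t ^+ decay_exponent GP k sigma n w))//.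
    by rewrite ler_piMr//; exact: mulr_ge0.
  by apply: ler_pM => //; rewrite lerDl.
rewrite -[X in X * _ * _ <= _](lnK (_ : r + 1 \is Num.pos)) ?posrE// -!expRD ler_expR.
rewrite le_eqVlt; apply/orP; left; apply/eqP.
have -> : c = l - m / k%:R * kap + e * (1 + kap / k%:R).
  by rewrite /e divfK ?gt_eqF//; ring.
by field; rewrite gt_eqF.
Qed.

Theorem lyapunov_structure : exists l1 l2 A,
  [/\ full mu A, sigma @^-1` A = A, A `<=` good & (l1 < +oo)%E] /\
  (forall w, A w -> log_rate (fun n => `|coc n w|) @ \oo --> l1) /\
  (forall w, A w -> lyapunov_exponent sigma L w (v w) = l1) /\
  (forall w, A w -> growth w = l2) /\
  (l1 != -oo%E -> (l2 <= l1 - (fine (mu GP) / k%:R * ln t^-1)%:E)%E) /\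
  (l1 != -oo%E -> forall w, A w -> forall x, ker (eta w) x ->
    (lyapunov_exponent sigma L w x < l1)%E).
Proof.
have [l1 [l1y [A1 [fA1 A1P]]]] := vector_growth.
have [A2 [fA2 A2P]] := visits_asymptotic mGP msigma pres erg.
have /choice[A3 A3P] := mQ.
have fA4 : full mu (A1 `&` A2 `&` (\bigcap_n A3 n) `&` good).
  apply: fullI good_full; apply: fullI; first exact: fullI.
  by apply: full_bigcap => n; have [] := A3P n.
(* Two invariant cores are taken: on [A5] the growth rate is measurable, and inside the later core
   [A] it is constant. *)
have [A5 [fA5 invA5 A5A4]] := full_invariant_core sigmaK msigma mtau pres fA4.
have mA5 : measurable A5 by have [] := fA5.
have gA5 w : A5 w -> good w by move=> /A5A4[].
have mg : measurable_fun A5 (fun w => growth w).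
  apply: (eq_measurable_fun (fun w => limn_esup (log_rate (fun n => `|blin_comp (coc n w) (Q w)|)))).
    by move=> w /set_mem A5w; rewrite growthE//; exact: gA5.
  apply: measurable_fun_limn_esup => n.
  apply: emeasurable_funM; first exact: measurable_cst.
  apply: (measurableT_comp (f := fun x : R => lne x%:E)); first exact: measurable_lne_EFin.
  by have [_] := A3P n; apply: measurable_funS; [have [[]] := A3P n|move=> w /A5A4[[_ h] _]; exact: h].
have [l2 [A6 [fA6 A6P]]] := subinvariant_constant msigma pres erg fA5 invA5 mg
  (fun w A5w => growth_sigma (gA5 w A5w)).
have [A [fA invA AA]] := full_invariant_core sigmaK msigma mtau pres (fullI fA5 fA6).
have iterA i w : A w -> A (iter i sigma w).
  by move=> Aw; elim: i => //= i; rewrite -{1}invA.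
have gA w : A w -> good w by move=> /AA[/gA5].
have A1w w : A w -> A1 w by move=> /AA[/A5A4[[[]]]].
have A2w w : A w -> A2 w by move=> /AA[/A5A4[[[]]]].
have vg w (Aw : A w) := A1P w (A1w w Aw) (gA w Aw) (fun i => A1w _ (iterA i w Aw)).
have eb w : A w -> forall c, (l1 < c%:E)%E -> exp_bounded (fun n => `|coc n w (v w)|) c.
  by move=> Aw c hc; have [B BP] := (vg w Aw).1 c hc; exists B, 0%N => n _.
have gapA : l1 != -oo%E -> (l2 <= l1 - (fine (mu GP) / k%:R * ln t^-1)%:E)%E.
  have [w Aw] : A !=set0.
    by apply/set0P/eqP => A0; have := fA.2; rewrite A0 measure0 => /eqP; rewrite eqe eq_sym oner_eq0.
  move: l1y vg => {eb A1P}; case: l1 => [l| |]// _ vg _.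
  rewrite -(A6P w (AA w Aw).2) -EFinB; apply: growth_gap; first exact: gA.
    by move=> c lc; apply: (vg w Aw).1; rewrite lte_fin.
  exact: A2P (A2w w Aw).
have growthl2 w : A w -> growth w = l2 by move=> /AA[_ /A6P].
exists l1, l2, A; split; first by split => // w /gA.
split; [|split; [|split; [|split]]] => //.
- move=> w Aw; apply: log_rate_cvg.
    move=> c hc; have [K [n0 [K0 Kn]]] := coc_norm_le (gA w Aw).
    exact: exp_bounded_le K0 Kn (eb w Aw c hc).
  move=> c hc; have [B BP] := (vg w Aw).2 c hc; exists B => n.
  rewrite (le_trans (BP n))// (le_trans (ler_opnorm _ _))//.
  by rewrite (split_norm sp (gA w Aw)) mulr1.
- move=> w Aw.
  have cv : log_rate (fun n => `|coc n w (v w)|) @ \oo --> l1.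
    by apply: log_rate_cvg => c hc; [exact: eb|exact: (vg w Aw).2 c hc].
  by rewrite /lyapunov_exponent (cvg_limn_einf_sup cv).2.
- move=> l1Ny w Aw x kx; apply: (@le_lt_trans _ _ l2).
    rewrite -(growthl2 w Aw); apply: limsup_log_rate_le => c /limsup_log_rate_lt.
    apply: (@exp_bounded_le _ _ _ _ (`|x| + 1) 0%N) => [|n _]; first by rewrite ltr_wpDl.
    rewrite (le_trans (ler_opnorm_on _ (ker0 _) (@kerZ _) kx))// mulrC ler_wpM2r ?lerDl//.
    by apply: opnorm_on_ge0; exact: ker0.
  apply: le_lt_trans (gapA l1Ny) _.
  move: l1y l1Ny; case: (l1) => [l| |]// _ _; rewrite -EFinB lte_fin gtrBl.
  rewrite mulr_gt0//; last by rewrite ln_gt0// invf_gt1 ?hopf_rate_lt1// t_gt0.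
  by rewrite divr_gt0 ?ltr0n// -lte_fin fine_probability.
Qed.

(** Norm ratios are accessible to measurability and continuity arguments. They only recover
    [|eta w x|], but on the cone [eta] is nonnegative, and the cone is generating. *)
Lemma eta_ratio_err w n0 n x : good w -> (n0 <= n)%N -> (2 * k <= visits GP sigma n0 w)%N ->
  `| `|coc n w x| / `|coc n w (v w)| - `|eta w x| | <=
    c0 * (`|coc n0 w| / `|coc n0 w (v w)|) * t ^+ decay_exponent GP k sigma n w * `|x|.
Proof.
move=> gw n0n n0P; have p0 := coc_vec_gt0 n gw.
have h := split_eta_err sp x gw n0n n0P.
rewrite -(ler_pM2r p0); apply: le_trans h.
rewrite -[X in _ * X <= _](gtr0_norm p0) -normrM mulrBl divfK ?gt_eqF// -normrZ.
exact: ler_dist_dist.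
Qed.

Lemma eta_ratio_cvg w x : good w ->
  (fun n => `|coc n w x| / `|coc n w (v w)|) @ \oo --> `|eta w x|.
Proof.
move=> gw; have [n0 n0P] := gw.1 (2 * k)%N.
apply/cvgrPdist_lt => e e0.
have [j0 j0P] := small_hopf_rate q1 (c0 * (`|coc n0 w| / `|coc n0 w (v w)|) * `|x|) e0.
have [n1 n1P] := recurrent_decay k0 gw.1 j0.
exists (maxn n0 n1) => // n /=; rewrite geq_max => /andP[n0n n1n].
rewrite distrC (le_lt_trans (eta_ratio_err x gw n0n n0P))// mulrAC.
by apply: j0P; have [] := n1P n n1n.
Qed.

Lemma vec_cvg w : good w -> (fun n => normalize (coc n (iter n tau w) g)) @ \oo --> v w.
Proof.
move=> gw; apply/cvgrPdist_lt => e e0.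
have [j0 j0P] := small_hopf_rate q1 c0 e0.
have [n1 n1P] := recurrent_decay k0 gw.2 j0.
exists n1 => // n /= n1n; have [kN jN] := n1P n n1n.
by rewrite distrC (le_lt_trans (split_vec_err sp gw kN))// j0P.
Qed.

End growth.

(** * Measurability for separable spaces *)

Section separable_measurability.
Context {R : realType} {X : normedModType R}.

Lemma separable_sequence : separable X -> exists e : nat -> X,
  forall x (r : R), 0 < r -> exists n, `|x - e n| < r.
Proof.
move=> [D /countable_injP[f finj] dD].
exists (fun n => xget 0 [set x | D x /\ f x = n]) => x r r0.
have [||y []] := dD (ball x r); [by exists x; exact: ballxx|exact: ball_open|].
rewrite -ball_normE /= => xy Dy; exists (f y).
case: xgetP => [z _ [Dz fz]|/(_ y)]; last by case.
by rewrite (finj z y (mem_set Dz) (mem_set Dy) fz).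
Qed.

Lemma continuous_measurable_borel (h : X -> R) : continuous h ->
  measurable_fun setT (h : borel X -> R).
Proof.
move=> ch; apply: (measurability _ (RGenOInfty.measurableE R)) => _ [_ [r ->] <-].
rewrite setTI; apply: sub_sigma_algebra; apply: (@open_comp _ _ h).
  by move=> x _; exact: ch.
exact: interval_open.
Qed.

Context {d} {Omega : measurableType d}.
Implicit Types (D : set Omega) (f : Omega -> X).

(** For separable [X] this amounts to Borel measurability, while only real-valued functions have to
    be handled and limits pass through directly. *)
Definition dist_measurable D f : Prop := forall y, measurable_fun D (fun w => `|f w - y|).

Lemma dist_measurableP D f : measurable D -> separable X ->
  dist_measurable D f -> measurable_fun D (f : Omega -> borel X).
Proof.
move=> mD /separable_sequence[e eP] fd.
apply: (@measurability _ _ _ (borel X) D f (@open X)) => // _ [U oU <-].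
have -> : D `&` f @^-1` U = \bigcup_(n : nat) \bigcup_(j in [set j : nat | ball (e n) j.+1%:R^-1 `<=` U])
    (D `&` [set w | `|f w - e n| < j.+1%:R^-1]).
  apply/seteqP; split => [w [Dw Ufw]|w [n _ [j jU] [Dw /= fe]]]; last first.
    by split => //; apply: jU; rewrite -ball_normE /= distrC.
  have [r /= r0 rU] : nbhs_ball (f w) U by apply/nbhs_ballP; exact: open_nbhs_nbhs.
  have [j jr] : exists j : nat, j.+1%:R^-1 < r / 2.
    have [j _ jP] := near_infty_natSinv_lt (PosNum (divr_gt0 r0 (ltr0n _ 2))).
    by exists j; apply: jP => /=.
  have [n ne] := eP (f w) (j.+1%:R^-1) (ltac:(by rewrite invr_gt0)).
  exists n => //; exists j => //= z.
  rewrite -ball_normE /= => ez; apply: rU; rewrite -ball_normE /=.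
  rewrite -(subrK (e n) (f w)) -addrA (le_lt_trans (ler_normD _ _))//.
  by rewrite [r]splitr ltrD// (lt_trans _ jr).
apply: bigcup_measurable => n _; apply: bigcup_measurable => j _.
exact: (measurable_fun_ltr (fd (e n)) (measurable_cst _)).
Qed.

Lemma measurable_dist D f : measurable_fun D (f : Omega -> borel X) -> dist_measurable D f.
Proof.
move=> mf y; have ch : continuous (fun x : X => `|x - y|).
  by move=> x; apply: cvg_norm; apply: cvgB => //; exact: cvg_cst.
exact: (measurableT_comp (continuous_measurable_borel ch) mf).
Qed.

Lemma dist_measurable_norm D f : dist_measurable D f -> measurable_fun D (fun w => `|f w|).
Proof. by move=> /(_ 0); apply: eq_measurable_fun => w _; rewrite subr0. Qed.

Lemma dist_measurable_cvg D (f : nat -> Omega -> X) (f0 : Omega -> X) :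
  (forall n, dist_measurable D (f n)) -> (forall w, D w -> (fun n => f n w) @ \oo --> f0 w) ->
  dist_measurable D f0.
Proof.
move=> mf fc y; apply: (measurable_fun_cvg (fun n => mf n y)) => w Dw.
by apply: cvg_norm; apply: cvgB; [exact: fc|exact: cvg_cst].
Qed.

(** A function measurable in [w] and continuous in the vector can be evaluated at a measurable [f]:
    replace [f] by countably-valued approximations from the dense sequence and pass to the limit. *)
Lemma caratheodory D (G : Omega -> X -> R) f : measurable D -> separable X ->
  (forall x, measurable_fun D (fun w => G w x)) -> (forall w, D w -> continuous (G w)) ->
  dist_measurable D f -> measurable_fun D (fun w => G w (f w)).
Proof.
move=> mD /separable_sequence[e eP] mG cG fd.
have eP' w (j : nat) : exists n, `|f w - e n| < j.+1%:R^-1 by apply: eP; rewrite invr_gt0.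
(* Choosing the least index makes the sets on which the approximation is constant measurable. *)
pose i j w := ex_minn (eP' w j).
have mi j n : measurable (D `&` [set w | i j w = n]).
  have -> : D `&` [set w | i j w = n] = (D `&` [set w | `|f w - e n| < j.+1%:R^-1]) `\`
     \bigcup_(m in [set m : nat | (m < n)%N]) (D `&` [set w | `|f w - e m| < j.+1%:R^-1]).
    apply/seteqP; split => [w [Dw /= <-]|w [[Dw /= wn] nex]].
      rewrite /i; case: ex_minnP => m wm minm; split => // -[p /= pm [_ wp]].
      by have := minm _ wp; rewrite leqNgt pm.
    split => //; rewrite /= /i; case: ex_minnP => m wm minm; apply/eqP.
    rewrite eqn_leq minm// leqNgt; apply/negP => mn; apply: nex.
    by exists m.
  apply: measurableD; first exact: (measurable_fun_ltr (fd (e n)) (measurable_cst _)).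
  by apply: bigcup_measurable => m _; exact: (measurable_fun_ltr (fd (e m)) (measurable_cst _)).
apply: (measurable_fun_cvg (h := fun j w => G w (e (i j w)))) => [j|w Dw].
  have DE : D = \bigcup_n (D `&` [set w | i j w = n]).
    by apply/seteqP; split => [w Dw|w [n _ []]//]; exists (i j w).
  rewrite DE; apply/measurable_fun_bigcup => // n.
  apply: (eq_measurable_fun (fun w => G w (e n))).
    by move=> w /set_mem[_ /= ->].
  exact: measurable_funS (mG (e n)).
apply: (continuous_cvg _ (cG w Dw (f w))).
apply/cvgrPdist_lt => r r0; near=> j.
have : `|f w - e (i j w)| < j.+1%:R^-1 by rewrite /i; case: ex_minnP.
move=> /lt_trans; apply; near: j; exact: near_infty_natSinv_lt (PosNum r0).
Unshelve. all: by end_near. Qed.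

Lemma dist_measurableZ D (r : Omega -> R) f : measurable D -> separable X ->
  measurable_fun D r -> dist_measurable D f -> dist_measurable D (fun w => r w *: f w).
Proof.
move=> mD sX mr fd y.
apply: (@caratheodory D (fun w z => `|r w *: z - y|)) => //.
  move=> x; have ch : continuous (fun s : R => `|s *: x - y|).
    by move=> s; apply: cvg_norm; apply: cvgB; [exact: cvgZr_tmp|exact: cvg_cst].
  exact: (measurableT_comp (continuous_measurable_fun ch) mr).
by move=> w Dw x; apply: cvg_norm; apply: cvgB; [exact: cvgZl_tmp|exact: cvg_cst].
Qed.

Lemma dist_measurable_blin D (Y : normedModType R) (A : Omega -> blin X Y) f :
  measurable D -> separable X ->
  (forall x y, measurable_fun D (fun w => `|A w x - y|)) -> dist_measurable D f ->
  forall y, measurable_fun D (fun w => `|A w (f w) - y|).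
Proof.
move=> mD sX mA fd y; apply: (@caratheodory D (fun w z => `|A w z - y|)) => //.
by move=> w Dw x; apply: cvg_norm; apply: cvgB; [exact: blin_continuous|exact: cvg_cst].
Qed.

(** The norm exceeds [r >= 0] exactly when some vector of the dense sequence is stretched by more
    than [r], a countable condition. Comparing with [r * |e n|] avoids dividing by a norm that may
    vanish. *)
Lemma measurable_opnorm D (Y : normedModType R) (A : Omega -> blin X Y) :
  measurable D -> separable X -> (forall x, measurable_fun D (fun w => `|A w x|)) ->
  measurable_fun D (fun w => `|A w|).
Proof.
move=> mD /separable_sequence[e eP] mA.
apply: (measurability _ (RGenOInfty.measurableE R)) => _ [_ [r ->] <-].
have [r0|r0] := ltP r 0.
  rewrite (_ : _ `&` _ = D)//; apply/seteqP; split => [w []//|w Dw]; split => //=.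
  by rewrite in_itv /= andbT (lt_le_trans r0).
have -> : D `&` (fun w => `|A w|) @^-1` `]r, +oo[%classic =
   D `&` \bigcup_n (D `&` [set w | r * `|e n| < `|A w (e n)|]).
  apply/seteqP; split => [w [Dw]|w [Dw [n _ [_ /= h]]]]; rewrite /= in_itv /= andbT; last first.
    split => //; rewrite ltNge; apply/negP => Ar; move: h; rewrite ltNge => /negP; apply.
    by rewrite (le_trans (ler_opnorm _ _))// ler_wpM2r.
  move=> rA; split => //; apply: contrapT => nex; move: rA; rewrite ltNge => /negP; apply.
  apply: opnorm_le => x x1; apply: (@le_trans _ _ (r * `|x|)); last by rewrite ler_piMr.
  apply/ler_addgt0Pr => s s0.
  have K0 : 0 < `|A w| + r + 1 by rewrite ltr_wpDl// addr_ge0.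
  have [n xn] := eP x (s / (`|A w| + r + 1)) (divr_gt0 s0 K0).
  have hn : `|A w (e n)| <= r * `|e n|.
    by rewrite leNgt; apply/negP => h; apply: nex; exists n.
  have e1 : `|A w x| <= `|A w (e n)| + `|A w| * `|x - e n|.
    rewrite -{1}(subrK (e n) x) raddfD /= addrC (le_trans (ler_normD _ _))//.
    by rewrite lerD2l ler_opnorm.
  have e2 : r * `|e n| <= r * `|x| + r * `|x - e n|.
    rewrite -mulrDr ler_wpM2l// -{1}(subKr x (e n)).
    exact: ler_normB.
  move: xn; rewrite ltr_pdivlMr// => xn.
  have := normr_ge0 (x - e n); lra.
apply: measurableI => //; apply: bigcup_measurable => n _.
have mc : measurable_fun D (fun=> r * `|e n|) by exact: measurable_cst.
exact: (measurable_fun_ltr mc (mA (e n))).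
Qed.

End separable_measurability.

(** Required on every full subset of [G], since the invariant set of the theorem is only fixed after
    the growth rates are known. *)
Definition regular_splitting (R : realType) (X : completeNormedModType R) d
    (Omega : measurableType d)
    (mu : probability Omega R) (G : set Omega) (reg : regularity X Omega)
    (v : Omega -> X) (eta : Omega -> blin X R^o) : Prop :=
  forall A, full mu A -> A `<=` G ->
    [/\ reg_vec reg A v, reg_dual reg A eta, reg_op reg A (fun w => rank_one (eta w) (v w)) &
      reg_op reg A (fun w => co_rank_one (eta w) (v w))].

(** * Regularity of the splitting for strongly measurable systems *)

Section measurable_case.
Context {R : realType} {X : completeNormedModType R} {d} {Omega : measurableType d}.
Variables (mu : probability Omega R) (sigma tau : Omega -> Omega) (L : Omega -> blin X X).
Hypotheses (sigmaK : cancel sigma tau).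
Hypotheses (msigma : measurable_fun setT sigma) (mtau : measurable_fun setT tau).
Hypotheses (sX : separable X) (mL : strongly_measurable setT L).
Variables (C : set X) (GP : set Omega) (k : nat) (q : R).
Hypotheses (niceC : nice_cone C) (LC : forall w, [set L w x | x in C] `<=` C).
Hypotheses (k0 : (0 < k)%N) (q1 : 1 < q).
Variables (g : X) (c0 : R) (v : Omega -> X) (eta : Omega -> blin X R^o).
Hypothesis sp : splitting sigma tau L C GP k q g c0 v eta.

Local Notation coc := (cocycle sigma L).
Local Notation good := (good sigma tau GP).
Hypothesis mgood : measurable good.

Lemma measurable_inv_pos D (r : Omega -> R) : (forall w, D w -> 0 < r w) ->
  measurable_fun D r -> measurable_fun D (fun w => (r w)^-1).
Proof.
move=> r0 mr; apply: (eq_measurable_fun (fun w => expR (- ln (r w)))).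
  by move=> w /set_mem Dw; rewrite -lnV ?posrE ?r0// lnK// posrE invr_gt0 r0.
apply: (measurableT_comp (f := fun x : R => expR (- x))).
  apply: continuous_measurable_fun => x; apply: (@continuous_comp _ _ _ (fun x : R => - x) expR).
    by apply: cvgN.
  exact: continuous_expR.
exact: measurableT_comp (@measurable_ln R) mr.
Qed.

Lemma cocycle_dist_measurable n x : dist_measurable setT (fun w => coc n w x).
Proof.
elim: n => [|n IH]; first by move=> y; apply: (eq_measurable_fun (cst `|x - y|)).
apply: (dist_measurable_blin (A := fun w => L (iter n sigma w)) measurableT sX _ IH) => z y.
apply: (measurableT_comp (f := fun w => `|L w z - y|)); last exact: measurable_iter.
exact: (measurable_dist (mL z)).
Qed.

Lemma vec_dist_measurable : dist_measurable good v.
Proof.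
apply: (dist_measurable_cvg (f := fun n w => normalize (coc n (iter n tau w) g))); last first.
  by move=> w gw; exact: (vec_cvg k0 q1 sp gw).
move=> n; have mc : dist_measurable setT (fun w => coc n (iter n tau w) g).
  move=> y; apply: (measurableT_comp (f := fun w => `|coc n w g - y|)); last exact: measurable_iter.
  exact: cocycle_dist_measurable.
move=> y; apply: measurable_funTS; move: y.
apply: dist_measurableZ => //; apply: measurable_inv_pos; last exact: dist_measurable_norm.
move=> w _; rewrite normr_gt0; apply: (cone_neq0 niceC).
by apply: cocycle_in_cone => //; exact: split_seed sp.
Qed.

Lemma dist_measurable_sub (D D' : set Omega) (f : Omega -> X) : measurable D' -> D `<=` D' ->
  dist_measurable D' f -> dist_measurable D f.
Proof. by move=> mD' DD' mf y; exact: measurable_funS (mf y). Qed.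

Lemma coc_vec_measurable n : measurable_fun good (fun w => `|coc n w (v w)|).
Proof.
apply: dist_measurable_norm.
apply: (dist_measurable_blin (A := fun w => coc n w) mgood sX _ vec_dist_measurable) => x y.
by apply: measurable_funTS; exact: cocycle_dist_measurable.
Qed.

Lemma phi_measurable : measurable_fun good (fun w => `|L w (v w)|).
Proof. exact: (coc_vec_measurable 1). Qed.

(** For cone vectors [eta] is a pointwise limit of norm ratios; any other vector is a difference of
    two cone vectors that do not depend on [w]. *)
Lemma eta_measurable x : measurable_fun good (fun w => eta w x : R).
Proof.
have cone_meas y : (C `|` [set 0]) y -> measurable_fun good (fun w => eta w y : R).
  move=> Ky; apply: (measurable_fun_cvg (h := fun n w => `|coc n w y| / `|coc n w (v w)|)).
    move=> n; apply: measurable_funM.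
      apply: measurable_funTS; apply: dist_measurable_norm; exact: cocycle_dist_measurable.
    apply: measurable_inv_pos; last exact: coc_vec_measurable.
    by move=> w gw; rewrite normr_gt0; apply: (cone_neq0 niceC); apply: cocycle_in_cone => //; exact: split_cone sp _ gw.
  move=> w gw; rewrite -(ger0_norm (split_eta_ge0 sp gw Ky)).
  exact: (eta_ratio_cvg sigmaK niceC LC k0 q1 sp gw).
have [y Cy [z Cz <-]] : [set x - y | x in C & y in C] x by rewrite (nice_generating niceC).
have -> : (fun w => eta w (y - z) : R) = (fun w => eta w y - eta w z).
  by apply/funext => w; rewrite raddfB.
by apply: measurable_funB; apply: cone_meas; left.
Qed.

Lemma rank_one_dist_measurable x : dist_measurable good (fun w => rank_one (eta w) (v w) x).
Proof.
have -> : (fun w => rank_one (eta w) (v w) x) = (fun w => eta w x *: v w).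
  by apply/funext => w; rewrite rank_oneE.
by apply: dist_measurableZ => //; [exact: eta_measurable|exact: vec_dist_measurable].
Qed.

Lemma co_rank_one_dist_measurable x : dist_measurable good (fun w => co_rank_one (eta w) (v w) x).
Proof.
move=> y; apply: (eq_measurable_fun (fun w => `|rank_one (eta w) (v w) x - (x - y)|)).
  move=> w _; rewrite co_rank_oneE rank_oneE distrC; congr (`|_|).
  by rewrite addrAC.
exact: rank_one_dist_measurable.
Qed.

Lemma coc_ker_measurable n :
  measurable_fun good (fun w => `|blin_comp (coc n w) (co_rank_one (eta w) (v w))|).
Proof.
apply: measurable_opnorm => // x; apply: dist_measurable_norm.
apply: (dist_measurable_blin (A := fun w => coc n w) mgood sX _ (co_rank_one_dist_measurable x)) => z y.
by apply: measurable_funTS; exact: cocycle_dist_measurable.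
Qed.

Lemma measurable_regular_splitting :
  regular_splitting mu good (measurable_regularity X Omega) v eta.
Proof.
move=> A [mA _] Ag; split=> /=.
- apply: dist_measurableP => //; exact: dist_measurable_sub vec_dist_measurable.
- by move=> x; apply: measurable_funS (eta_measurable x).
- move=> x; apply: dist_measurableP => //.
  exact: dist_measurable_sub (rank_one_dist_measurable x).
- move=> x; apply: dist_measurableP => //.
  exact: dist_measurable_sub (co_rank_one_dist_measurable x).
Qed.

End measurable_case.

(** * Continuity on large compact sets *)

Section borel_regularity.
Context {R : realType} {T : ptopologicalType} (mu : probability (borel T) R).
Hypothesis polishT : borel_in_polish R T.
Implicit Types A B F U K : set T.

Local Notation msbl A := (measurable (A : set (borel T))).

Lemma open_borel U : open U -> msbl U.
Proof. by move=> oU; exact: sub_sigma_algebra. Qed.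

Lemma closed_borel F : closed F -> msbl F.
Proof. by move=> cF; rewrite -[F]setCK; apply: measurableC; apply: open_borel; exact: closed_openC. Qed.

Lemma measure_le A B : msbl A -> msbl B -> A `<=` B -> (mu A <= mu B)%E.
Proof. by move=> mA mB AB; exact: (le_measure mu (mem_set mA) (mem_set mB) AB). Qed.

Lemma measureU_le A B (a b : \bar R) : msbl A -> msbl B -> (mu A <= a)%E -> (mu B <= b)%E ->
  (mu (A `|` B) <= a + b)%E.
Proof. by move=> mA mB ha hb; apply: le_trans (measureU2 mu mA mB) (leeD ha hb). Qed.

Lemma measureU_null A B (a : \bar R) : msbl A -> msbl B -> (mu A <= a)%E -> mu B = 0%E ->
  (mu (A `|` B) <= a)%E.
Proof.
by move=> mA mB ha hb; rewrite -[a]adde0; apply: measureU_le => //; rewrite hb lexx.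
Qed.

Lemma polish_hausdorff : hausdorff_space T.
Proof.
have [P [h [[hP _] hinj oE _]]] := polishT.
move=> x y cxy; apply: hinj; apply: hP => A B nA nB.
have oh (U : set P) : open U -> open (h @^-1` U) by move=> oU; rewrite oE; exists U.
have [z [zA zB]] := cxy _ _
  (open_nbhs_nbhs (conj (oh _ (open_interior A)) nA))
  (open_nbhs_nbhs (conj (oh _ (open_interior B)) nB)).
by exists (h z); split; exact: interior_subset.
Qed.

(** The metric of the Polish space provides shrinking neighbourhoods of a closed set, which are
    pulled back through the embedding. *)
Lemma closed_Gdelta F : closed F -> exists O : nat -> set T,
  [/\ forall n, open (O n), forall n m, (n <= m)%N -> O m `<=` O n & F = \bigcap_n O n].
Proof.
have [P [h [_ _ oE _]]] := polishT.
have oh V : open V -> open (h @^-1` V) by move=> oV; rewrite oE; exists V.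
move=> /closed_openC oF.
have [U oU UF] : [set h @^-1` U | U in @open P] (~` F) by rewrite -oE.
exists (fun n => h @^-1` (\bigcup_(z in ~` U) (ball z (n.+1%:R^-1 : R))°)); split.
- by move=> n; apply: oh; apply: bigcup_open => z _; exact: open_interior.
- move=> n m nm w [z zU zw]; exists z => //.
  apply: interiorS zw; apply: le_ball.
  by rewrite lef_pV2 ?posrE ?ltr0n// ler_nat.
rewrite -[F]setCK -UF; apply/seteqP; split => w /= Uw.
  move=> n _; exists (h w) => //.
  by apply: (nbhsx_ballx (h w) _ (_ : 0 < n.+1%:R^-1)); rewrite invr_gt0.
move=> Uhw; have /nbhs_ballP[e /= e0 eU] : nbhs (h w) U by exact: open_nbhs_nbhs.
have [n _ nP] := near_infty_natSinv_lt (PosNum e0).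
have [z zU zw] := Uw n I; apply: zU; apply: eU.
apply: ball_sym; apply: (le_ball (ltW (nP n (leqnn n)))).
exact: interior_subset zw.
Qed.

Lemma measure_setD_cvg0 (A : nat -> set T) : (forall n, msbl (A n)) ->
  (forall n m, (n <= m)%N -> A n `<=` A m) ->
  forall e : R, 0 < e -> exists n, (mu ((\bigcup_n A n) `\` A n) <= e%:E)%E.
Proof.
move=> mA ndA e e0; apply: contrapT => /forallNP h.
have mU : msbl (\bigcup_n A n) by exact: bigcup_measurable.
pose B n : set (borel T) := (\bigcup_n A n) `\` A n.
have mB n : measurable (B n) by exact: measurableD.
have B0 : \bigcap_n B n = set0.
  by apply/seteqP; split => // w Bw; have [[n _ Anw] _] := Bw 0%N I; have [_] := Bw n I.
have cv : (mu \o B) @ \oo --> mu (\bigcap_n B n).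
  apply: nonincreasing_cvg_mu => //.
  - by rewrite (le_lt_trans (probability_le1 mu (mB 0%N)))// ltry.
  - by rewrite B0.
  - by move=> n m nm; apply/subsetPset => w [Uw nAw]; split => // Anw; apply: nAw; exact: ndA Anw.
have : (e%:E <= limn (mu \o B))%E.
  apply: lime_ge; first by apply/cvg_ex; eexists; exact: cv.
  by apply: nearW => n; rewrite ltW// ltNge; apply/negP; exact: h.
by rewrite (cvg_lim _ cv)// B0 measure0 lee_fin leNgt e0.
Qed.

Lemma measure_bigcup_le (A : nat -> set T) (e : R) : 0 <= e -> (forall n, msbl (A n)) ->
  (forall n, (mu (A n) <= (e / (2 ^ n.+1)%:R)%:E)%E) -> (mu (\bigcup_n A n) <= e%:E)%E.
Proof.
move=> e0 mA Ae; apply: le_trans (epsilon_trick0 xpredT e0).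
apply: (le_trans (measure_sigma_subadditive mu mA (bigcup_measurable (fun n _ => mA n)) (fun _ h => h))).
by apply: lee_nneseries => n _ //; exact: Ae.
Qed.

(** Approximation from both sides is symmetric under complements, so that the regular sets form a
    sigma-algebra. *)
Definition closed_open_regular A : Prop := forall e : R, 0 < e -> exists F U,
  [/\ closed F, open U, F `<=` A, A `<=` U & (mu (U `\` F) <= e%:E)%E].

Lemma open_regular U : open U -> closed_open_regular U.
Proof.
move=> oU e e0; have [V [oV Vnd CU]] := closed_Gdelta (open_closedC oU).
have UE : U = \bigcup_n ~` V n by rewrite -setC_bigcap -CU setCK.
have [||n nP] := measure_setD_cvg0 (A := fun n => ~` V n) _ _ e0.
- by move=> n; apply: closed_borel; exact: open_closedC.
- by move=> n m nm; apply: subsetC; exact: Vnd.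
exists (~` V n), U; split => //; first exact: open_closedC.
  by move=> w nVw; rewrite UE; exists n.
by rewrite [in X in mu X]UE.
Qed.

Lemma regular_setC A : closed_open_regular A -> closed_open_regular (~` A).
Proof.
move=> rA e e0; have [F [U [cF oU FA AU h]]] := rA e e0.
exists (~` U), (~` F); split.
- exact: open_closedC.
- exact: closed_openC.
- exact: subsetC.
- exact: subsetC.
- by rewrite setDE setCK setIC -setDE.
Qed.

(** Only finite unions of the closed sets are kept, since an infinite one need not be closed: half
    of [e] pays for the truncation and the other half for the approximations. *)
Lemma regular_bigcup (A : nat -> set T) : (forall n, closed_open_regular (A n)) ->
  closed_open_regular (\bigcup_n A n).
Proof.
move=> rA e e0; have e20 : 0 < e / 2 by rewrite divr_gt0.
have e2n n : 0 < e / 2 / (2 ^ n.+1)%:R by rewrite divr_gt0// ltr0n expn_gt0.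
have h n := rA n _ (e2n n).
have /choice[F h1] := h; have /choice[U h2] := h1.
have cF n : closed (F n) by have [] := h2 n.
have oU n : open (U n) by have [] := h2 n.
pose G n := \big[setU/set0]_(i < n) F i.
have cG n : closed (G n) by apply: closed_bigsetU => i _; exact: cF.
have [||n nP] := measure_setD_cvg0 (A := G) _ _ e20.
- by move=> n; exact: closed_borel.
- by move=> n m nm; exact: subset_bigsetU.
have GE : \bigcup_n G n = \bigcup_n F n.
  apply/seteqP; split => w [m _].
    by move=> Gm; have [i _ Fi] := @bigsetU_bigcup _ F m _ Gm; exists i.
  by move=> Fm; exists m.+1 => //; exact: (@bigsetU_sup _ m m.+1 F (ltnSn m)).
exists (G n), (\bigcup_n U n); split => //.
- by apply: bigcup_open => i _.
- move=> w Gw; have : (\bigcup_n F n) w by rewrite -GE; exists n.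
  by move=> [i _ Fi]; exists i => //; have [_ _ FA _ _] := h2 i; exact: FA.
- by move=> w [i _ Ai]; exists i => //; have [_ _ _ AU _] := h2 i; exact: AU.
have mUF i : msbl (U i `\` F i).
  by apply: measurableD; [exact: open_borel|exact: closed_borel].
have sub : (\bigcup_n U n) `\` G n `<=` (\bigcup_n (U n `\` F n)) `|` ((\bigcup_n G n) `\` G n).
  move=> w [[i _ Ui] nG]; have [Fw|nF] := pselect ((\bigcup_n F n) w).
    by right; split => //; rewrite GE.
  by left; exists i => //; split => // Fi; apply: nF; exists i.
have mU : msbl (\bigcup_n U n) by apply: open_borel; apply: bigcup_open => i _.
have mG i : msbl (G i) by exact: closed_borel.
have mUG : msbl (\bigcup_n G n) by exact: bigcup_measurable.
have mUUF : msbl (\bigcup_n (U n `\` F n)) by exact: bigcup_measurable.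
apply: le_trans (measure_le _ _ sub) _.
- exact: measurableD.
- by apply: measurableU => //; exact: measurableD.
rewrite [e]splitr EFinD; apply: measureU_le => //; first exact: measurableD.
by apply: measure_bigcup_le => // [|i]; [exact: ltW|have [] := h2 i].
Qed.

Lemma borel_regular A : msbl A -> closed_open_regular A.
Proof.
apply: smallest_sub; last by move=> U; exact: open_regular.
split.
- by apply: open_regular; exact: open0.
- by move=> B; rewrite setTD; exact: regular_setC.
- exact: regular_bigcup.
Qed.

Hypothesis sigma_compact : exists K : nat -> set T,
  [/\ forall n, compact (K n), forall n, K n `<=` K n.+1 & mu (\bigcup_n K n) = 1%E].

Lemma compact_borel K : compact K -> msbl K.
Proof. by move=> cK; apply: closed_borel; apply: compact_closed => //; exact: polish_hausdorff. Qed.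

Lemma measure_bigcupC1 (K : nat -> set T) : (forall n, msbl (K n)) ->
  mu (\bigcup_n K n) = 1%E -> mu (~` \bigcup_n K n) = 0%E.
Proof.
move=> mK K1; have mU : msbl (\bigcup_n K n) by exact: bigcup_measurable.
by have := probability_setC mu mU; rewrite K1 subee.
Qed.

Lemma compact_inner_regular A (e : R) : msbl A -> 0 < e ->
  exists K, [/\ compact K, K `<=` A & (mu (A `\` K) <= e%:E)%E].
Proof.
move=> mA e0; have e20 : 0 < e / 2 by rewrite divr_gt0.
have [F [U [cF oU FA AU UFe]]] := borel_regular mA e20.
have [K [cK Knd K1]] := sigma_compact.
have mK n : msbl (K n) by exact: compact_borel.
have [||n nP] := measure_setD_cvg0 (A := K) _ _ e20 => //.
  by move=> n m /subnK <-; elim: (m - n)%N => //= i IH w /IH; exact: Knd.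
have mF := closed_borel cF; have mU := open_borel oU.
have mUK : msbl (\bigcup_n K n) by exact: bigcup_measurable.
exists (F `&` K n); split.
- by rewrite setIC; exact: compact_closedI.
- by move=> w [/FA].
have sub : A `\` (F `&` K n) `<=` (U `\` F) `|` (((\bigcup_n K n) `\` K n) `|` ~` (\bigcup_n K n)).
  move=> w [Aw nFK]; have [Fw|nF] := pselect (F w); last by left; split => //; exact: AU.
  right; have [Uw|nU] := pselect ((\bigcup_n K n) w); last by right.
  by left; split => // Kw; apply: nFK.
have m1 := measurableD mU mF; have m2 := measurableD mUK (mK n); have m3 := measurableC mUK.
apply: le_trans (measure_le _ _ sub) _.
- by apply: measurableD => //; exact: measurableI.
- by apply: measurableU => //; exact: measurableU.
rewrite [e]splitr EFinD; apply: measureU_le => //; first exact: measurableU.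
by apply: measureU_null => //; exact: measure_bigcupC1.
Qed.

(** The property is a parameter so that countably many hereditary ones can be imposed on a single
    compact set. *)
Definition lusin (P : set T -> Prop) : Prop := forall e : R, 0 < e ->
  exists K, [/\ compact K, (mu (~` K) <= e%:E)%E & P K].

Definition hereditary (P : set T -> Prop) : Prop := forall K K', K' `<=` K -> P K -> P K'.

Lemma lusin_sub (P Q : set T -> Prop) : (forall K, compact K -> P K -> Q K) -> lusin P -> lusin Q.
Proof.
by move=> PQ lP e e0; have [K [cK Ke PK]] := lP e e0; exists K; split => //; exact: PQ.
Qed.

Lemma lusin_bigcap (P : nat -> set T -> Prop) : (forall i, hereditary (P i)) ->
  (forall i, lusin (P i)) -> lusin (fun K => forall i, P i K).
Proof.
move=> hP lP e e0.
have e2n n : 0 < e / (2 ^ n.+1)%:R by rewrite divr_gt0// ltr0n expn_gt0.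
have /choice[K KP] : forall i, exists K, [/\ compact K, (mu (~` K) <= (e / (2 ^ i.+1)%:R)%:E)%E & P i K].
  by move=> i; exact: lP.
have cK i : compact (K i) by have [] := KP i.
have clK i : closed (K i) by apply: compact_closed => //; exact: polish_hausdorff.
exists (\bigcap_i K i); split.
- rewrite (_ : \bigcap_i K i = K 0%N `&` \bigcap_i K i).
    by apply: compact_closedI => //; apply: closed_bigI => i _.
  by apply/seteqP; split => [w h|w []//]; split => //; exact: h.
- rewrite setC_bigcap; apply: measure_bigcup_le => [|n|n]; first exact: ltW.
    by apply: measurableC; exact: compact_borel.
  by have [] := KP n.
- by move=> i; have [_ _] := KP i; apply: hP => w; apply.
Qed.

Lemma lusinI (P Q : set T -> Prop) : hereditary P -> hereditary Q -> lusin P -> lusin Q ->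
  lusin (fun K => P K /\ Q K).
Proof.
move=> hP hQ lP lQ; pose S (i : nat) := if i == 0%N then P else Q.
have : lusin (fun K => forall i, S i K).
  by apply: lusin_bigcap => i; rewrite /S; case: eqP.
by apply: lusin_sub => K _ h; split; [exact: (h 0%N)|exact: (h 1%N)].
Qed.

Lemma lusin_subset A : full mu A -> lusin (fun K => K `<=` A).
Proof.
move=> /fullP[mA nA] e e0; have [K [cK KA Ke]] := compact_inner_regular mA e0.
exists K; split => //.
have mK := compact_borel cK.
have /negligibleP nA0 := nA; have {}nA0 := nA0 (measurableC mA).
have -> : ~` K = (A `\` K) `|` ~` A.
  apply/seteqP; split => w /=; last by move=> [[]//|nAw Kw]; apply: nAw; exact: KA.
  by move=> nK; have [Aw|] := pselect (A w); [left|right].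
by apply: measureU_null => //; [exact: measurableD|exact: measurableC].
Qed.

(** An index that exists at almost every point can be chosen uniformly on a large compact set; for
    visit counts this makes convergence uniform. *)
Lemma lusin_increasing A (B : nat -> set T) : full mu A -> (forall n, msbl (B n)) ->
  (forall n m, (n <= m)%N -> B n `<=` B m) -> A `<=` \bigcup_n B n ->
  lusin (fun K => exists n, K `<=` B n).
Proof.
move=> fA mB Bnd AB e e0; have e20 : 0 < e / 2 by rewrite divr_gt0.
have [//|n nP] := measure_setD_cvg0 mB _ e20.
have [K [cK KB Ke]] := compact_inner_regular (mB n) e20.
have mU : msbl (\bigcup_n B n) by exact: bigcup_measurable.
have /fullP[_ /negligibleP nU] := full_sub mU AB fA; have {}nU := nU (measurableC mU).
exists K; split => //; last by exists n.
have sub : ~` K `<=` (B n `\` K) `|` (((\bigcup_n B n) `\` B n) `|` ~` (\bigcup_n B n)).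
  move=> w nK; have [Bw|nB] := pselect (B n w); first by left.
  by right; have [Uw|] := pselect ((\bigcup_n B n) w); [left|right].
have mK := compact_borel cK.
have m1 := measurableD (mB n) mK; have m2 := measurableD mU (mB n); have m3 := measurableC mU.
apply: le_trans (measure_le _ _ sub) _.
- exact: measurableC.
- by apply: measurableU => //; exact: measurableU.
rewrite [e]splitr EFinD; apply: measureU_le => //; first exact: measurableU.
exact: measureU_null.
Qed.

Lemma lusin_preimage (s s' : T -> T) (P Q : set T -> Prop) : continuous s -> continuous s' ->
  cancel s s' -> cancel s' s -> (forall A, msbl A -> mu (s @^-1` A) = mu A) ->
  (forall K, compact K -> P K -> Q (s @^-1` K)) -> lusin P -> lusin Q.
Proof.
move=> cs cs' sK s'K pres PQ lP e e0; have [K [cK Ke PK]] := lP e e0.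
have sE : s @^-1` K = s' @` K.
  apply/seteqP; split => [w /= sw|w /= [z Kz <-]]; last by rewrite s'K.
  by exists (s w).
exists (s @^-1` K); split; last exact: PQ.
  rewrite sE; apply: continuous_compact => //.
  by apply: continuous_subspaceT.
rewrite preimage_setC pres//; apply: measurableC; exact: compact_borel.
Qed.

Section continuity.
Context {Y : topologicalType}.
Implicit Types f : T -> Y.

Definition continuous_within K f := forall w, K w -> f z @[z --> within K (nbhs w)] --> f w.

Lemma continuous_withinP K f : {within K, continuous f} <-> continuous_within K f.
Proof. exact: subspace_continuousP. Qed.

Lemma hereditary_continuous f : hereditary (fun K => continuous_within K f).
Proof.
move=> K K' K'K cf w K'w A nA.
have h : nbhs w (fun z => K z -> A (f z)) := cf w (K'K w K'w) A nA.
suff : nbhs w (fun z => K' z -> A (f z)) by [].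
by apply: filterS h => z h /K'K.
Qed.

Lemma mu_continuous_lusin D f : mu_continuous mu D f -> lusin (fun K => continuous_within K f).
Proof.
move=> [K [cK _ Knd K1 cf]] e e0.
have mK n : msbl (K n) by exact: compact_borel.
have [||n nP] := measure_setD_cvg0 (A := K) _ _ e0 => //.
  by move=> n m /subnK <-; elim: (m - n)%N => //= i IH w /IH; exact: Knd.
exists (K n); split => //; last by apply/continuous_withinP.
have mU : msbl (\bigcup_n K n) by exact: bigcup_measurable.
have -> : ~` K n = ((\bigcup_n K n) `\` K n) `|` ~` (\bigcup_n K n).
  apply/seteqP; split => w /=; last by move=> [[]//|nU Kw]; apply: nU; exists n.
  by move=> nK; have [Uw|] := pselect ((\bigcup_n K n) w); [left|right].
by apply: measureU_null => //; [exact: measurableD|exact: measurableC|exact: measure_bigcupC1].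
Qed.

(** Finite unions of compact sets with errors tending to 0 form the increasing sequence; continuity
    passes to these unions because the pieces are closed. *)
Lemma lusin_mu_continuous D f : lusin (fun K => K `<=` D /\ continuous_within K f) ->
  mu_continuous mu D f.
Proof.
move=> lf.
have /choice[K KP] : forall n : nat, exists K, [/\ compact K, (mu (~` K) <= (n.+1%:R^-1)%:E)%E &
    K `<=` D /\ continuous_within K f] by move=> n; apply: lf; rewrite invr_gt0.
pose G n := \big[setU/set0]_(i < n) K i.
have cK n : compact (K n) by have [] := KP n.
have cG n : compact (G n) by apply: bigsetU_compact.
have clK n : closed (K n) by apply: compact_closed => //; exact: polish_hausdorff.
have clG n : closed (G n) by apply: compact_closed => //; exact: polish_hausdorff.
have mU : msbl (\bigcup_n G n) by apply: bigcup_measurable => n _; exact: compact_borel.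
exists G; split => //.
- by move=> n w Gw; have [i _] := @bigsetU_bigcup _ K n _ Gw; have [_ _ [KD _]] := KP i; exact: KD.
- by move=> n; apply: subset_bigsetU.
- suff h : mu (~` \bigcup_n G n) = 0%E.
    by rewrite -[X in mu X]setCK probability_setC ?h ?sube0//; exact: measurableC.
  apply/eqP; rewrite eq_le measure_ge0 andbT; apply/lee_addgt0Pr => e e0; rewrite add0e.
  have [n _ nP] := near_infty_natSinv_lt (PosNum e0).
  have [_ Kn _] := KP n.
  apply: (@le_trans _ _ (mu (~` K n))).
    apply: measure_le; [exact: measurableC|by apply: measurableC; exact: compact_borel|].
    apply: subsetC => w Kw; exists n.+1 => //; exact: (@bigsetU_sup _ n n.+1 K (ltnSn n)).
  by rewrite (le_trans Kn)// lee_fin ltW//; apply: nP => /=.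
elim=> [|n IH].
  by apply/continuous_withinP => w; rewrite /G big_ord0.
have -> : G n.+1 = G n `|` K n by rewrite /G big_ord_recr.
apply: withinU_continuous => //.
by apply/continuous_withinP; have [_ _ []] := KP n.
Qed.

End continuity.

Lemma lusin_measurable (f : T -> R) : lusin (fun K => continuous_within K f) ->
  exists A, full mu A /\ measurable_fun (A : set (borel T)) (f : borel T -> R).
Proof.
move=> lf; have : mu_continuous mu setT f.
  by apply: lusin_mu_continuous; apply: lusin_sub lf.
move=> [K [cK _ Knd K1 cf]].
have mK n : msbl (K n) by exact: compact_borel.
exists (\bigcup_n K n); split; first by split => //; exact: bigcup_measurable.
apply/measurable_fun_bigcup => // n.
apply: (measurability _ (RGenOInfty.measurableE R)) => _ [_ [r ->] <-].
have /continuous_withinP cfn := cf n.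
(* By continuity within the compact set the superlevel set is relatively open, being cut out by the
   interior of the set where membership in [K n] implies [r < f w]. *)
have -> : K n `&` f @^-1` `]r, +oo[%classic = K n `&` [set w | K n w -> r < f w]°.
  apply/seteqP; split => w [Kw]; rewrite /= ?in_itv /= ?andbT => h; split => //.
    have := cfn w Kw; move=> /cvgr_gt /(_ r h); exact.
  exact: (interior_subset h).
by apply: measurableI => //; apply: open_borel; exact: open_interior.
Qed.

End borel_regularity.

(** Evaluation, composition and formation of rank-one operators are all bilinear with norm at most
    1. *)
Lemma bilinear_cvg {R : realType} {U V W : normedModType R} (B : U -> V -> W)
    {T : Type} (F : set_system T) {FF : Filter F} (u : T -> U) (v : T -> V) u0 v0 :
  (forall a b y, B (a - b) y = B a y - B b y) ->
  (forall a x y, B a (x - y) = B a x - B a y) ->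
  (forall a y, `|B a y| <= `|a| * `|y|) ->
  u @ F --> u0 -> v @ F --> v0 -> B (u z) (v z) @[z --> F] --> B u0 v0.
Proof.
move=> Bl Br Bn cu cv.
have h : `|u0 - u z| * `|v z| + `|u0| * `|v0 - v z| @[z --> F] --> (0 : R).
  suff : `|u0 - u z| * `|v z| + `|u0| * `|v0 - v z| @[z --> F] -->
      `|u0 - u0| * `|v0| + `|u0| * `|v0 - v0| by rewrite !subrr !normr0 mul0r mulr0 addr0.
  apply: cvgD; apply: cvgM; [|exact: cvg_norm|exact: cvg_cst|];
    by apply: cvg_norm; apply: cvgB => //; exact: cvg_cst.
apply/cvgrPdist_lt => e e0; move/cvgrPdist_lt: h => /(_ e e0).
apply: filterS => z; rewrite sub0r normrN => he.
have -> : B u0 v0 - B (u z) (v z) = B (u0 - u z) (v z) + B u0 (v0 - v z).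
  by rewrite Bl Br [RHS]addrC subrKA.
apply: le_lt_trans he; apply: le_trans (ler_norm _).
by apply: (le_trans (ler_normD _ _)); apply: lerD; exact: Bn.
Qed.

Section blin_cvg.
Context {R : realType} {X Y Z : normedModType R} {T : Type} (F : set_system T) {FF : Filter F}.

Lemma blin_app_cvg (A : T -> blin X Y) (x : T -> X) (A0 : blin X Y) (x0 : X) :
  A @ F --> A0 -> x @ F --> x0 -> A z (x z) @[z --> F] --> A0 x0.
Proof.
apply: (bilinear_cvg (B := fun (a : blin X Y) y => a y)) => //.
- by move=> a y z; rewrite raddfB.
- by move=> a y; exact: ler_opnorm.
Qed.

Lemma blin_comp_cvg (A : T -> blin Y Z) (B : T -> blin X Y)
    (A0 : blin Y Z) (B0 : blin X Y) :
  A @ F --> A0 -> B @ F --> B0 -> blin_comp (A z) (B z) @[z --> F] --> blin_comp A0 B0.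
Proof.
apply: (bilinear_cvg (B := fun a b => blin_comp a b)).
- by move=> a b y; exact/val_inj.
- by move=> a x y; apply/val_inj/funext => z /=; rewrite -[RHS]/(a (x z) - a (y z)) -raddfB.
- move=> a b; apply: opnorm_le => x x1 /=; apply: (le_trans (ler_opnorm _ _)).
  rewrite ler_wpM2l ?opnorm_ge0//; apply: (le_trans (ler_opnorm _ _)).
  by rewrite ler_piMr// opnorm_ge0.
Qed.

Lemma rank_one_cvg (f : T -> blin X R^o) (v : T -> X) (f0 : blin X R^o) (v0 : X) :
  f @ F --> f0 -> v @ F --> v0 -> rank_one (f z) (v z) @[z --> F] --> rank_one f0 v0.
Proof.
apply: (bilinear_cvg (B := fun a b => rank_one a b)).
- move=> a b y; apply/val_inj/funext => z; rewrite -[RHS]/(rank_one a y z - rank_one b y z).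
  by rewrite -[LHS]/(rank_one (a - b) y z) !rank_oneE -scalerBl.
- move=> a x y; apply/val_inj/funext => z; rewrite -[RHS]/(rank_one a x z - rank_one a y z).
  by rewrite -[LHS]/(rank_one a (x - y) z) !rank_oneE -scalerBr.
- move=> a b; apply: opnorm_le => x x1; rewrite rank_oneE normrZ mulrC [leRHS]mulrC.
  rewrite ler_wpM2l//; apply: (le_trans (ler_opnorm _ _)).
  by rewrite ler_piMr// opnorm_ge0.
Qed.

Lemma co_rank_one_cvg (f : T -> blin X R^o) (v : T -> X) (f0 : blin X R^o) (v0 : X) :
  f @ F --> f0 -> v @ F --> v0 -> co_rank_one (f z) (v z) @[z --> F] --> co_rank_one f0 v0.
Proof. by move=> cf cv; apply: cvgB; [exact: cvg_cst|exact: rank_one_cvg]. Qed.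

End blin_cvg.

(** * Regularity of the splitting for mu-continuous systems *)

Section mu_continuous_case.
Context {R : realType} {X : completeNormedModType R} {T : ptopologicalType}.
Variables (mu : probability (borel T) R) (sigma tau : T -> T) (L : T -> blin X X).
Hypothesis polishT : borel_in_polish R T.
Hypotheses (csigma : continuous sigma) (ctau : continuous tau).
Hypotheses (sigmaK : cancel sigma tau) (tauK : cancel tau sigma).
Hypothesis msigma : measurable_fun setT (sigma : borel T -> borel T).
Hypothesis mtau : measurable_fun setT (tau : borel T -> borel T).
Hypothesis pres : forall A : set (borel T), measurable A -> mu (sigma @^-1` A) = mu A.
Hypothesis muL : mu_continuous mu setT L.
Variables (C : set X) (GP : set T) (k : nat) (q : R).
Hypotheses (niceC : nice_cone C) (LC : forall w, [set L w x | x in C] `<=` C).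
Hypothesis mGP : measurable (GP : set (borel T)).
Hypotheses (k0 : (0 < k)%N) (q1 : 1 < q).
Variables (g : X) (c0 : R) (v : T -> X) (eta : T -> blin X R^o).
Hypothesis sp : splitting sigma tau L C GP k q g c0 v eta.

Local Notation coc := (cocycle sigma L).
Local Notation good := (good sigma tau GP).
Local Notation t := (hopf_rate q).
Hypothesis good1 : full mu (good : set (borel T)).

(* On a tame set the approximations of [v] and [eta] are continuous and
   converge locally uniformly. *)
Definition tame K : Prop :=
  [/\ K `<=` good, forall n, continuous_within K (fun w => L (iter n sigma w)),
      forall n, continuous_within K (fun w => L (iter n tau w)),
      forall j, exists n, K `<=` [set w | (j <= visits GP sigma n w)%N] &
      forall j, exists n, K `<=` [set w | (j <= visits GP tau n (tau w))%N]].

(** The mu-continuity of [L] already carries compact sets exhausting almost all of the space. *)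
Let sigma_compact : exists K : nat -> set T,
  [/\ forall n, compact (K n), forall n, K n `<=` K n.+1 & mu (\bigcup_n K n) = 1%E].
Proof. by have [K [cK _ Knd K1 _]] := muL; exists K. Qed.

Lemma lusin_L_iter (s s' : T -> T) n : continuous s -> continuous s' ->
  cancel s s' -> cancel s' s ->
  (forall A, measurable (A : set (borel T)) -> mu (s @^-1` A) = mu A) ->
  lusin mu (fun K => continuous_within K (fun w => L (iter n s w))).
Proof.
move=> cs cs' sK s'K press; elim: n => [|n IH]; first exact: mu_continuous_lusin muL.
apply: (lusin_preimage polishT cs cs' sK s'K press _ IH) => K cK ctK w sKw A nA.
have h : nbhs (s w) (fun z => K z -> A (L (iter n s z))) by move: nA; rewrite iterSr; exact: ctK.
suff : nbhs w (fun z => K (s z) -> A (L (iter n.+1 s z))) by [].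
have h' : nbhs w (fun z => K (s z) -> A (L (iter n s (s z)))) := cs w _ h.
by apply: filterS h' => z; rewrite -iterSr.
Qed.

Lemma lusin_tame : lusin mu tame.
Proof.
have prest := preserving_inverse (Omega := borel T)
  (sigmaK : cancel (sigma : borel T -> borel T) tau) mtau pres.
have lgood := lusin_subset polishT sigma_compact good1.
have lf n := lusin_L_iter n csigma ctau sigmaK tauK pres.
have lb n := lusin_L_iter n ctau csigma tauK sigmaK prest.
have lvf j : lusin mu (fun K => exists n, K `<=` [set w | (j <= visits GP sigma n w)%N]).
  apply: (lusin_increasing polishT sigma_compact good1).
  - by move=> n; exact: measurable_visits_ge.
  - by move=> n m nm w /= h; apply: leq_trans h _; exact: visits_mono.
  - by move=> w [fw _]; have [n nP] := fw j; exists n.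
have lvb j : lusin mu (fun K => exists n, K `<=` [set w | (j <= visits GP tau n (tau w))%N]).
  apply: (lusin_increasing polishT sigma_compact good1).
  - move=> n; have mV := measurable_visits_ge (R := R) (Omega := borel T) mGP mtau j n.
    exact: (measurable_preimage (A := [set w | (j <= visits GP tau n w)%N]) mtau mV).
  - by move=> n m nm w /= h; apply: leq_trans h _; exact: visits_mono.
  - by move=> w [_ bw]; have [n nP] := bw j; exists n.
pose P (i : nat) K := [/\ K `<=` good, continuous_within K (fun w => L (iter i sigma w)),
  continuous_within K (fun w => L (iter i tau w)),
  exists n, K `<=` [set w | (i <= visits GP sigma n w)%N] &
  exists n, K `<=` [set w | (i <= visits GP tau n (tau w))%N]].
have hgood : hereditary (fun K => K `<=` good) by move=> K K' K'K /(subset_trans K'K).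
have hex (D : nat -> set T) : hereditary (fun K => exists n, K `<=` D n).
  by move=> K K' K'K [n nP]; exists n; exact: subset_trans nP.
have lP : lusin mu (fun K => forall i, P i K).
  apply: (lusin_bigcap polishT) => [i K K' K'K [p1 p2 p3 p4 p5]|i].
    split; [exact: hgood p1|exact: hereditary_continuous p2|exact: hereditary_continuous p3|
      exact: hex p4|exact: hex p5].
  (* The five conditions become a sequence, the last one repeated, so that one countable
     intersection imposes them all. *)
  pose S (m : nat) K := match m with 0 => K `<=` good
    | 1 => continuous_within K (fun w => L (iter i sigma w))
    | 2 => continuous_within K (fun w => L (iter i tau w))
    | 3 => exists n, K `<=` [set w | (i <= visits GP sigma n w)%N]
    | _ => exists n, K `<=` [set w | (i <= visits GP tau n (tau w))%N] end.
  have : lusin mu (fun K => forall m, S m K).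
    apply: (lusin_bigcap polishT) => [] [|[|[|[|m]]]].
    - exact: hgood.
    - exact: hereditary_continuous.
    - exact: hereditary_continuous.
    - exact: hex.
    - exact: hex.
    - exact: lgood.
    - exact: lf.
    - exact: lb.
    - exact: lvf.
    - exact: lvb.
  by apply: lusin_sub => K _ h; split; 
    [exact: h 0%N|exact: h 1%N|exact: h 2%N|exact: h 3%N|exact: h 4%N].
apply: lusin_sub lP => K _ h; split => [w Kw|n|n|j|j].
- by have [p1 _ _ _ _] := h 0%N; exact: p1.
- by have [] := h n.
- by have [] := h n.
- by have [] := h j.
- by have [] := h j.
Qed.

Section on_tame_set.
Variable K : set T.
Hypothesis tK : tame K.

Let Kgood : K `<=` good. Proof. by have [] := tK. Qed.

Lemma near_within_in (w : T) : \forall z \near within K (nbhs w), K z.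
Proof. by apply: (@filterE _ (nbhs w)). Qed.

Lemma tame_coc n : continuous_within K (fun w => coc n w).
Proof.
have [_ cf _ _ _] := tK.
elim: n => [|n IH] w Kw; first exact: cvg_cst.
by apply: blin_comp_cvg; [exact: cf|exact: IH].
Qed.

(** For [m <= n] the point [iter m sigma (iter n tau w)] is [iter (n - m) tau w], so only [L] along
    the backward orbit enters. *)
Lemma tame_pullback n : continuous_within K (fun w => coc n (iter n tau w)).
Proof.
have [_ _ cb _ _] := tK.
suff h m : (m <= n)%N -> continuous_within K (fun w => coc m (iter n tau w)) by exact: h.
elim: m => [|m IH] mn w Kw; first exact: cvg_cst.
apply: (@blin_comp_cvg _ _ _ _ _ _ _ (fun w => L (iter m sigma (iter n tau w))));
  last exact: IH (ltnW mn) _ Kw.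
have E z : iter m sigma (iter n tau z) = iter (n - m) tau z.
  rewrite -{1}(subnKC (ltnW mn)) iterD; move: (iter _ tau z) => y.
  by elim: m {mn IH} y => //= i IH y; rewrite -iterS iterSr tauK IH.
rewrite E (_ : (fun z => L _) = fun z => L (iter (n - m) tau z)); first exact: cb.
by apply/funext => z; rewrite E.
Qed.

Lemma tame_vec : continuous_within K v.
Proof.
have [_ _ _ _ nb] := tK.
move=> w Kw; apply/cvgrPdist_lt => e e0; have e30 : 0 < e / 3 by rewrite divr_gt0.
have [j0 j0P] := small_hopf_rate q1 c0 e30.
have [n nP] := nb (j0.+4 * k)%N.
have err z : K z -> `|normalize (coc n (iter n tau z) g) - v z| < e / 3.
  move=> Kz; have [h1 h2] := decay_exponent_large k0 (nP z Kz).
  by apply: le_lt_trans (split_vec_err sp (Kgood Kz) h1) _; exact: j0P.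
have : normalize (coc n (iter n tau z) g) @[z --> within K (nbhs w)] -->
    normalize (coc n (iter n tau w) g).
  have cg : coc n (iter n tau z) g @[z --> within K (nbhs w)] --> coc n (iter n tau w) g.
    by apply: blin_app_cvg; [exact: tame_pullback|exact: cvg_cst].
  apply: cvgZ => //; apply: cvgV; last exact: cvg_norm.
  rewrite normr_eq0; apply: (cone_neq0 niceC).
  by apply: cocycle_in_cone => //; exact: split_seed sp.
move=> /cvgrPdist_lt /(_ _ e30); apply: filterS2 (near_within_in w) => z Kz h.
rewrite [e](_ : _ = e / 3 + e / 3 + e / 3); last by field.
rewrite -[v w - v z](subrKA (normalize (coc n (iter n tau z) g))).
rewrite (le_lt_trans (ler_normD _ _))// ltrD ?err//.
rewrite -[v w - _](subrKA (normalize (coc n (iter n tau w) g))).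
by rewrite (le_lt_trans (ler_normD _ _))// ltrD// distrC err.
Qed.

Lemma tame_coc_vec n : continuous_within K (fun w => coc n w (v w)).
Proof. by move=> w Kw; apply: blin_app_cvg; [exact: tame_coc|exact: tame_vec]. Qed.

Lemma coc_vec_neq0 n w : K w -> `|coc n w (v w)| != 0.
Proof.
move=> Kw; rewrite normr_eq0; apply: (cone_neq0 niceC); apply: cocycle_in_cone => //.
exact: split_cone sp _ (Kgood Kw).
Qed.

Lemma tame_coc_vecV n : continuous_within K (fun w => `|coc n w (v w)|^-1).
Proof.
by move=> w Kw; apply: cvgV; [exact: coc_vec_neq0|apply: cvg_norm; exact: tame_coc_vec].
Qed.

Lemma tame_ratio n : continuous_within K (fun w => `|coc n w| / `|coc n w (v w)|).
Proof.
by move=> w Kw; apply: cvgM; [apply: cvg_norm; exact: tame_coc|exact: tame_coc_vecV].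
Qed.

Lemma tame_normalized n : continuous_within K (fun w => `|coc n w (v w)|^-1 *: coc n w).
Proof. by move=> w Kw; apply: cvgZ; [exact: tame_coc_vecV|exact: tame_coc]. Qed.

(** The values at two points are compared through the normalized operators at a common time [n],
    which depend continuously on the point in operator norm. *)
Lemma eta_cone_dist w z n0 n y : good w -> good z -> (n0 <= n)%N ->
  (2 * k <= visits GP sigma n0 w)%N -> (2 * k <= visits GP sigma n0 z)%N ->
  (C `|` [set 0]) y -> `|eta w y - eta z y| <=
    (c0 * (`|coc n0 w| / `|coc n0 w (v w)|) * t ^+ decay_exponent GP k sigma n w +
     c0 * (`|coc n0 z| / `|coc n0 z (v z)|) * t ^+ decay_exponent GP k sigma n z +
     `|(`|coc n w (v w)|^-1 *: coc n w) - (`|coc n z (v z)|^-1 *: coc n z)|) * `|y|.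
Proof.
move=> gw gz n0n nw nz Ky.
have ratio u : `|coc n u y| / `|coc n u (v u)| = `|(`|coc n u (v u)|^-1 *: coc n u) y|.
  by rewrite blinZ normrZ ger0_norm ?invr_ge0// mulrC.
have ew := eta_ratio_err (Omega := borel T) sigmaK niceC LC sp y gw n0n nw.
have ez := eta_ratio_err (Omega := borel T) sigmaK niceC LC sp y gz n0n nz.
rewrite (ger0_norm (split_eta_ge0 sp gw Ky)) ratio in ew.
rewrite (ger0_norm (split_eta_ge0 sp gz Ky)) ratio in ez.
move: ew ez; set Dw := _ *: coc n w; set Dz := _ *: coc n z => ew ez.
have ed : `| `|Dw y| - `|Dz y| | <= `|Dw - Dz| * `|y|.
  apply: le_trans (ler_dist_dist _ _) _; exact: (ler_opnorm (Dw - Dz)).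
rewrite !mulrDl -[eta w y - _](subrKA `|Dz y|) (le_trans (ler_normD _ _))//.
rewrite [leRHS]addrAC; apply: lerD => //.
rewrite -[eta w y - _](subrKA `|Dw y|) (le_trans (ler_normD _ _))//.
by apply: lerD => //; rewrite distrC.
Qed.

Lemma tame_eta : continuous_within K eta.
Proof.
have [_ _ _ nf _] := tK.
have [M [M0 Mdec]] := bounded_decomposition niceC.
move=> w Kw; apply/cvgrPdist_lt => e e0.
have [n0 n0P] := nf (2 * k)%N.
pose r z := `|coc n0 z| / `|coc n0 z (v z)|.
(* The error constant at [z] involves [r z]; continuity bounds it by [r w + 1] near [w], so the
   choice of [n] below is locally uniform. *)
have r1 : \forall z \near within K (nbhs w), r z < r w + 1.
  by apply: (cvgr_lt (r w)); [exact: tame_ratio|rewrite ltrDl].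
(* The three errors on the cone add up to [e / (4 * M)]; the decomposition of a unit vector costs a
   factor [2 * M], which leaves [e / 2]. *)
have e4 : 0 < e / (8 * M) by rewrite divr_gt0// mulr_gt0.
have [j0 j0P] := small_hopf_rate q1 (2 * c0 * (r w + 1)) e4.
have [n1 n1P] := nf (j0.+4 * k)%N.
pose n := maxn n0 n1.
have nD := tame_normalized (n := n) Kw.
move/cvgrPdist_lt: nD => /(_ _ e4) nD.
have c00 := split_const sp.
have small z : K z -> r z <= r w + 1 ->
    c0 * r z * t ^+ decay_exponent GP k sigma n z <= e / (8 * M) / 2.
  move=> Kz rz.
  have h : (j0.+4 * k <= visits GP sigma n z)%N.
    by apply: leq_trans (n1P z Kz) _; apply: visits_mono; exact: leq_maxr.
  have [_ h2] := decay_exponent_large k0 h.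
  have t0 : 0 < t by exact: hopf_rate_gt0.
  rewrite ler_pdivlMr//; apply: le_trans (ltW (j0P _ h2)).
  by rewrite mulrAC ler_pM2r ?exprn_gt0// mulrC mulrA ler_pM2l// mulr_gt0.
apply: filterS3 (near_within_in w) r1 nD => z Kz rz Dz.
apply: le_lt_trans (_ : 2 * M * (e / (8 * M) / 2 + e / (8 * M) / 2 + e / (8 * M)) < e); last first.
  rewrite [ltLHS](_ : _ = e / 2); first by rewrite ltr_pdivrMr// ltr_pMr// ltr1n.
  by field; rewrite gt_eqF.
apply: opnorm_le => x x1; have [y [y' [Ky Ky' yM y'M ->]]] := Mdec x.
pose S := e / (8 * M) / 2 + e / (8 * M) / 2 + e / (8 * M).
have S0 : 0 <= S by rewrite ltW// !addr_gt0// divr_gt0.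
have gw := Kgood Kw; have gz := Kgood Kz.
have bnd y0 : (C `|` [set 0]) y0 -> `|y0| <= M * `|x| -> `|eta w y0 - eta z y0| <= S * M.
  move=> Ky0 y0M; 
  apply: (le_trans (eta_cone_dist gw gz (leq_maxl n0 n1) (n0P w Kw) (n0P z Kz) Ky0)).
  apply: ler_pM => //.
  - by rewrite !addr_ge0// !mulr_ge0 ?exprn_ge0// ltW// ?c00 ?hopf_rate_gt0.
  - apply: lerD; last exact: ltW.
    by apply: lerD; apply: small => //; [rewrite lerDl|exact: ltW].
  - by rewrite (le_trans y0M)// ler_piMr// ltW.
have -> : (eta w - eta z) (y - y') = (eta w y - eta z y) - (eta w y' - eta z y').
  rewrite -[LHS]/(eta w (y - y') - eta z (y - y')) (raddfB (eta w)) (raddfB (eta z)).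
  by rewrite !opprD !opprK addrACA.
rewrite (le_trans (ler_normB _ _))// -/S mulrC.
rewrite [S * _]mulrA mulrAC mulrDr mulr1.
by apply: lerD; exact: bnd.
Qed.

Lemma tame_rank_one : continuous_within K (fun w => rank_one (eta w) (v w)).
Proof. by move=> w Kw; apply: rank_one_cvg; [exact: tame_eta|exact: tame_vec]. Qed.

Lemma tame_co_rank_one : continuous_within K (fun w => co_rank_one (eta w) (v w)).
Proof. by move=> w Kw; apply: co_rank_one_cvg; [exact: tame_eta|exact: tame_vec]. Qed.

Lemma tame_coc_ker n :
  continuous_within K (fun w => `|blin_comp (coc n w) (co_rank_one (eta w) (v w))|).
Proof.
by move=> w Kw; apply: cvg_norm; apply: blin_comp_cvg; [exact: tame_coc|exact: tame_co_rank_one].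
Qed.

End on_tame_set.

Lemma lusin_regular {Y : topologicalType} (f : T -> Y) A :
  (forall K, tame K -> continuous_within K f) -> full mu (A : set (borel T)) ->
  mu_continuous mu A f.
Proof.
move=> tf fA; apply: (lusin_mu_continuous polishT); apply: (lusinI polishT).
- by move=> K K' K'K /(subset_trans K'K).
- exact: hereditary_continuous.
- exact: (lusin_subset polishT sigma_compact).
- by apply: lusin_sub lusin_tame => K _; exact: tf.
Qed.

Lemma mu_continuous_regular_splitting :
  regular_splitting mu (good : set (borel T)) (mu_continuous_regularity X mu) v eta.
Proof.
move=> A fA Ag; split; apply: lusin_regular => // K tK.
- exact: tame_vec.
- exact: tame_eta.
- exact: tame_rank_one.
- exact: tame_co_rank_one.
Qed.

Lemma mu_continuous_phi :
  exists A, full mu A /\ measurable_fun (A : set (borel T)) (fun w => `|L w (v w)|).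
Proof.
apply: (lusin_measurable polishT); apply: lusin_sub lusin_tame => K _ tK w Kw.
by apply: cvg_norm; exact: (tame_coc_vec tK (n := 1) Kw).
Qed.

Lemma mu_continuous_coc_ker n : exists A, full mu A /\ measurable_fun (A : set (borel T))
  (fun w => `|blin_comp (coc n w) (co_rank_one (eta w) (v w))|).
Proof.
apply: (lusin_measurable polishT); apply: lusin_sub lusin_tame => K _ tK.
exact: tame_coc_ker.
Qed.

End mu_continuous_case.

(** * Both kinds of systems together *)

Lemma rds_ergodic (R : realType) (X : completeNormedModType R) d (Omega : measurableType d)
    (mu : probability Omega R) sigma (L : Omega -> blin X X) (reg : regularity X Omega) :
  is_rds mu sigma L reg -> ergodic_invertible mu sigma.
Proof. by case. Qed.

Lemma rds_splitting (R : realType) (X : completeNormedModType R) d (Omega : measurableType d)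
    (mu : probability Omega R) (sigma tau : Omega -> Omega) (L : Omega -> blin X X)
    (reg : regularity X Omega) (C : set X) (GP : set Omega) (k : nat) (q : R)
    (g : X) (c : R) (v : Omega -> X) (eta : Omega -> blin X R^o) :
  is_rds mu sigma L reg -> cancel sigma tau -> cancel tau sigma -> measurable_fun setT tau ->
  nice_cone C -> (forall w, [set L w x | x in C] `<=` C) ->
  measurable GP -> (0 < mu GP)%E -> (0 < k)%N -> 1 < q ->
  splitting sigma tau L C GP k q g c v eta ->
  [/\ regular_splitting mu (good sigma tau GP) reg v eta,
      exists A, full mu A /\ measurable_fun A (fun w => `|L w (v w)|) &
      forall n, exists A, full mu A /\ measurable_fun A
        (fun w => `|blin_comp (cocycle sigma L n w) (co_rank_one (eta w) (v w))|)].
Proof.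
move=> rds; case: d Omega mu sigma L reg / rds tau GP v eta => [d Omega|T] mu sigma L.
  move=> erg sX mL tau GP v eta sK tK mt niceC LC mGP GP0 k0 q1 sp.
  have [ms _ pres ergo] := erg.
  have fgood := good_full sK ms mt pres ergo mGP GP0.
  have mgood : measurable (good sigma tau GP) by have [] := fgood.
  split.
  - exact: (measurable_regular_splitting sK ms mt sX mL niceC LC k0 q1 sp mgood).
  - exists (good sigma tau GP); split => //.
    exact: (phi_measurable ms mt sX mL niceC LC k0 q1 sp mgood).
  - move=> n; exists (good sigma tau GP); split => //.
    exact: (coc_ker_measurable sK ms mt sX mL niceC LC k0 q1 sp mgood n).
move=> erg polT [cs [tau' [sK' _] ct']] muL tau GP v eta sK tK mt niceC LC mGP GP0 k0 q1 sp.
have [ms _ pres ergo] := erg.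
have tauE : tau' = tau by apply/funext => w; rewrite -[w in LHS]tK sK'.
rewrite tauE in ct'.
have fgood := good_full (Omega := borel T) sK ms mt pres ergo mGP GP0.
split.
- exact: (mu_continuous_regular_splitting
    polT cs ct' sK tK ms mt pres muL niceC LC mGP k0 q1 sp fgood).
- exact: (mu_continuous_phi polT cs ct' sK tK ms mt pres muL niceC LC mGP k0 q1 sp fgood).
- move=> n.
  exact: (mu_continuous_coc_ker polT cs ct' sK tK ms mt pres muL niceC LC mGP k0 q1 sp fgood n).
Qed.

Lemma hopf_rate_tanh {R : realType} (x : R) : hopf_rate (expR (x / 2)) = tanh (x / 4).
Proof.
rewrite /hopf_rate /tanh (_ : x / 2 = x / 4 + x / 4); last by field.
rewrite expRD expRN; have : expR (x / 4) != 0 by rewrite gt_eqF// expR_gt0.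
have : expR (x / 4) ^+ 2 + 1 != 0 by rewrite gt_eqF// ltr_wpDl// sqr_ge0.
move: (expR _) => s s1 s0; field.
by rewrite s0 -expr2.
Qed.

Theorem theoremA (R : realType) (X : completeNormedModType R)
    (d : measure_display) (Omega : measurableType d)
    (mu : probability Omega R) (sigma : Omega -> Omega)
    (L : Omega -> blin X X) (reg : regularity X Omega)
    (rds : is_rds mu sigma L reg)
    (log_int : ae_integrable mu (fun w => log_plus `|L w|))
    (C : set X) (niceC : nice_cone C)
    (LC : forall w, [set L w x | x in C] `<=` C)
    (GP : set Omega) (mGP : measurable GP) (GP_gt0 : (0 < mu GP)%E)
    (kP : nat) (kP_gt0 : (0 < kP)%N) (DP : R) (DP_gt0 : 0 < DP)
    (contraction : forall w, GP w ->
      (proj_diam C [set cocycle sigma L kP w x | x in C] <= DP%:E)%E) :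
  exists lambda1 : \bar R,
    is_max_lyapunov_exponent mu sigma L lambda1 /\
  exists Omega' : set Omega,
    [/\ measurable Omega', mu Omega' = 1%E & sigma @^-1` Omega' = Omega'] /\
  exists (v : Omega -> X) (eta : Omega -> blin X R^o),
    (* (1) *)
    [/\ reg_vec reg Omega' v,
        reg_dual reg Omega' eta,
        forall w, Omega' w -> v w != 0 /\ direct_sum (line (v w)) (ker (eta w)),
        exists P Q : Omega -> blin X X,
          [/\ reg_op reg Omega' P, reg_op reg Omega' Q &
              forall w, Omega' w ->
                projection_along (line (v w)) (ker (eta w)) (P w) /\
                projection_along (ker (eta w)) (line (v w)) (Q w)] &
        forall w, Omega' w ->
          [set L w x | x in line (v w)] `<=` line (v (sigma w)) /\
          [set L w x | x in ker (eta w)] `<=` ker (eta (sigma w))] /\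
    (forall w, Omega' w -> lyapunov_exponent sigma L w (v w) = lambda1) /\
    (lambda1 != -oo%E -> forall w, Omega' w -> forall x, ker (eta w) x ->
      (lyapunov_exponent sigma L w x < lambda1)%E) /\
    (* (2) *)
    exists lambda2 : \bar R,
      (forall w, Omega' w ->
        growth_rate_on sigma L (ker (eta w)) w = lambda2) /\
      (lambda1 != -oo%E ->
        lambda2 <= lambda1
          - (fine (mu GP) / kP%:R * ln (tanh (DP / 4))^-1)%:E)%E.
Proof.
have [msigma [tau [sigmaK tauK] mtau] pres erg] := rds_ergodic rds.
(* The diameter bounds ratios by [expR DP], which is the [q ^+ 2] of the contraction lemmas, and
   [hopf_rate q] is then [tanh (DP / 4)]. *)
pose q : R := expR (DP / 2).
have q1 : 1 < q by rewrite -expR0 ltr_expR divr_gt0.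
have q2 : q ^+ 2 = expR DP by rewrite expr2 -expRD; congr expR; field.
have GPq w : GP w -> forall x y, C x -> C y ->
    exists2 l, 0 < l & cone_le C (l *: cocycle sigma L kP w x) (cocycle sigma L kP w y) /\
      cone_le C (cocycle sigma L kP w y) ((q ^+ 2 * l) *: cocycle sigma L kP w x).
  move=> GPw x y Cx Cy; rewrite q2; apply: (proj_diam_bound niceC _ (contraction w GPw)) => //.
  by move=> z Cz; exact: cocycle_in_cone.
have [g [c [v [eta sp]]]] := splitting_exists sigmaK tauK niceC LC kP_gt0 q1 GPq.
have [regs mphi mQ] := rds_splitting rds sigmaK tauK mtau niceC LC mGP GP_gt0 kP_gt0 q1 sp.
have [l1 [l2 [A [[fA invA Ag l1y] [lnorm [lv [lk [gap lker]]]]]]]] :=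
  lyapunov_structure sigmaK msigma mtau pres erg log_int niceC LC mGP GP_gt0 kP_gt0 q1 sp mphi mQ.
have [regv regeta regP regQ] := regs A fA Ag.
have [mA A1] := fA.
exists l1; split; first by split => //; exact: full_ae fA lnorm.
exists A; split => //; exists v, eta; split; [split => //|split => //; split => //].
- by move=> w Aw; apply: rank_one_decomposition; apply: (split_eta1 sp); exact: Ag.
- exists (fun w => rank_one (eta w) (v w)), (fun w => co_rank_one (eta w) (v w)); split => // w Aw.
  by apply: rank_one_projections; apply: (split_eta1 sp); exact: Ag.
- move=> w Aw; have gw := Ag w Aw; split => _ [x xP <-].
    case: xP => a _ <-; rewrite linearZ /= (split_vec sp gw) scalerA.
    by exists (a * `|L w (v w)|).
  exact: split_ker sp _ _ gw xP.
- by exists l2; split => //; rewrite -hopf_rate_tanh.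
Qed.
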